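(* There is a sufficiently large absolute constant $C_0$ such that the following holds, for streams whose final frequency vector is interpreted as an $n\times n$ matrix $\mathbf M$ (one coordinate per entry) and $W\ge n^{C_0}$: (1) (Eigenvalue approximation) Assume $n=\Omega(\epsilon^{-2})$. Any randomized turnstile streaming algorithm that, on every unit update turnstile stream of length at most $W$, outputs additive $\epsilon\|\mathbf M\|_F$ approximations to all eigenvalues of $\mathbf M$ with success probability at least $2/3$ must use $\Omega(\epsilon^{-4}\log W)$ bits of space. (2) (PSD testing) Fix $p\ge1$. Any randomized turnstile streaming algorithm that, on every unit update turnstile stream of length at most $W$, distinguishes the case $\mathbf M\succeq 0$ from the case $\lambda_{\min}(\mathbf M)\le-\epsilon\|\mathbf M\|_p$ (Schatten-$p$ norm) with success probability at least $2/3$ must use $\Omega(\min\{\epsilon^{-2p},n^2\}\log W)$ bits for $p\in[1,2]$, $\Omega(\min\{\epsilon^{-4}n^{2-4/p},n^2\}\log W)$ bits for $p\in(2,\infty)$, and $\Omega(n^2\log W)$ bits for $p=\infty$.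
   Context: A unit update turnstile stream is a sequence of updates $(i,\Delta)$ with $\Delta\in\{\pm1\}$, each adding $\Delta$ to coordinate $i$ of a vector starting at $0$; the final frequency vector is the vector at the end. A randomized streaming algorithm using $S$ bits is a public-coin family of deterministic streaming algorithms each with at most $2^S$ memory states; the seed is not counted toward the space and success probability is over the seed for each fixed stream. $\|\cdot\|_F$ is the Frobenius norm and $\|\cdot\|_p$ the Schatten-$p$ norm. *)

(* Defs.v *)
From HB Require Import structures.
From mathcomp Require Import all_boot all_order all_algebra.
From mathcomp Require Import all_classical all_reals all_analysis.
From mathcomp Require Import polyrcf.
Set Implicit Arguments.
Unset Strict Implicit.
Unset Printing Implicit Defensive.
Import Order.TTheory GRing.Theory Num.Theory.
Import numFieldNormedType.Exports.
Local Open Scope classical_set_scope.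
Local Open Scope ring_scope.

(* [(i, b)] stands for the update [(i, Delta)] with [Delta = (-1) ^+ b]. *)
Definition unit_update (I : Type) : Type := (I * bool)%type.

Definition unit_stream (I : Type) : Type := seq (unit_update I).

Definition frequency (I : finType) (s : unit_stream I) (i : I) : int :=
  \sum_(u <- s | u.1 == i) (-1) ^+ u.2.

Record det_algorithm (I : finType) (O : Type) := DetAlgorithm {
  mem_state : finType;
  mem_init : mem_state;
  mem_update : mem_state -> unit_update I -> mem_state;
  mem_output : mem_state -> O
}.

Definition run (I : finType) (O : Type) (A : det_algorithm I O)
    (s : unit_stream I) : O :=
  mem_output (foldl (@mem_update I O A) (mem_init A) s).

(* Some randomized algorithm using [S] bits answers correctly, with probability
   at least 2/3 on each fixed unit update stream of length at most [W].
   [correct f o] says that [o] is an acceptable answer when the final frequency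
   vector is [f]. The seed lives in an arbitrary probability space and is not
   counted as memory. *)
Definition turnstile_solvable (R : realType) (I : finType) (O : Type)
    (correct : (I -> int) -> O -> Prop) (W S : nat) : Prop :=
  exists (d : measure_display) (Omega : measurableType d)
         (P : probability Omega R) (A : Omega -> det_algorithm I O),
    (forall w : Omega, (#|mem_state (A w)| <= 2 ^ S)%N) /\
    (forall s : unit_stream I, (size s <= W)%N ->
       let success := [set w | correct (frequency s) (run (A w) s)] in
       measurable success /\ ((2 / 3)%:E <= P success)%E).

Definition matrix_of (R : realType) (n : nat) (f : 'I_n * 'I_n -> int) :
  'M[R]_n := \matrix_(i, j) (f (i, j))%:~R.

(* The real eigenvalues, in nondecreasing order and repeated according to
   algebraic multiplicity; for a symmetric matrix these are all of them. *)
Definition eigenvalues (R : realType) (n : nat) (M : 'M[R]_n) : seq R :=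
  flatten [seq nseq (mup x (char_poly M)) x | x <- rootsR (char_poly M)].

Definition lambda_min (R : realType) (n : nat) (M : 'M[R]_n) : R :=
  head 0 (eigenvalues M).

Definition psd (R : realType) (n : nat) (M : 'M[R]_n) : Prop :=
  M^T = M /\ forall x : 'cV[R]_n, 0 <= (x^T *m M *m x) 0 0.

Definition frobenius_norm (R : realType) (n : nat) (M : 'M[R]_n) : R :=
  Num.sqrt (\sum_(i < n) \sum_(j < n) M i j ^+ 2).

Definition singular_values (R : realType) (n : nat) (M : 'M[R]_n) : seq R :=
  [seq Num.sqrt x | x <- eigenvalues (M^T *m M)].

(* Only meant for [1 <= p]; the value at [-oo] is junk. *)
Definition schatten_norm (R : realType) (n : nat) (p : \bar R) (M : 'M[R]_n) :
    R :=
  match p with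
  | q%:E => (\sum_(x <- singular_values M) x `^ q) `^ q^-1
  | +oo%E => \big[Num.max/0]_(x <- singular_values M) x
  | -oo%E => 0
  end.

(* Eigenvalues and positive semidefiniteness are notions for symmetric matrices,
   so nothing is required of the answer on streams whose final matrix is not
   symmetric. The approximations may be listed in any order. *)
Definition eigenvalue_approximation (R : realType) (n : nat) (eps : R)
    (f : 'I_n * 'I_n -> int) (out : 'rV[R]_n) : Prop :=
  let M := matrix_of R f in
  M^T = M ->
  exists2 lam : n.-tuple R, perm_eq lam (eigenvalues M) &
    forall i : 'I_n, `|out 0 i - tnth lam i| <= eps * frobenius_norm M.

(* [true] stands for "positive semidefinite". The zero matrix satisfies
   [lambda_min M <= - eps * schatten_norm p M] as well as [psd M]; it has to be
   accepted, since otherwise no algorithm could satisfy the specification. *)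
Definition psd_test (R : realType) (n : nat) (eps : R) (p : \bar R)
    (f : 'I_n * 'I_n -> int) (out : bool) : Prop :=
  let M := matrix_of R f in
  M^T = M ->
  (psd M -> out = true) /\
  (M <> 0 -> lambda_min M <= - eps * schatten_norm p M -> out = false).

(* Main.v *)
(** The hard inputs are a symmetric [d x d] matrix of discrete Gaussian noise,
    shifted to be positive semidefinite, and the same matrix minus a rank one
    spike [a u u^T] with random signs [u], where [a] is just large enough for the
    spike to create a very negative eigenvalue. Before the noise, the stream
    receives many uniform vectors of the box [{0..B-1}^D], [D] being the number of
    entries above the diagonal; the final segment of the stream subtracts their
    sum, so that this padding does not change the final matrix.

    The law of the padding given the memory state has entropy at most [D ln m],
    so at a typical time a further increment gains almost no entropy. That law is
    then almost invariant under the differences of a set [A] of at least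
    [2 ^ - S B ^ D] box vectors (up to a constant factor). A maximal determinant
    basis of [A] spans, with small coefficients, everything up to an orthogonal
    projection [P] of rank [r = O(S / ln B)]: the algorithm essentially only sees
    the image of its input under [P].

    The noise hides the image of the spike under [P] as soon as the chi-square sum
    [E exp <z P, z'> / sigma^2] over independent spikes [z], [z'] is close to [1].
    By decoupling, this Rademacher chaos is close to [1] unless [r] is of order
    [d ^ 2]. Hence [S] is of order [d ^ 2 ln B], where [B] is a power of [W], and
    the four bounds follow by choosing [d]. *)

Require Import Defs.
From HB Require Import structures.
From mathcomp Require Import all_boot all_order all_algebra.
From mathcomp Require Import all_classical all_reals all_analysis.
From mathcomp Require Import measurable_realfun polyrcf complex.
From mathcomp Require Import ring lra zify.
Set Implicit Arguments.
Unset Strict Implicit.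
Unset Printing Implicit Defensive.
Import Order.TTheory GRing.Theory Num.Theory.
Import numFieldNormedType.Exports.
Local Open Scope ring_scope.

(** * Entropy and almost invariance *)

(** Both problems enter only through [separates]: a correct answer tells a form between 0 and
    [kappa] from such a form minus [a u u^T] as soon as [a d] exceeds [kappa (1 + e) / (1 - eps1)].
    Here [e] is the accuracy lost on the bounded part: [2 eps sqrt d] for eigenvalues, [eps d^(1/p)]
    for Schatten norms, [eps] for infinite [p]. Noise entries of standard deviation [B^2 sqrt d]
    give an operator norm O(B^2 d), so [a] can be O(B^2 (1 + e)), and the chi-square exponent stays
    small while the rank is below a constant times d^2 / (1 + e)^4. This ratio times [ln W] is the
    general bound. Invariance holds only along integer combinations of increments, so a spike is
    replaced by its projection up to an error of [D B] per entry; the noise must be far wider than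
    the box to absorb it. Partial sums live in Z/m so that their entropy is bounded, with [m] so
    large that nothing wraps around. When [d] is not large compared with [1 + e], the gap leaves no
    room, but then the ratio is O(1) and a one-entry instance supplies the factor [ln W]. *)

Lemma dist_le_kl (R : realType) (k a b : R) : 0 < k -> 0 <= a -> 0 <= b ->
  (b = 0 -> a = 0) ->
  `|a - b| <= k * (a + b) + (a * (ln a - ln b) - a + b) / (2 * k).
Proof.
move=> k0 a0 b0 ab.
have [b00|bn0] := eqVneq b 0.
  by rewrite b00 (ab b00) !(subrr, mul0r, addr0, normr0, mulr0, subr0).
have bp : 0 < b by rewrite lt_def bn0.
pose x := Num.sqrt a; pose y := Num.sqrt b.
have ax : a = x ^+ 2 by rewrite sqr_sqrtr.
have by_ : b = y ^+ 2 by rewrite sqr_sqrtr.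
have x0 : 0 <= x by exact: sqrtr_ge0.
have yp : 0 < y by rewrite sqrtr_gt0.
(* The squared Hellinger distance is at most the divergence term: [ln z <= z - 1] at
   [z = sqrt (b / a)], doubled. *)
have hell : (x - y) ^+ 2 <= a * (ln a - ln b) - a + b.
  have [a00|an0] := eqVneq a 0.
    by rewrite {1}/x a00 sqrtr0 sub0r sqrrN -by_ mul0r subrr add0r.
  have ap : 0 < a by rewrite lt_def an0.
  have xp : 0 < x by rewrite sqrtr_gt0.
  have lnab : ln b - ln a <= 2 * (y / x - 1).
    rewrite -ln_div ?posrE //.
    have -> : b / a = (y / x) ^+ 2 by rewrite ax by_ expr_div_n.
    rewrite lnXn ?divr_gt0 // -[ln _ *+ 2]mulr_natl ler_pM2l ?ltr0n //.
    have := @le_ln1Dx R (y / x - 1).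
    rewrite [1 + _]addrC subrK; apply.
    by have := divr_gt0 yp xp; lra.
  have : a * (ln b - ln a) <= a * (2 * (y / x - 1)) by rewrite ler_pM2l.
  have -> : a * (2 * (y / x - 1)) = 2 * (x * y) - 2 * a.
    by rewrite ax; field; rewrite gt_eqF.
  rewrite by_; have -> : (x - y) ^+ 2 = a - 2 * (x * y) + y ^+ 2 by rewrite ax; ring.
  by rewrite -by_; lra.
(* The arithmetic-geometric inequality, with weight [k] on the sum of the roots, separates the mass
   [a + b] from the divergence. *)
have -> : a - b = (x - y) * (x + y) by rewrite ax by_; ring.
set h := (X in _ + X / _); have {}hell : (x - y) ^+ 2 <= h by exact: hell.
have k2 : 0 < 2 * k by lra.
suff : `|(x - y) * (x + y)| * (2 * k) <= k * (a + b) * (2 * k) + h.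
  rewrite -ler_pdivlMr // => /le_trans; apply.
  by rewrite mulrDl mulfK ?gt_eqF.
have e1 : (k * (x + y)) ^+ 2 <= k * (a + b) * (2 * k).
  rewrite ax by_.
  have -> : k * (x ^+ 2 + y ^+ 2) * (2 * k) =
    (k * (x + y)) ^+ 2 + (k * (x - y)) ^+ 2 by ring.
  by rewrite lerDl sqr_ge0.
have : `|(x - y) * (x + y)| * (2 * k) <= (k * (x + y)) ^+ 2 + (x - y) ^+ 2.
  rewrite normrM (ger0_norm (addr_ge0 x0 (ltW yp))).
  have -> : (x - y) ^+ 2 = `|x - y| ^+ 2 by rewrite real_normK ?num_real.
  have := sqr_ge0 (k * (x + y) - `|x - y|); lra.
by lra.
Qed.

Section Entropy.
Variables (R : realType) (V : finZmodType).
Implicit Types p : V -> R.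

Definition distr p := (forall s, 0 <= p s) /\ \sum_s p s = 1.

Definition entropy p : R := - \sum_s p s * ln (p s).

(** A point with [q s = 0 < p s] contributes a finite value here instead of infinity, which is why
    the inequalities below assume that [p] vanishes wherever [q] does. *)
Definition kl_div p q : R := \sum_s p s * (ln (p s) - ln (q s)).

(** Pinsker's inequality with a worse constant: summing the pointwise bound with [k = t / 4], the
    masses and the divergence contribute [t / 2] each. *)
Lemma tv_le_kl t p q : 0 < t -> distr p -> distr q ->
  (forall s, q s = 0 -> p s = 0) -> kl_div p q <= t ^+ 2 / 4 ->
  \sum_s `|p s - q s| <= t.
Proof.
move=> t0 [p0 p1] [q0 q1] pq kl.
have k0 : 0 < t / 4 by lra.
apply: (@le_trans _ _ (\sum_s (t / 4 * (p s + q s) +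
    (p s * (ln (p s) - ln (q s)) - p s + q s) / (2 * (t / 4))))).
  by apply: ler_sum => s _; apply: dist_le_kl => //; apply: pq.
rewrite big_split /= -mulr_sumr -mulr_suml big_split /= p1 q1.
rewrite !big_split /= sumrN p1 q1 -[X in _ + (X - 1 + 1) / _]/(kl_div p q).
rewrite subrK.
have : kl_div p q / (2 * (t / 4)) <= t / 2.
  by rewrite ler_pdivrMr; lra.
lra.
Qed.

Lemma kl_div_ge0 p q : distr p -> distr q ->
  (forall s, q s = 0 -> p s = 0) -> 0 <= kl_div p q.
Proof.
move=> [p0 p1] [q0 q1] pq.
have : \sum_s (p s - q s) <= kl_div p q.
  apply: ler_sum => s _.
  have [qs|qs] := eqVneq (q s) 0; first by rewrite (pq _ qs) qs subrr mul0r.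
  have [ps|ps] := eqVneq (p s) 0; first by rewrite ps sub0r mul0r oppr_le0.
  have pp : 0 < p s by rewrite lt_def ps p0.
  have qp : 0 < q s by rewrite lt_def qs q0.
  have := @le_ln1Dx R (q s / p s - 1).
  rewrite [1 + _]addrC subrK ln_div ?posrE // => H.
  have {}H : ln (q s) - ln (p s) <= q s / p s - 1.
    by apply: H; have := divr_gt0 qp pp; lra.
  have : p s * (ln (q s) - ln (p s)) <= p s * (q s / p s - 1) by rewrite ler_pM2l.
  have -> : p s * (q s / p s - 1) = q s - p s by field.
  lra.
by rewrite big_split /= sumrN p1 q1 subrr.
Qed.

Lemma entropy_le p : distr p -> entropy p <= ln #|V|%:R.
Proof.
move=> dp; have [p0 p1] := dp.
have V0 : (0 < #|V|)%N by apply/card_gt0P; exists 0.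
pose u (s : V) : R := #|V|%:R^-1.
have du : distr u.
  split=> [s|]; first by rewrite invr_ge0.
  by rewrite sumr_const -[X in X *+ _]mulr1 -mulrnAr mulVf ?pnatr_eq0 -?lt0n.
have un s : u s = 0 -> p s = 0.
  by move/eqP; rewrite invr_eq0 pnatr_eq0 -leqn0 leqNgt V0.
have := kl_div_ge0 dp du un.
rewrite /kl_div /entropy.
under eq_bigr do rewrite mulrBr.
rewrite /u big_split /= sumrN -mulr_suml p1 mul1r lnV ?posrE ?ltr0n // opprK.
lra.
Qed.

Lemma entropy_shift p (h : V) : entropy (fun s => p (s - h)) = entropy p.
Proof.
rewrite /entropy (reindex_inj (addIr h)) /=.
by congr (- _); apply: eq_bigr => s _; rewrite addrK.
Qed.

Lemma distr_shift p (h : V) : distr p -> distr (fun s => p (s - h)).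
Proof.
move=> [p0 p1]; split => // .
by rewrite (reindex_inj (addIr h)) /= -[RHS]p1; apply: eq_bigr => s _; rewrite addrK.
Qed.

Section Conv.
Variables (X : finType) (iota : X -> V).

Definition conv (A : {set X}) p (s : V) : R :=
  #|A|%:R^-1 * \sum_(x in A) p (s - iota x).

Lemma distr_conv (A : {set X}) p : A != finset.set0 -> distr p -> distr (conv A p).
Proof.
move=> A0 dp; have [p0 p1] := dp; split => [s|].
  by apply: mulr_ge0; [rewrite invr_ge0|apply: sumr_ge0].
rewrite /conv -mulr_sumr exchange_big /=.
under eq_bigr do rewrite (distr_shift _ dp).2.
by rewrite sumr_const mulVf // pnatr_eq0 cards_eq0.
Qed.

Lemma conv_eq0 (A : {set X}) p x s : x \in A -> distr p -> conv A p s = 0 ->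
  p (s - iota x) = 0.
Proof.
move=> xA [p0 _] /eqP; rewrite mulf_eq0 invr_eq0 pnatr_eq0 => /orP[|].
  by rewrite cards_eq0 => /eqP A0; rewrite A0 inE in xA.
by rewrite psumr_eq0 // => /allP/(_ x); rewrite mem_index_enum xA => /(_ isT)/eqP.
Qed.

(** All shifts of [p] have the same entropy, so the entropy gained by mixing them is the average
    divergence of a shift from the mixture. *)
Lemma entropy_conv (A : {set X}) p : A != finset.set0 -> distr p ->
  entropy (conv A p) - entropy p =
  #|A|%:R^-1 * \sum_(x in A) kl_div (fun s => p (s - iota x)) (conv A p).
Proof.
move=> A0 dp.
have An : #|A|%:R != 0 :> R by rewrite pnatr_eq0 cards_eq0.
rewrite /kl_div; under eq_bigr => x _.
  under eq_bigr do rewrite mulrBr.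
  rewrite big_split /= sumrN -[X in X - _]opprK.
  rewrite -[X in - X - _]/(entropy (fun s => p (s - iota x))) entropy_shift.
  over.
rewrite big_split /= sumr_const sumrN exchange_big /= mulrDr.
rewrite -[(- entropy p) *+ _]mulr_natl mulrA mulVf // mul1r addrC.
congr (_ + _); rewrite mulrN /entropy mulr_sumr; congr (- _).
by apply: eq_bigr => s _; rewrite -mulr_suml mulrA.
Qed.

(** By Markov, at least half of the shifts have at most twice the average divergence, that is
    [t ^+ 2 / 16]. Each of them is within [t / 2] of the mixture, hence any two are within [t] of
    each other. *)
Lemma almost_invariant t (A : {set X}) p : 0 < t -> A != finset.set0 -> distr p ->
  entropy (conv A p) - entropy p <= t ^+ 2 / 32 ->
  exists2 A' : {set X}, (A' \subset A) && (#|A| <= 2 * #|A'|)%N &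
    {in A' &, forall x y, \sum_s `|p (s - iota x) - p (s - iota y)| <= t}.
Proof.
move=> t0 A0 dp; rewrite entropy_conv // => H.
have t2 : 0 < t / 2 by lra.
have Ap : 0 < #|A|%:R :> R by rewrite ltr0n card_gt0.
pose K x := kl_div (fun s => p (s - iota x)) (conv A p).
have K0 x : x \in A -> 0 <= K x.
  move=> xA; apply: kl_div_ge0; [exact: distr_shift|exact: distr_conv|].
  by move=> s; exact: conv_eq0.
pose A' := [set x in A | K x <= t ^+ 2 / 16].
have sA : A' \subset A by apply/fintype.subsetP => x; rewrite inE => /andP[].
exists A'.
  rewrite sA /=.
  have : #|A :\: A'|%:R * (t ^+ 2 / 16) <= #|A|%:R * (t ^+ 2 / 32).
    rewrite -[X in X%:R * _]sum1_card natr_sum mulr_suml.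
    apply: (@le_trans _ _ (\sum_(x in A) K x)); last by rewrite -ler_pdivrMl.
    rewrite [leRHS](big_setID A') /= [leLHS](_ : _ = 0 + \sum_(x in A :\: A') (t ^+ 2 / 16)).
      apply: lerD; first by apply: sumr_ge0 => x; rewrite inE => /andP[xA _]; exact: K0.
      apply: ler_sum => x; rewrite !inE negb_and => /andP[] + xA.
      by rewrite xA /= -ltNge => /ltW.
    by rewrite add0r; apply: eq_bigr => x _; rewrite mul1r.
  have tt : 0 < t ^+ 2 by rewrite exprn_gt0.
  have -> : #|A|%:R * (t ^+ 2 / 32) = (#|A|%:R / 2) * (t ^+ 2 / 16) by field.
  rewrite ler_pM2r ?divr_gt0 // ler_pdivlMr // -natrM ler_nat.
  by have := cardsID A' A; rewrite (finset.setIidPr sA); lia.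
move=> x y; rewrite !inE => /andP[xA Kx] /andP[yA Ky].
have cl z : z \in A -> K z <= t ^+ 2 / 16 ->
    \sum_s `|p (s - iota z) - conv A p s| <= t / 2.
  move=> zA Kz; apply: tv_le_kl => //; [exact: distr_shift|exact: distr_conv| |].
    by move=> s; exact: conv_eq0.
  by rewrite -/(K z); lra.
apply: (@le_trans _ _ (\sum_s `|p (s - iota x) - conv A p s| +
                       \sum_s `|p (s - iota y) - conv A p s|)).
  rewrite -big_split /=; apply: ler_sum => s _.
  by rewrite [`|p (s - iota y) - _|]distrC; apply: ler_distD.
have := cl x xA Kx; have := cl y yA Ky; lra.
Qed.

End Conv.
End Entropy.

(** * Distinguishing advantage along a trajectory of memory states *)

Section Trajectory.
Variables (R : realType) (V : finZmodType) (X Q : finType) (iota : X -> V).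
Variables (step : Q -> X -> Q) (out : Q -> V -> R) (nu : V -> R).
Hypothesis X_gt0 : (0 < #|X|)%N.
Hypothesis out01 : forall q y, 0 <= out q y <= 1.
Implicit Type p : V -> R.

(* Expected output from the state [q] after [k] uniform increments, when the
   last vector to be added is [y] minus their sum. *)
Fixpoint expect k q y : R :=
  if k is k'.+1 then #|X|%:R^-1 * \sum_x expect k' (step q x) (y - iota x)
  else out q y.

(** [nu] will be the spiked law minus the unspiked law of the target vector and [p] the law of the
    partial sum given the state, so this is the advantage of the test [U], which sees only the
    difference of target and partial sum. *)
Definition bilin p (U : V -> R) : R := \sum_s \sum_m p s * nu m * U (m - s).

Lemma expect01 k q y : 0 <= expect k q y <= 1.
Proof.
elim: k q y => [|k IH] q y //=; apply/andP; split.
  by apply: mulr_ge0; rewrite ?invr_ge0 // sumr_ge0 // => x _; case/andP: (IH (step q x) (y - iota x)).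
rewrite ler_pdivrMl ?ltr0n // mulr1 -[X in X%:R]sum1_card natr_sum.
by apply: ler_sum => x _; case/andP: (IH (step q x) (y - iota x)).
Qed.

Lemma bilin_conv (A : {set X}) p (U : V -> R) :
  bilin (conv iota A p) U =
  bilin p (fun y => #|A|%:R^-1 * \sum_(x in A) U (y - iota x)).
Proof.
rewrite /bilin exchange_big [RHS]exchange_big /=; apply: eq_bigr => m _.
transitivity (\sum_(x in A) \sum_s #|A|%:R^-1 * (p (s - iota x) * nu m * U (m - s))).
  rewrite exchange_big /=; apply: eq_bigr => s _.
  by rewrite /conv mulr_sumr !mulr_suml; apply: eq_bigr => x _; rewrite !mulrA.
transitivity (\sum_(x in A) \sum_s #|A|%:R^-1 * (p s * nu m * U (m - s - iota x))).
  apply: eq_bigr => x _; rewrite (reindex_inj (addIr (iota x))) /=.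
  by apply: eq_bigr => s _; rewrite addrK opprD addrA.
rewrite exchange_big /=; apply: eq_bigr => s _.
by rewrite !mulr_sumr; apply: eq_bigr => x _; ring.
Qed.

(** The next increment is uniform and independent of the past; conditioning on the new state [q']
    restricts it to the fibre of [q'], so the law of the partial sum becomes a convolution. *)
Lemma bilin_step k q p :
  bilin p (expect k.+1 q) =
  \sum_q' #|[set x | step q x == q']|%:R / #|X|%:R *
     bilin (conv iota [set x | step q x == q'] p) (expect k q').
Proof.
pose A q' := [set x | step q x == q'].
under [RHS]eq_bigr => q' _ do rewrite bilin_conv.
transitivity (\sum_s \sum_q' \sum_m p s * nu m * (#|X|%:R^-1 *
    \sum_(x | step q x == q') expect k (step q x) (m - s - iota x))).
  apply: eq_bigr => s _; rewrite exchange_big /=; apply: eq_bigr => m _.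
  by rewrite (partition_big (step q) xpredT) //= !mulr_sumr.
rewrite exchange_big /=; apply: eq_bigr => q' _.
rewrite /bilin mulr_sumr; apply: eq_bigr => s _.
rewrite mulr_sumr; apply: eq_bigr => m _.
have [A0|A0] := eqVneq (A q') finset.set0.
  rewrite -/(A q') A0 cards0 mul0r mul0r big1 ?mulr0 // => x xq.
  have : x \in A q' by rewrite inE xq.
  by rewrite A0 inE.
have An : #|A q'|%:R != 0 :> R by rewrite pnatr_eq0 cards_eq0.
rewrite -/(A q').
have -> : \sum_(x | step q x == q') expect k (step q x) (m - s - iota x) =
          \sum_(x in A q') expect k q' (m - s - iota x).
  by apply: eq_big => [x|x /eqP -> //]; rewrite inE.
have Xn : #|X|%:R != 0 :> R by rewrite pnatr_eq0 -lt0n.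
by field; rewrite An Xn.
Qed.

Variables (t tau : R).
Hypothesis t_gt0 : 0 < t.
Hypothesis tau_ge0 : 0 <= tau.
Hypothesis bilin_le1 : forall p (U : V -> R), distr p -> (forall y, 0 <= U y <= 1) ->
  `|bilin p U| <= 1.
Hypothesis bilin_good : forall p (A : {set X}) (U : V -> R), distr p ->
  (#|X| <= 40 * #|Q| * #|A|)%N ->
  {in A &, forall x y, \sum_s `|p (s - iota x) - p (s - iota y)| <= t} ->
  (forall y, 0 <= U y <= 1) -> `|bilin p U| <= tau.

(** Each term pays for one case. A small fibre costs the trivial bound 1; an entropy gain above
    [t ^+ 2 / 32] makes the last term exceed 1; otherwise half of the fibre consists of almost
    invariant shifts, and this halving turns 20 into the 40 of [bilin_good]. *)
Lemma bilin_conv_bound (A : {set X}) p (U : V -> R) : distr p -> A != finset.set0 ->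
  (forall y, 0 <= U y <= 1) ->
  `|bilin (conv iota A p) U| <=
    (#|X| > 20 * #|Q| * #|A|)%N%:R + tau +
    (entropy (conv iota A p) - entropy p) / (t ^+ 2 / 32).
Proof.
move=> dp A0 U01.
have i0 : 0 < t ^+ 2 / 32 by rewrite divr_gt0 ?exprn_gt0.
have dc : distr (conv iota A p) by exact: distr_conv.
pose E : R := (entropy (conv iota A p) - entropy p) / (t ^+ 2 / 32).
have H0 : 0 <= E.
  apply: divr_ge0 (ltW i0); rewrite entropy_conv //.
  apply: mulr_ge0; rewrite ?invr_ge0 //; apply: sumr_ge0 => x xA.
  by apply: kl_div_ge0 => //; [exact: distr_shift|move=> s; exact: conv_eq0].
have b1 := bilin_le1 dc U01.
rewrite -/E.
case: ltnP => Abig.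
  by apply: (le_trans b1); rewrite -addrA lerDl addr_ge0.
case: (lerP (entropy (conv iota A p) - entropy p) (t ^+ 2 / 32)) => Hs; last first.
  have : 1 <= E.
    by rewrite ler_pdivlMr // mul1r ltW.
  by move=> E1; apply: (le_trans b1); apply: le_trans E1 _; rewrite lerDr add0r.
have [A' /andP[sA cA] inv] := almost_invariant t_gt0 A0 dp Hs.
have : `|bilin (conv iota A p) U| <= tau.
  (* The invariance is known for [p] and not for its convolution, so the averaging is moved to the
     test function. *)
  rewrite bilin_conv; apply: (bilin_good dp _ inv).
    by apply: leq_trans Abig _; rewrite -mulnA; nia.
  move=> y; apply/andP; split.
    by apply: mulr_ge0; rewrite ?invr_ge0 // sumr_ge0 // => x _; case/andP: (U01 (y - iota x)).
  rewrite ler_pdivrMl ?ltr0n ?card_gt0 // mulr1 -[X in X%:R]sum1_card natr_sum.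
  by apply: ler_sum => x _; case/andP: (U01 (y - iota x)).
by move=> b2; apply: (le_trans b2); rewrite add0r lerDl.
Qed.

(* Along a trajectory of states, either the partial sum gains entropy, which
   happens rarely since the entropy is at most [ln #|V|], or its law is almost
   invariant under many shifts, and then [bilin_good] applies. *)
Theorem bilin_trajectory k q p : distr p ->
  k%:R * `|bilin p (expect k q)| <=
    k%:R * (20^-1 + tau) + (ln #|V|%:R - entropy p) / (t ^+ 2 / 32).
Proof.
have i0 : 0 < t ^+ 2 / 32 by rewrite divr_gt0 ?exprn_gt0.
elim: k q p => [|k IH] q p dp.
  rewrite !mul0r add0r; apply: divr_ge0 (ltW i0).
  by rewrite subr_ge0; exact: entropy_le.
pose A q' := [set x | step q x == q'].
pose w q' : R := #|A q'|%:R / #|X|%:R.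
have X0 : 0 < #|X|%:R :> R by rewrite ltr0n.
have w0 q' : 0 <= w q' by rewrite divr_ge0.
have w1 : \sum_q' w q' = 1.
  rewrite -mulr_suml -natr_sum.
  suff -> : (\sum_q' #|A q'| = #|X|)%N by rewrite mulfV ?gt_eqF.
  rewrite -sum1_card (partition_big (step q) xpredT) //=.
  by apply: eq_bigr => q' _; rewrite sum1_card; apply: eq_card => x; rewrite inE.
pose p' q' := conv iota (A q') p.
pose small q' : R := (#|X| > 20 * #|Q| * #|A q'|)%N%:R.
rewrite bilin_step -/w.
(* There are at most [#|Q|] small fibres, each of weight at most [1 / (20 #|Q|)]. *)
have wsmall : \sum_q' w q' * small q' <= 20^-1.
  apply: (@le_trans _ _ (\sum_(q' : Q) (20 * #|Q|%:R)^-1)).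
    apply: ler_sum => q' _; rewrite /small; case: ltnP => h; last first.
      by rewrite mulr0 invr_ge0 mulr_ge0.
    rewrite mulr1 /w ler_pdivrMr // mulrC ler_pdivlMr; last first.
      by rewrite mulr_gt0 // ltr0n; apply/card_gt0P; exists q.
    by rewrite mulrC -!natrM ler_nat ltnW.
  rewrite sumr_const -[_ *+ _]mulr_natr invfM.
  rewrite -mulrA mulVf ?mulr1 // pnatr_eq0 -lt0n.
  by apply/card_gt0P; exists q.
(* Of the [k.+1] copies of the advantage at [q'], [k] are bounded by induction, which charges the
   entropy still to be gained, and one directly, which charges the gain of this step. The two
   charges telescope. *)
have term q' : k.+1%:R * (w q' * `|bilin (p' q') (expect k q')|) <=
   w q' * (k%:R * (20^-1 + tau) + tau + (ln #|V|%:R - entropy p) / (t ^+ 2 / 32))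
   + w q' * small q'.
  have [A0|A0] := eqVneq (A q') finset.set0.
    by rewrite /w A0 cards0 !mul0r mulr0 addr0.
  have h1 := IH q' (p' q') (distr_conv iota A0 dp).
  have h2 := bilin_conv_bound dp A0 (expect01 k q').
  rewrite mulrCA -mulrDr ler_wpM2l // -natr1 mulrDl mul1r.
  apply: (le_trans (lerD h1 h2)).
  rewrite -/(p' q') -/(small q') !mulrBl; lra.
apply: (@le_trans _ _ (\sum_q' k.+1%:R * (w q' * `|bilin (p' q') (expect k q')|))).
  rewrite -mulr_sumr ler_wpM2l //; apply: le_trans (ler_norm_sum _ _ _) _.
  by apply: ler_sum => q' _; rewrite normrM (ger0_norm (w0 q')).
apply: le_trans (ler_sum _ (fun q' _ => term q')) _.
rewrite big_split /= -mulr_suml w1 mul1r.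
have -> : k.+1%:R = k%:R + 1 :> R by rewrite natr1.
by rewrite [(_ + 1) * _]mulrDl mul1r; lra.
Qed.

End Trajectory.

(** * Barycentric spanners and the projection that remains visible *)

Section Spanner.
Variables (R : realType) (D B : nat).
Implicit Type x : {ffun 'I_D -> 'I_B}.

Definition row_of x : 'rV[R]_D := \row_e (x e)%:R.

(** Cramer's rule in row form. *)
Lemma det_replace_row (M M' : 'M[R]_D) j : M \in unitmx ->
  (forall i, i != j -> row i M' = row i M) ->
  \det M' = \det M * (row j M' *m invmx M) 0 j.
Proof.
move=> uM rM; rewrite /invmx uM -scalemxAr mxE mulrA mulfV; last first.
  by rewrite unitmxE unitfE in uM.
rewrite mul1r (expand_det_row _ j) mxE; apply: eq_bigr => k _.
rewrite !mxE; congr (_ * _); rewrite /cofactor; congr (_ * \det _).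
apply/matrixP => a b; rewrite !mxE.
have /rowP/(_ (lift k b)) : row (lift j a) M' = row (lift j a) M.
  by apply: rM; rewrite eq_sym neq_lift.
by rewrite !mxE.
Qed.

Variables (A : {set {ffun 'I_D -> 'I_B}}) (x0 : {ffun 'I_D -> 'I_B}).
Hypothesis x0A : x0 \in A.

Let T := ({ffun 'I_D -> 'I_B} + 'I_D)%type.

(** Adding the unit vectors guarantees a nonsingular choice of rows even when [A] spans little; the
    number of unit vectors in the optimal choice will be the rank of the projection. *)
Definition cand_row (c : T) : 'rV[R]_D :=
  match c with
  | inl h => if h \in A then row_of h - row_of x0 else 0
  | inr i => delta_mx 0 i
  end.

Definition cand_mx (c : {ffun 'I_D -> T}) : 'M[R]_D := \matrix_j cand_row (c j).

(** At a choice maximizing the absolute determinant, exchanging a row for any candidate cannot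
    increase it; by Cramer's rule the exchange ratio is the coefficient of the candidate on that
    row. *)
Lemma barycentric_spanner : exists2 c : {ffun 'I_D -> T}, cand_mx c \in unitmx &
  forall tau j, `|(cand_row tau *m invmx (cand_mx c)) 0 j| <= 1.
Proof.
pose c0 : {ffun 'I_D -> T} := [ffun j => inr j].
pose F (c : {ffun 'I_D -> T}) := `|\det (cand_mx c)|.
case: (@Order.TotalTheory.arg_maxP _ _ _ c0 xpredT F isT) => c _ cmax.
have F0 : F c0 = 1.
  rewrite /F (_ : cand_mx c0 = 1%:M) ?det1 ?normr1 //.
  by apply/row_matrixP => j; rewrite rowK ffunE /= rowE mulmx1.
have Fc : 0 < F c by apply: lt_le_trans (cmax c0 isT); rewrite F0.
have uc : cand_mx c \in unitmx by rewrite unitmxE unitfE -normr_gt0.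
exists c => // tau j.
pose c' := [ffun k => if k == j then tau else c k].
have := cmax c' isT; rewrite /F (@det_replace_row _ (cand_mx c') j uc); last first.
  by move=> i ij; rewrite !rowK ffunE (negbTE ij).
rewrite rowK ffunE eqxx normrM.
by move=> le_det; rewrite -(ler_pM2l Fc) mulr1.
Qed.

(* [r] basis vectors of the spanner are coordinate vectors: the other coordinates
   of a point of [A] determine these [r] ones up to an error of at most [2]. *)
Lemma spanner_projection : exists (r : nat) (P : 'M[R]_D)
    (h : 'I_D -> {ffun 'I_D -> 'I_B}),
  [/\ (#|A| * B ^ r <= B ^ D * 3 ^ r)%N, P^T = P, P *m P = P, \tr P = r%:R &
   (forall j, h j \in A) /\
   forall x : 'rV[R]_D, exists2 c : 'I_D -> R,
     x - x *m P = \sum_j c j *: (row_of (h j) - row_of x0) &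
     forall j, `|c j| <= \sum_e `|(x - x *m P) 0 e|].
Proof.
have [c uc cb] := barycentric_spanner.
set M := cand_mx c in uc cb *.
pose isr (y : T) := if y is inr _ then true else false.
pose J := [set j | isr (c j)].
pose idx j := if c j is inr i then i else j.
have rowM j : row j M = cand_row (c j) by rewrite rowK.
have rowI j : row j M *m invmx M = delta_mx 0 j.
  by rewrite rowE -mulmxA mulmxV // mulmx1.
have cJ j : j \in J -> c j = inr (idx j).
  by rewrite inE /isr /idx; case: (c j).
have idx_inj : {in J &, injective idx}.
  move=> j j' jJ j'J e.
  have : row j M = row j' M by rewrite !rowM (cJ _ jJ) (cJ _ j'J) e.
  move/(congr1 (mulmx^~ (invmx M))); rewrite !rowI => /rowP/(_ j).
  by rewrite !mxE !eqxx /=; case: eqP => // _ /eqP; rewrite oner_eq0.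
pose I := [set idx j | j in J].
have cI : #|I| = #|J| by rewrite card_in_imset.
pose r := #|J|.
have deltaI j : j \in J -> delta_mx 0 (idx j) *m invmx M = delta_mx 0 j :> 'rV_D.
  by move=> jJ; rewrite -[RHS]rowI rowM (cJ _ jJ).
(* A coordinate of [I] of [x - y] is the spanner coefficient on the corresponding unit vector. Both
   [x - x0] and [y - x0] have coefficients of size at most 1, so their difference has size at most
   2. *)
have key x y : x \in A -> y \in A -> (forall e, e \notin I -> x e = y e) ->
    forall e, (x e <= y e + 2)%N.
  move=> xA yA agree e.
  have [/imsetP[j jJ ->]|/agree ->] := boolP (e \in I); last exact: leq_addr.
  have h1 : row_of x - row_of y =
      \sum_(j in J) ((x (idx j))%:R - (y (idx j))%:R) *: delta_mx 0 (idx j).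
    apply/rowP => e'; rewrite summxE !mxE.
    have [/imsetP[k kJ ->]|e'I] := boolP (e' \in I).
      rewrite (bigD1 k) //= !mxE !eqxx /= mulr1 big1 ?addr0 // => k' /andP[k'J kk'].
      rewrite !mxE eqxx /=; case: eqP => [/idx_inj|_]; last by rewrite mulr0.
      by move/(_ kJ k'J)=> ee; rewrite ee eqxx in kk'.
    rewrite agree // subrr big1 // => k kJ; rewrite !mxE eqxx /=.
    case: eqP => [ee|_]; last by rewrite mulr0.
    by rewrite ee imset_f in e'I.
  have h2 : ((row_of x - row_of y) *m invmx M) 0 j =
      (x (idx j))%:R - (y (idx j))%:R.
    rewrite h1 mulmx_suml summxE (bigD1 j) //= -scalemxAl deltaI // !mxE !eqxx mulr1.
    rewrite big1 ?addr0 // => k /andP[kJ kj]; rewrite -scalemxAl deltaI // !mxE eqxx.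
    by rewrite eq_sym (negbTE kj) mulr0.
  have := cb (inl x) j; have := cb (inl y) j; rewrite /= xA yA => b1 b2.
  have : `|((row_of x - row_of y) *m invmx M) 0 j| <= 2.
    have -> : row_of x - row_of y = (row_of x - row_of x0) - (row_of y - row_of x0).
      by rewrite opprB addrA subrK.
    rewrite mulmxBl !mxE; move: b1 b2; rewrite !mxE => b1 b2.
    by apply: le_trans (ler_normB _ _) _; apply: le_trans (lerD b2 b1) _.
  rewrite h2 ler_norml => /andP[_]; rewrite lerBlDl -natrD ler_nat addnC.
  by rewrite addnC.
(* A point of [A] and an arbitrary filling of the [r] coordinates in [I] are encoded by the filled
   point and the residues mod 3 of the erased coordinates. The encoding is injective: by [key],
   erased values compatible with the rest differ by at most 2. *)
have count : (#|A| * B ^ r <= B ^ D * 3 ^ r)%N.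
  pose S := {i | i \in I}.
  have cS : #|{: S}| = r by rewrite card_sig /r -cI; apply: eq_card.
  pose ov x (g : {ffun S -> 'I_B}) : {ffun 'I_D -> 'I_B} :=
    [ffun e => if insub e is Some i then g i else x e].
  pose md x : {ffun S -> 'I_3} := [ffun i => inZp (x (val i))].
  pose f (z : {ffun 'I_D -> 'I_B} * {ffun S -> 'I_B}) := (ov z.1 z.2, md z.1).
  have finj : {in finset.setX A [set: {ffun S -> 'I_B}] &, injective f}.
    move=> [x g] [y g']; rewrite !inE !andbT /= => xA yA [/ffunP e1 /ffunP e2].
    have agree e : e \notin I -> x e = y e.
      by move=> eI; have := e1 e; rewrite !ffunE insubN.
    have k1 := key x y xA yA agree.
    have k2 := key y x yA xA (fun e h => esym (agree e h)).
    have -> : x = y.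
      apply/ffunP => e; have [eI|/agree //] := boolP (e \in I).
      have /(congr1 val) /= := e2 (exist _ e eI); rewrite !ffunE /= => mm.
      apply: val_inj; have := k1 e; have := k2 e; move: mm => /=.
      by move: (x e : nat) (y e : nat) => a b; lia.
    congr (_, _); apply/ffunP => i; have := e1 (val i).
    by rewrite !ffunE valK.
  have := card_in_imset finj; rewrite cardsX cardsT card_ffun card_ord cS => <-.
  apply: leq_trans (max_card _) _.
  by rewrite card_prod !card_ffun !card_ord cS.
pose m := #|~: J|.
have mr : (m + r = D)%N by rewrite /m /r addnC cardsC card_ord.
pose H : 'M[R]_(m, D) := \matrix_(k < m) row (enum_val k) M.
have rowH k : row k H *m invmx M = delta_mx 0 (enum_val k).
  by rewrite rowK rowI.
have Hfree (u : 'rV[R]_m) : u *m H = 0 -> u = 0.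
  move=> uH; apply/rowP => k.
  have /rowP/(_ (enum_val k)) : u *m H *m invmx M = 0 by rewrite uH mul0mx.
  rewrite [u *m H]mulmx_sum_row mulmx_suml summxE (bigD1 k) //= -scalemxAl rowH.
  rewrite !mxE !eqxx mulr1 big1 ?addr0 // => k' kk'.
  rewrite -scalemxAl rowH !mxE eqxx /= (inj_eq enum_val_inj) eq_sym (negbTE kk').
  by rewrite mulr0.
pose G := H *m H^T.
have uG : G \in unitmx.
  rewrite -row_free_unit; apply: inj_row_free => u uG0.
  apply: Hfree; have : (u *m H) *m (u *m H)^T = 0.
    by rewrite trmx_mul -mulmxA (mulmxA H) -/G mulmxA uG0 mul0mx.
  move/matrixP/(_ 0 0); rewrite !mxE => /eqP; rewrite psumr_eq0; last first.
    by move=> i _; rewrite [X in _ * X]mxE -expr2 sqr_ge0.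
  move=> /allP z; apply/rowP => i; have := z i (mem_index_enum i).
  by rewrite /= [X in _ * X]mxE -expr2 sqrf_eq0 [RHS]mxE => /eqP.
have GT : G^T = G by rewrite trmx_mul trmxK.
(* The orthogonal projection onto the span of the spanner rows coming from [A], by the Gram matrix;
   [P] is the complementary one. *)
pose N := H^T *m invmx G *m H.
have NT : N^T = N by rewrite !trmx_mul trmxK trmx_inv GT mulmxA.
have NN : N *m N = N.
  rewrite /N !mulmxA -(mulmxA _ H H^T) -/G -(mulmxA _ G) mulmxV // mulmx1.
  by [].
pose P := 1%:M - N.
pose h j := if c j is inl y then if y \in A then y else x0 else x0.
exists r, P, h; split => //.
- by rewrite /P linearB /= trmx1 NT.
- by rewrite /P mulmxBr mulmx1 mulmxBl mul1mx NN subrr subr0.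
- rewrite /P linearB /= mxtrace1 /N mxtrace_mulC mulmxA -/G mulmxV // mxtrace1.
  by rewrite -mr natrD addrAC subrr add0r.
split=> [j|x].
  by rewrite /h; case: (c j) => // y; case: ifP.
have xP : x - x *m P = (x *m H^T *m invmx G) *m H.
  by rewrite /P mulmxBr mulmx1 opprB addrCA subrr addr0 /N !mulmxA.
pose a := (x - x *m P) *m invmx M.
(* [x - x *m P] lies in the span of the rows from [A], so unit vectors do not occur in its
   expansion. *)
have aJ j : j \in J -> a 0 j = 0.
  move=> jJ; rewrite /a xP [_ *m H]mulmx_sum_row mulmx_suml summxE big1 // => k _.
  rewrite -scalemxAl rowH !mxE eqxx /=; case: eqP => [jk|_]; last by rewrite mulr0.
  by have := enum_valP k; rewrite -jk inE jJ.
exists (fun j => a 0 j).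
  rewrite -[LHS](mulmxKV uc) -/a [a *m M]mulmx_sum_row.
  apply: eq_bigr => j _; have [jJ|jJ] := boolP (j \in J); first by rewrite aJ // !scale0r.
  congr (_ *: _); rewrite rowM /h; move: jJ; rewrite inE /isr.
  case: (c j) => // y _ /=; case: ifP => // _; by rewrite subrr.
(* The unit vectors are candidates too, so each has coefficients of size at most 1; expand [v] in
   them. *)
move=> j; rewrite /a; set v := x - x *m P.
rewrite [X in `|X|](_ : _ = \sum_e v 0 e * (cand_row (inr e) *m invmx M) 0 j).
  apply: le_trans (ler_norm_sum _ _ _) _; apply: ler_sum => e _.
  by rewrite normrM -[leRHS]mulr1 ler_wpM2l.
rewrite mxE; apply: eq_bigr => e _; congr (_ * _).
by rewrite /= -rowE mxE.
Qed.

End Spanner.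

(** * Discrete Gaussian noise *)

Section CenteredResidue.
Variable m : nat.
Hypothesis m_gt1 : (1 < m)%N.

Lemma intr_Zp_eq0 (i : int) : (i%:~R == 0 :> 'Z_m) = (m %| `|i|)%N.
Proof.
have nat_case n : ((n%:R : 'Z_m) == 0) = (m %| n)%N.
  by rewrite -val_eqE /= val_Zp_nat.
by case: i => n /=; rewrite ?NegzE ?mulrNz ?oppr_eq0 nat_case.
Qed.

Definition crep (v : 'Z_m) : int :=
  if (v.*2 < m)%N then (v : nat)%:Z else (v : nat)%:Z - m%:Z.

Lemma crepK v : (crep v)%:~R = v.
Proof.
rewrite /crep; case: ifP => _; first by rewrite -pmulrn natr_Zp.
rewrite rmorphB /= -!pmulrn natr_Zp.
suff -> : m%:R = 0 :> 'Z_m by rewrite subr0.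
by apply/eqP; rewrite pmulrn intr_Zp_eq0 /=.
Qed.

Lemma crep_bound v : (2 * `|crep v| <= m)%N.
Proof. by rewrite /crep; have := ltn_ord v; rewrite [in X in (_ < X)%N]Zp_cast //; case: ifP; lia. Qed.

Lemma intr_Zp_inj (i j : int) : (`|i - j| < m)%N -> i%:~R = j%:~R :> 'Z_m -> i = j.
Proof.
move=> ij /eqP; rewrite -subr_eq0 -rmorphB /= intr_Zp_eq0 => /dvdnP[k e].
by move: ij; rewrite e; case: k e => [|k] e; [lia|rewrite mulSn; lia].
Qed.

Lemma crep_intr (i : int) : (2 * `|i| < m)%N -> crep i%:~R = i.
Proof.
move=> hi; apply: intr_Zp_inj; last exact: crepK.
have := crep_bound i%:~R; lia.
Qed.

End CenteredResidue.

Definition gval (L : nat) (i : 'I_(2 * L).+1) : int := (i : nat)%:Z - L%:Z.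

Lemma gval_bound (L : nat) (i : 'I_(2 * L).+1) : (`|gval i| <= L)%N.
Proof. by have := ltn_ord i; rewrite /gval; lia. Qed.

Section DiscreteGaussian.
Variables (R : realType) (L : nat) (s2 : R).
Hypothesis s2_gt0 : 0 < s2.

Definition gauss (i : int) : R := expR (- (i%:~R ^+ 2) / (2 * s2)).

Definition gnorm : R := \sum_(i < (2 * L).+1) gauss (gval i).

Lemma gauss_gt0 i : 0 < gauss i. Proof. exact: expR_gt0. Qed.

Lemma gauss_mono i j : (`|i| <= `|j|)%N -> gauss j <= gauss i.
Proof.
move=> ij; rewrite /gauss ler_expR ler_pM2r ?invr_gt0 ?mulr_gt0 // lerN2.
rewrite -[_ ^+ 2](@real_normK R) ?num_real // -[leRHS](@real_normK R) ?num_real //.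
rewrite lerXn2r ?nnegrE // -!intr_norm ler_int; lia.
Qed.

Lemma gaussN i : gauss (- i) = gauss i.
Proof. by rewrite /gauss rmorphN sqrrN. Qed.

Lemma gnorm_ge1 : 1 <= gnorm.
Proof.
have h : (L < (2 * L).+1)%N by lia.
rewrite /gnorm (bigD1 (Ordinal h)) //= /gval /= subrr {1}/gauss expr0n /= oppr0 mul0r.
by rewrite expR0 lerDl; apply: sumr_ge0 => i _; exact: expR_ge0.
Qed.

Lemma gnorm_gt0 : 0 < gnorm. Proof. exact: lt_le_trans gnorm_ge1. Qed.

(** Each unit shift away from the centre exchanges an end term of the window for a term farther from
    0; reflection treats the negative shifts. *)
Lemma gauss_window (k : int) : \sum_(i < (2 * L).+1) gauss (gval i - k) <= gnorm.
Proof.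
pose F (k : int) := \sum_(i < (2 * L).+1) gauss (gval i - k).
have refl j : F (- j) = F j.
  rewrite /F (reindex_inj rev_ord_inj) /=; apply: eq_bigr => i _.
  rewrite -gaussN /gval /=; congr gauss.
  by have := ltn_ord i; lia.
have dec (n : nat) : F n%:Z <= gnorm.
  elim: n => [|n IH]; first by rewrite /F; under eq_bigr do rewrite subr0.
  apply: le_trans IH; rewrite /F big_ord_recl [leRHS]big_ord_recr /= addrC.
  rewrite lerD //; first by apply: gauss_mono; rewrite /gval /=; lia.
  apply: ler_sum => i _; apply: gauss_mono; rewrite /gval /= /bump /=; lia.
by case: k => n; [exact: dec|rewrite NegzE -/(F _) refl; exact: dec].
Qed.

Lemma gauss_shift2 (i a b : int) :
  gauss (i - a) * gauss (i - b) / gauss i =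
  expR (a%:~R * b%:~R / s2) * gauss (i - (a + b)).
Proof.
have s2n : s2 != 0 by rewrite gt_eqF.
rewrite /gauss -expRN -!expRD; congr expR.
rewrite !(rmorphB, rmorphD) /=.
by field.
Qed.

Lemma gauss_mgf (k : int) :
  \sum_(i < (2 * L).+1) gauss (gval i) * expR (k%:~R * (gval i)%:~R / s2) <=
  expR (k%:~R ^+ 2 / (2 * s2)) * gnorm.
Proof.
have s2n : s2 != 0 by rewrite gt_eqF.
apply: le_trans (ler_wpM2l (expR_ge0 _) (gauss_window k)).
rewrite mulr_sumr; apply: ler_sum => i _; rewrite le_eqVlt; apply/orP; left.
apply/eqP; rewrite /gauss -!expRD; congr expR.
by rewrite intrB; field.
Qed.

Variable m : nat.
Hypothesis m_gt1 : (1 < m)%N.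
Hypothesis m_big : (4 * L < m)%N.

Definition gdens1 (v : 'Z_m) : R :=
  gnorm^-1 * \sum_(i < (2 * L).+1) ((gval i)%:~R == v)%:R * gauss (gval i).

Lemma sum_gdens1 (F : 'Z_m -> R) :
  \sum_v gdens1 v * F v = gnorm^-1 * \sum_(i < (2 * L).+1) gauss (gval i) * F (gval i)%:~R.
Proof.
rewrite /gdens1; under eq_bigr => v _ do rewrite -mulrA mulr_suml.
rewrite -mulr_sumr exchange_big /=; congr (_ * _); apply: eq_bigr => i _.
rewrite (bigD1 ((gval i)%:~R : 'Z_m)) //= eqxx mul1r big1 ?addr0 // => v.
by rewrite eq_sym => /negbTE ->; rewrite !mul0r.
Qed.

Lemma gdens1_ge0 v : 0 <= gdens1 v.
Proof.
apply: mulr_ge0; first by rewrite invr_ge0 (le_trans _ gnorm_ge1).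
by apply: sumr_ge0 => i _; rewrite mulr_ge0 // expR_ge0.
Qed.

Lemma sum_gdens1_eq1 : \sum_v gdens1 v = 1.
Proof.
have := sum_gdens1 (fun=> 1); under eq_bigr do rewrite mulr1.
move=> ->; under eq_bigr do rewrite mulr1.
by rewrite mulVf // gt_eqF // gnorm_gt0.
Qed.

Lemma gdens1_val (i : 'I_(2 * L).+1) : gdens1 (gval i)%:~R = gauss (gval i) / gnorm.
Proof.
rewrite /gdens1 mulrC (bigD1 i) //= eqxx mul1r big1 ?addr0 // => j ji.
case: eqP => [/intr_Zp_inj e|_]; last by rewrite mul0r.
suff ij : j = i by rewrite ij eqxx in ji.
apply/val_inj => /=; have : gval j = gval i.
  by apply: e => //; have := gval_bound i; have := gval_bound j; lia.
rewrite /gval; lia.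
Qed.

Lemma gdens1_le (j : int) : (`|j| + L < m)%N -> gdens1 j%:~R <= gauss j / gnorm.
Proof.
move=> jm.
case: (pickP (fun i : 'I_(2 * L).+1 => (gval i)%:~R == j%:~R :> 'Z_m)) => [i /eqP/intr_Zp_inj e|none].
  by rewrite -e ?gdens1_val //; have := gval_bound i; lia.
rewrite /gdens1 big1 ?mulr0; last by move=> i _; rewrite none mul0r.
by rewrite divr_ge0 ?expR_ge0 // (le_trans _ gnorm_ge1).
Qed.

(** Completing the square. Since division by 0 gives 0, the sum ignores points outside the support
    of the unshifted law; the mass that the shifts put there is bounded in [gdens1_tail]. *)
Lemma gdens1_chi (a b : int) : (`|a| <= L)%N -> (`|b| <= L)%N ->
  \sum_(v : 'Z_m) gdens1 (v - a%:~R) * gdens1 (v - b%:~R) / gdens1 v <=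
  expR (a%:~R * b%:~R / s2).
Proof.
move=> aL bL; have g0 := gnorm_gt0.
apply: (@le_trans _ _ (\sum_(i < (2 * L).+1) gdens1 ((gval i)%:~R - a%:~R) *
    gdens1 ((gval i)%:~R - b%:~R) / gdens1 (gval i)%:~R)).
  rewrite le_eqVlt; apply/orP; left; apply/eqP.
  transitivity (\sum_(v : 'Z_m) gdens1 v * (gdens1 (v - a%:~R) * gdens1 (v - b%:~R)
      / gdens1 v ^+ 2)).
    apply: eq_bigr => v _; have [->|v0] := eqVneq (gdens1 v) 0.
      by rewrite invr0 mulr0 mul0r.
    by field.
  rewrite sum_gdens1 mulr_sumr; apply: eq_bigr => i _.
  have gi : gauss (gval i) != 0 by rewrite gt_eqF // gauss_gt0.
  have gn : gnorm != 0 by rewrite gt_eqF.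
  by rewrite gdens1_val; field; rewrite gi gn.
apply: (@le_trans _ _ (\sum_(i < (2 * L).+1) expR (a%:~R * b%:~R / s2) *
   (gauss (gval i - (a + b)) / gnorm))).
  apply: ler_sum => i _; rewrite mulrA -gauss_shift2 gdens1_val.
  have gi := gauss_gt0 (gval i).
  have ha : gdens1 ((gval i)%:~R - a%:~R) <= gauss (gval i - a) / gnorm.
    by rewrite -rmorphB; apply: gdens1_le; have := gval_bound i; lia.
  have hb : gdens1 ((gval i)%:~R - b%:~R) <= gauss (gval i - b) / gnorm.
    by rewrite -rmorphB; apply: gdens1_le; have := gval_bound i; lia.
  apply: (@le_trans _ _ ((gauss (gval i - a) / gnorm) * (gauss (gval i - b) / gnorm)
      / (gauss (gval i) / gnorm))).
    rewrite ler_wpM2r ?invr_ge0 ?divr_ge0 ?(ltW gi) ?(ltW g0) //.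
    by rewrite ler_pM ?gdens1_ge0.
  rewrite le_eqVlt; apply/orP; left; apply/eqP; field.
  by rewrite !gt_eqF.
rewrite -mulr_sumr -mulr_suml -[leRHS]mulr1 ler_wpM2l ?expR_ge0 //.
by rewrite ler_pdivrMr // mul1r gauss_window.
Qed.

(** A shift by at most [L / 2] leaves the support only from a point of modulus at least [L / 2],
    whose weight is at most the exponential on the right. *)
Lemma gdens1_tail (a : int) : (2 * `|a| <= L)%N ->
  \sum_(v : 'Z_m | gdens1 v == 0) gdens1 (v - a%:~R) <=
  (2 * L).+1%:R * expR (- (L%:R ^+ 2) / (8 * s2)).
Proof.
move=> aL.
have -> : \sum_(v : 'Z_m | gdens1 v == 0) gdens1 (v - a%:~R) =
    \sum_v gdens1 v * (gdens1 (v + a%:~R) == 0)%:R.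
  rewrite big_mkcond (reindex_inj (addIr (a%:~R : 'Z_m))) /=.
  by apply: eq_bigr => v _; rewrite addrK; case: eqP; rewrite ?mulr1 ?mulr0.
rewrite sum_gdens1 ler_pdivrMl ?gnorm_gt0 //.
apply: (@le_trans _ _ ((2 * L).+1%:R * expR (- (L%:R ^+ 2) / (8 * s2)))); last first.
  rewrite -[leLHS]mul1r ler_wpM2r ?gnorm_ge1 // mulr_ge0 ?expR_ge0 //.
rewrite -[X in X%:R * _]card_ord -sum1_card natr_sum mulr_suml.
apply: ler_sum => i _; rewrite mul1r.
case: eqP => [e|_]; last by rewrite mulr0 expR_ge0.
rewrite mulr1; have [big|small] := leqP (absz (gval i + a)%R) L.
  have hi : (absz (gval i + a + L%:Z)%R < (2 * L).+1)%N by lia.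
  have gi : gval (Ordinal hi) = gval i + a by rewrite {1}/gval /=; lia.
  move: e; rewrite -rmorphD /= -gi gdens1_val => /eqP.
  by rewrite gt_eqF // divr_gt0 ?gauss_gt0 ?gnorm_gt0.
rewrite /gauss ler_expR ler_pdivrMr ?mulr_gt0 // mulrAC ler_pdivlMr ?mulr_gt0 //.
rewrite !mulNr lerN2.
have hL : (L <= 2 * `|gval i|)%N by lia.
have : L%:R ^+ 2 <= (2 * `|gval i|)%:R ^+ 2 :> R by rewrite lerXn2r ?nnegrE ?ler_nat.
have -> : (2 * `|gval i|)%:R ^+ 2 = 4 * (gval i)%:~R ^+ 2 :> R.
  rewrite natrM exprMn -natrX; congr (_ * _).
  by rewrite -[RHS](@real_normK R) ?num_real // -intr_norm -abszE pmulrn.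
by move: s2_gt0; nra.
Qed.

End DiscreteGaussian.

(** * Rademacher chaos *)

Section Rademacher.
Variable R : realType.

(** The sharp constant is 1/2. With 2 a quadratic bound on [expR] suffices for [|x| <= 1/2], and
    beyond that [|x| <= 2 x^2]. *)
Lemma cosh_le (x : R) : (expR x + expR (- x)) / 2 <= expR (2 * x ^+ 2).
Proof.
have expub (y : R) : y <= 1 / 2 -> expR y <= 1 + y + 2 * y ^+ 2.
  move=> y2; have y1 : 0 < 1 - y by lra.
  have /(ler_wpM2l (expR_ge0 y)) : 1 - y <= expR (- y) by exact: expR_ge1Dx.
  rewrite expRxMexpNx_1 => h.
  have : expR y <= (1 - y)^-1 by rewrite -[leRHS]mul1r ler_pdivlMr.
  move/le_trans; apply; rewrite -[leLHS]mul1r ler_pdivrMr //.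
  have -> : (1 + y + 2 * y ^+ 2) * (1 - y) = 1 + (y ^+ 2) * (1 - 2 * y) by ring.
  by rewrite lerDl mulr_ge0 ?sqr_ge0 //; lra.
have [xs|xb] := lerP `|x| (1 / 2).
  move: xs; rewrite ler_norml => /andP[x1 x2].
  have := expub x x2; have := expub (- x).
  rewrite sqrrN => /(_ _)/le_trans H1 H2.
  apply: (@le_trans _ _ (1 + 2 * x ^+ 2)); last exact: expR_ge1Dx.
  have : expR (- x) <= 1 - x + 2 * x ^+ 2 by apply: H1 => //; lra.
  by lra.
have le1 (y : R) : `|y| = `|x| -> expR y <= expR (2 * x ^+ 2).
  move=> yx; rewrite ler_expR; apply: le_trans (ler_norm _) _; rewrite yx.
  rewrite -[x ^+ 2]real_normK ?num_real //.
  have := normr_ge0 x; nra.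
have := le1 x erefl; have := le1 (- x) (normrN x); lra.
Qed.

Variable I : finType.
Implicit Type u : {ffun I -> bool}.

Definition sgn u i : R := (-1) ^+ u i.

Definition flip i u : {ffun I -> bool} := [ffun j => (j == i) (+) u j].

Lemma flipK i : involutive (flip i).
Proof. by move=> u; apply/ffunP => j; rewrite !ffunE; case: (j == i); case: (u j). Qed.

Lemma sgn_flip i u j : sgn (flip i u) j = (if j == i then - sgn u j else sgn u j).
Proof.
by rewrite /sgn ffunE; case: eqP => // _; case: (u j); rewrite ?expr0 ?expr1 ?opprK.
Qed.

Lemma sgn_sqr u i : sgn u i * sgn u i = 1.
Proof. by rewrite /sgn -expr2 sqrr_sign. Qed.

Lemma sum_flip i (F : {ffun I -> bool} -> R) :
  \sum_u F u = \sum_u (F u + F (flip i u)) / 2.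
Proof.
rewrite -mulr_suml big_split /=.
have -> : \sum_u F (flip i u) = \sum_u F u.
  by rewrite [RHS](reindex_inj (inv_inj (flipK i))).
lra.
Qed.

Lemma sum_sgn_prod i j : \sum_u sgn u i * sgn u j = (i == j)%:R * #|{ffun I -> bool}|%:R.
Proof.
have [->|ij] := eqVneq i j.
  by under eq_bigr do rewrite sgn_sqr; rewrite sumr_const mul1r.
rewrite mul0r (sum_flip i) big1 // => u _.
by rewrite !sgn_flip eqxx eq_sym (negbTE ij); lra.
Qed.

(** The hypotheses say that [g] and the coefficients do not depend on the signs in [S], so these
    signs can be averaged out one at a time by [cosh_le]. *)
Lemma rademacher_linear (S : seq I) (a : I -> {ffun I -> bool} -> R)
    (g : {ffun I -> bool} -> R) : uniq S ->
  (forall i u, i \in S -> g (flip i u) = g u) ->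
  (forall i j u, i \in S -> j \in S -> a j (flip i u) = a j u) ->
  \sum_u expR (\sum_(i <- S) sgn u i * a i u + g u) <=
  \sum_u expR (\sum_(i <- S) 2 * a i u ^+ 2 + g u).
Proof.
elim: S g => [|i S IH] g /=; first by under eq_bigr do rewrite big_nil; under [leRHS]eq_bigr do rewrite big_nil.
move=> /andP[iS uS] hg ha.
pose g' u := 2 * a i u ^+ 2 + g u.
apply: (@le_trans _ _ (\sum_u expR (\sum_(j <- S) sgn u j * a j u + g' u))).
  rewrite [leLHS](sum_flip i); apply: ler_sum => u _.
  pose h := \sum_(j <- S) sgn u j * a j u + g u.
  have -> : \sum_(j <- i :: S) sgn u j * a j u + g u = sgn u i * a i u + h.
    by rewrite big_cons addrA.
  have -> : \sum_(j <- i :: S) sgn (flip i u) j * a j (flip i u) + g (flip i u) =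
            - (sgn u i * a i u) + h.
    rewrite big_cons sgn_flip eqxx ha ?mem_head // mulNr hg ?mem_head // -addrA.
    congr (_ + (_ + _)); rewrite big_seq [RHS]big_seq; apply: eq_bigr => j jS.
    rewrite sgn_flip ha ?mem_head // ?inE ?jS ?orbT //.
    by case: eqP jS => // ->; rewrite (negbTE iS).
  rewrite !(expRD _ h) -mulrDl mulrAC.
  have -> : expR (\sum_(j <- S) sgn u j * a j u + g' u) =
            expR (2 * a i u ^+ 2) * expR h.
    by rewrite -expRD /g' /h; congr expR; ring.
  rewrite ler_wpM2r ?expR_ge0 //; apply: le_trans (cosh_le _) _.
  by rewrite exprMn expr2 sgn_sqr mul1r.
apply: le_trans (IH g' uS _ _) _.
- move=> j u jS; rewrite /g' ha ?mem_head ?inE ?jS ?orbT // hg // inE jS orbT //.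
- by move=> j k u jS kS; rewrite ha // inE ?jS ?kS orbT.
by apply: ler_sum => u _; rewrite ler_expR big_cons /g'; lra.
Qed.

(** Averaging out one sign gives the same problem for the remaining vectors with a slightly larger
    [th]. The form [th / (1 - 8 th N)] of the exponent is chosen to be stable under this update. *)
Lemma rademacher_sqnorm (K : finType) (q : I -> K -> R) (S : seq I) (th : R) :
  uniq S -> 0 <= th -> 8 * th * (\sum_(j <- S) \sum_k q j k ^+ 2) < 1 ->
  \sum_u expR (th * \sum_k (\sum_(j <- S) sgn u j * q j k) ^+ 2) <=
  #|{ffun I -> bool}|%:R * expR (th / (1 - 8 * th * (\sum_(j <- S) \sum_k q j k ^+ 2))
     * \sum_(j <- S) \sum_k q j k ^+ 2).
Proof.
elim: S th => [|i S IH] th /=.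
  move=> _ th0 _; rewrite big_nil mulr0 expR0 mulr1 -[X in X%:R]sum1_card natr_sum.
  apply: ler_sum => u _; rewrite big1 ?mulr0 ?expR0 // => k _.
  by rewrite big_nil expr0n.
move=> /andP[iS uS] th0; rewrite big_cons.
set N := \sum_k q i k ^+ 2; set M := \sum_(j <- S) _ => hNM.
have N0 : 0 <= N by apply: sumr_ge0 => k _; exact: sqr_ge0.
have M0 : 0 <= M.
  by apply: sumr_ge0 => j _; apply: sumr_ge0 => k _; exact: sqr_ge0.
(* The cross term [2 c] averages to at most [exp (8 th^2 c^2)], and Cauchy-Schwarz bounds [c^2] by
   [N] times the squared norm of the remaining sum. *)
pose th' := th * (1 + 8 * th * N).
have th'0 : 0 <= th' by rewrite /th' mulr_ge0 // addr_ge0 // !mulr_ge0.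
have key : 8 * th' * M < 1 /\ th' / (1 - 8 * th' * M) <= th / (1 - 8 * th * (N + M)).
  have e1 : (1 - 8 * th * (N + M)) * (1 + 8 * th * N) <= 1 - 8 * th' * M.
    rewrite /th' -subr_ge0.
    have -> : 1 - 8 * (th * (1 + 8 * th * N)) * M -
       (1 - 8 * th * (N + M)) * (1 + 8 * th * N) = (8 * th * N) ^+ 2 by ring.
    exact: sqr_ge0.
  have e2 : 0 < (1 - 8 * th * (N + M)) * (1 + 8 * th * N).
    by rewrite mulr_gt0 ?subr_gt0 // ltr_wpDr // !mulr_ge0.
  have e3 := lt_le_trans e2 e1.
  split; first by rewrite subr_gt0 in e3.
  rewrite ler_pdivrMr // mulrAC ler_pdivlMr ?subr_gt0 //.
  have -> : th' * (1 - 8 * th * (N + M)) =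
            th * ((1 - 8 * th * (N + M)) * (1 + 8 * th * N)) by rewrite /th'; ring.
  by rewrite ler_wpM2l.
apply: (@le_trans _ _ (\sum_u expR (th * N) *
    expR (th' * \sum_k (\sum_(j <- S) sgn u j * q j k) ^+ 2))).
  rewrite [leLHS](sum_flip i); apply: ler_sum => u _.
  pose b k := \sum_(j <- S) sgn u j * q j k.
  pose c := \sum_k b k * q i k.
  pose b2 := \sum_k b k ^+ 2.
  have sq (e : R) : e ^+ 2 = 1 -> \sum_k (e * q i k + b k) ^+ 2 = N + b2 + e * (2 * c).
    move=> e2; rewrite /N /b2 /c !mulr_sumr -!big_split /=; apply: eq_bigr => k _.
    by rewrite sqrrD exprMn e2; ring.
  have -> : \sum_k (\sum_(j <- i :: S) sgn u j * q j k) ^+ 2 = N + b2 + sgn u i * (2 * c).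
    by rewrite -sq ?expr2 ?sgn_sqr //; apply: eq_bigr => k _; rewrite big_cons.
  have -> : \sum_k (\sum_(j <- i :: S) sgn (flip i u) j * q j k) ^+ 2 =
            N + b2 + - sgn u i * (2 * c).
    rewrite -sq ?sqrrN ?expr2 ?sgn_sqr //; apply: eq_bigr => k _.
    rewrite big_cons sgn_flip eqxx; congr ((_ + _) ^+ 2).
    rewrite /b big_seq [RHS]big_seq; apply: eq_bigr => j jS.
    by rewrite sgn_flip; case: eqP jS => // ->; rewrite (negbTE iS).
  have -> : th * (N + b2 + sgn u i * (2 * c)) =
            th * (N + b2) + sgn u i * (2 * th * c) by ring.
  have -> : th * (N + b2 + - sgn u i * (2 * c)) =
            th * (N + b2) + - (sgn u i * (2 * th * c)) by ring.
  rewrite !(expRD (th * (N + b2))) -mulrDr -mulrA.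
  apply: (@le_trans _ _ (expR (th * (N + b2)) * expR (2 * (2 * th * c) ^+ 2))).
    rewrite ler_wpM2l ?expR_ge0 //; apply: le_trans (cosh_le _) _.
    by rewrite exprMn [sgn u i ^+ 2]expr2 sgn_sqr mul1r.
  rewrite -!expRD ler_expR -/b2 /th'.
  (* Cauchy-Schwarz through Lagrange's identity. *)
  have cs : c ^+ 2 <= b2 * N.
    rewrite -subr_ge0.
    have -> : b2 * N - c ^+ 2 =
       2^-1 * \sum_k \sum_l (b k * q i l - b l * q i k) ^+ 2.
      have e1 : b2 * N = \sum_k \sum_l b k ^+ 2 * q i l ^+ 2.
        by rewrite /b2 mulr_suml; apply: eq_bigr => k _; rewrite mulr_sumr.
      have e2 : b2 * N = \sum_k \sum_l b l ^+ 2 * q i k ^+ 2.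
        by rewrite e1 exchange_big.
      have e3 : c ^+ 2 = \sum_k \sum_l (b k * q i k) * (b l * q i l).
        by rewrite expr2 /c mulr_suml; apply: eq_bigr => k _; rewrite mulr_sumr.
      have -> : b2 * N - c ^+ 2 = 2^-1 * (b2 * N + b2 * N - 2 * c ^+ 2) by field.
      rewrite {1}e1 e2 e3; congr (_ * _); rewrite mulr_sumr -sumrN -!big_split /=.
      apply: eq_bigr => k _; rewrite mulr_sumr -sumrN -!big_split /=.
      by apply: eq_bigr => l _; ring.
    by rewrite mulr_ge0 ?invr_ge0 //; apply: sumr_ge0 => k _; apply: sumr_ge0 => l _; exact: sqr_ge0.
  have : th ^+ 2 * c ^+ 2 <= th ^+ 2 * (b2 * N) by rewrite ler_wpM2l ?sqr_ge0.
  lra.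
rewrite -mulr_sumr; have [key1 key2] := key.
apply: le_trans (ler_wpM2l (expR_ge0 _) (IH th' uS th'0 key1)) _.
rewrite -/M mulrCA ler_wpM2l // -expRD ler_expR mulrDr lerD //; last first.
  by rewrite ler_wpM2r.
rewrite ler_wpM2r //.
have h0 : 0 < 1 - 8 * th * (N + M) by rewrite subr_gt0.
rewrite ler_pdivlMr // -[leRHS]mulr1 ler_wpM2l //.
by rewrite lerBlDr lerDl !mulr_ge0 // addr_ge0.
Qed.

Lemma expR_jensen (J : finType) (y : J -> R) : (0 < #|J|)%N ->
  expR (#|J|%:R^-1 * \sum_j y j) <= #|J|%:R^-1 * \sum_j expR (y j).
Proof.
move=> J0; have Jn : #|J|%:R != 0 :> R by rewrite pnatr_eq0 -lt0n.
set m := _ * \sum_j y j.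
have h j : expR m * (1 + (y j - m)) <= expR (y j).
  have -> : expR (y j) = expR m * expR (y j - m) by rewrite -expRD addrC subrK.
  by rewrite ler_wpM2l ?expR_ge0 // expR_ge1Dx.
have : \sum_j expR m * (1 + (y j - m)) <= \sum_j expR (y j) by exact: ler_sum.
rewrite -mulr_sumr big_split /= sumr_const big_split /= sumr_const mulNrn.
rewrite -[m *+ _]mulr_natl /m mulrA mulfV // mul1r subrr addr0 -/m.
by rewrite ler_pdivlMl ?ltr0n // mulrC.
Qed.

(* Decoupling: averaging over the cut [w], each pair is separated half of the
   time, and across a fixed cut the form is linear in one side of the signs. *)
Lemma rademacher_chaos (b : I -> I -> R) :
  (forall i j, b i j = b j i) -> (forall i, b i i = 0) ->
  128 * \sum_i \sum_j b i j ^+ 2 <= 1 ->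
  \sum_u expR (2^-1 * \sum_i \sum_j b i j * (sgn u i * sgn u j)) <=
  #|{ffun I -> bool}|%:R * expR (16 * \sum_i \sum_j b i j ^+ 2).
Proof.
move=> bsym bdiag bsmall.
set C := #|{ffun I -> bool}|; set s2 := \sum_i \sum_j b i j ^+ 2 in bsmall *.
have C0 : (0 < C)%N by apply/card_gt0P; exists [ffun=> true].
have Cn : C%:R != 0 :> R by rewrite pnatr_eq0 -lt0n.
(* The coefficient 2 balances the factor [2^-1] of the form against the probability 1/4 that [w]
   contains [i] and not [j]. *)
pose Y (w u : {ffun I -> bool}) : R :=
  \sum_(i | w i) sgn u i * (\sum_(j | ~~ w j) 2 * b i j * sgn u j).
have avgY u : 2^-1 * \sum_i \sum_j b i j * (sgn u i * sgn u j) = C%:R^-1 * \sum_w Y w u.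
  have -> : \sum_w Y w u = \sum_i \sum_j
      (\sum_(w : {ffun I -> bool}) (w i && ~~ w j)%:R) * (2 * b i j * (sgn u i * sgn u j)).
    rewrite /Y.
    under eq_bigr => w _ do rewrite big_mkcond /=.
    rewrite exchange_big /=; apply: eq_bigr => i _.
    under [RHS]eq_bigr => j _ do rewrite mulr_suml.
    rewrite exchange_big /=; apply: eq_bigr => w _.
    case: (w i) => /=; last by rewrite big1 // => j _; rewrite mul0r.
    rewrite mulr_sumr big_mkcond /=; apply: eq_bigr => j _.
    by case: (w j) => /=; rewrite ?mul0r // mul1r; ring.
  rewrite mulr_sumr mulr_sumr; apply: eq_bigr => i _.
  rewrite !mulr_sumr; apply: eq_bigr => j _.
  have [->|ij] := eqVneq i j; first by rewrite bdiag !(mulr0, mul0r).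
  have -> : \sum_(w : {ffun I -> bool}) (w i && ~~ w j)%:R = C%:R / 4 :> R.
    have -> : \sum_(w : {ffun I -> bool}) (w i && ~~ w j)%:R =
       \sum_w (1 - sgn w i + sgn w j - sgn w i * sgn w j) / 4 :> R.
      apply: eq_bigr => w _; rewrite /sgn.
      by case: (w i); case: (w j) => /=; rewrite ?expr0 ?expr1; lra.
    rewrite -mulr_suml !big_split /= !sumrN sum_sgn_prod (negbTE ij) mul0r.
    have z k : \sum_w sgn w k = 0.
      by rewrite (sum_flip k) big1 // => w _; rewrite sgn_flip eqxx; lra.
    by rewrite !z sumr_const subr0 addr0 subr0.
  by field.
under eq_bigr => u _ do rewrite avgY.
apply: (@le_trans _ _ (\sum_u C%:R^-1 * \sum_w expR (Y w u))).
  by apply: ler_sum => u _; exact: expR_jensen.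
rewrite -mulr_sumr exchange_big /= ler_pdivrMl ?ltr0n // mulrA -natrM.
have -> : (C * C)%:R * expR (16 * s2) = \sum_(w : {ffun I -> bool}) C%:R * expR (16 * s2) :> R.
  by rewrite sumr_const -[RHS]mulr_natl natrM mulrA.
apply: ler_sum => w _.
pose S := enum [pred i | w i]; pose S' := enum [pred i | ~~ w i].
have YS u : Y w u = \sum_(i <- S) sgn u i * (\sum_(j <- S') 2 * b i j * sgn u j) + 0.
  by rewrite addr0 /S /S' big_enum /=; apply: eq_bigr => i _; rewrite big_enum.
under eq_bigr => u _ do rewrite YS.
apply: le_trans (@rademacher_linear S _ (fun=> 0) _ _ _) _ => //.
- exact: enum_uniq.
- move=> i j u; rewrite !mem_enum !inE => wi wj.
  rewrite big_seq [RHS]big_seq; apply: eq_bigr => k.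
  rewrite mem_enum inE => wk; rewrite sgn_flip; case: eqP wk => // ->.
  by rewrite wi.
pose q j i : R := if w i then 2 * b i j else 0.
have -> : \sum_u expR (\sum_(i <- S) 2 * (\sum_(j <- S') 2 * b i j * sgn u j) ^+ 2 + 0) =
   \sum_u expR (2 * \sum_i (\sum_(j <- S') sgn u j * q j i) ^+ 2).
  apply: eq_bigr => u _; congr expR; rewrite addr0 -mulr_sumr; congr (_ * _).
  rewrite /S big_enum /= big_mkcond /=; apply: eq_bigr => i _; rewrite /q inE.
  case: (w i); last by rewrite big1 ?expr0n // => j _; rewrite mulr0.
  by congr (_ ^+ 2); apply: eq_bigr => j _; rewrite mulrC.
set N := \sum_(j <- S') \sum_i q j i ^+ 2.
have N0 : 0 <= N.
  by apply: sumr_ge0 => j _; apply: sumr_ge0 => k _; exact: sqr_ge0.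
have Ns : N <= 4 * s2.
  rewrite /N /S' big_enum /= /s2 mulr_sumr /= big_mkcond /=.
  apply: ler_sum => j _; rewrite mulr_sumr inE.
  have pos : 0 <= \sum_i 4 * b j i ^+ 2.
    by apply: sumr_ge0 => i _; rewrite mulr_ge0 ?sqr_ge0.
  case: (w j) => //=; apply: ler_sum => i _; rewrite /q.
  by rewrite bsym; have := sqr_ge0 (b j i); case: (w i) => ?; rewrite ?exprMn ?expr0n /=; lra.
have h8 : 8 * 2 * N < 1 by lra.
apply: le_trans (rademacher_sqnorm (enum_uniq _) _ h8) _ => //.
rewrite -/C ler_wpM2l // ler_expR -/N.
have : 2 / (1 - 8 * 2 * N) <= 4 by rewrite ler_pdivrMr; lra.
by move/(ler_wpM2r N0)/le_trans; apply; lra.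
Qed.

End Rademacher.

(** * Indistinguishability *)

Section GaussianVector.
Variables (R : realType) (D L m : nat) (s2 : R).
Hypothesis s2_gt0 : 0 < s2.
Hypothesis m_gt1 : (1 < m)%N.
Hypothesis m_big : (4 * L < m)%N.
Let V := 'rV['Z_m]_D.

Lemma sum_rV_prod (T : finType) (F : 'I_D -> T -> R) :
  \sum_(v : 'rV[T]_D) \prod_e F e (v 0 e) = \prod_e \sum_x F e x.
Proof.
rewrite bigA_distr_bigA /= (reindex (fun f : {ffun 'I_D -> T} => \row_e f e)) /=.
  by apply: eq_bigr => f _; apply: eq_bigr => e _; rewrite mxE.
exists (fun v : 'rV[T]_D => [ffun e => v 0 e]) => [f _|v _].
  by apply/ffunP => e; rewrite ffunE mxE.
by apply/rowP => e; rewrite mxE ffunE.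
Qed.

Definition to_Zp (x : 'rV[int]_D) : V := map_mx intr x.

Lemma to_ZpD x y : to_Zp (x + y) = to_Zp x + to_Zp y.
Proof. by apply/rowP => e; rewrite !mxE rmorphD. Qed.

Definition gdens (v : V) : R := \prod_e gdens1 L s2 (v 0 e).

Lemma gdens_ge0 v : 0 <= gdens v.
Proof. by apply: prodr_ge0 => e _; exact: gdens1_ge0. Qed.

Lemma gdens_distr : distr gdens.
Proof.
split; first exact: gdens_ge0.
rewrite (sum_rV_prod (fun _ x => gdens1 L s2 x)) big1 // => e _.
exact: sum_gdens1_eq1.
Qed.

Lemma gdens_chi (a b : 'rV[int]_D) :
  (forall e, `|a 0%R e| <= L)%N -> (forall e, `|b 0%R e| <= L)%N ->
  \sum_v gdens (v - to_Zp a) * gdens (v - to_Zp b) / gdens v <=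
  expR (\sum_e (a 0 e)%:~R * (b 0 e)%:~R / s2).
Proof.
move=> aL bL.
have -> : \sum_v gdens (v - to_Zp a) * gdens (v - to_Zp b) / gdens v =
  \sum_(v : V) \prod_e (gdens1 L s2 (v 0 e - (a 0 e)%:~R) *
     gdens1 L s2 (v 0 e - (b 0 e)%:~R) / gdens1 L s2 (v 0 e)).
  apply: eq_bigr => v _; rewrite /gdens -prodfV -!big_split /=.
  by apply: eq_bigr => e _; rewrite !mxE.
rewrite (sum_rV_prod (fun e x => gdens1 L s2 (x - (a 0 e)%:~R) *
     gdens1 L s2 (x - (b 0 e)%:~R) / gdens1 L s2 x)) expR_sum.
apply: ler_prod => e _; rewrite gdens1_chi // andbT.
apply: sumr_ge0 => v _; apply: divr_ge0; last exact: gdens1_ge0.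
by apply: mulr_ge0; exact: gdens1_ge0.
Qed.

Lemma gdens_tail (a : 'rV[int]_D) : (forall e, 2 * `|a 0%R e| <= L)%N ->
  \sum_(v | gdens v == 0) gdens (v - to_Zp a) <=
  D%:R * ((2 * L).+1%:R * expR (- (L%:R ^+ 2) / (8 * s2))).
Proof.
move=> aL.
apply: (@le_trans _ _ (\sum_(v : V) \sum_e
   (gdens1 L s2 (v 0 e) == 0)%:R * gdens (v - to_Zp a))).
  rewrite big_mkcond; apply: ler_sum => v _.
  have pos e : 0 <= (gdens1 L s2 (v 0 e) == 0)%:R * gdens (v - to_Zp a).
    by rewrite mulr_ge0 // gdens_ge0.
  case: ifP => [/prodf_eq0[e _ e0]|_]; last by apply: sumr_ge0 => e _.
  by rewrite (bigD1 e) //= e0 mul1r lerDl sumr_ge0.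
rewrite exchange_big /=.
rewrite -[X in X%:R * _]card_ord -sum1_card natr_sum mulr_suml.
apply: ler_sum => e _; rewrite mul1r.
have -> : \sum_(v : V) (gdens1 L s2 (v 0 e) == 0)%:R * gdens (v - to_Zp a) =
  \sum_(v : V) \prod_e' (if e' == e then (gdens1 L s2 (v 0 e') == 0)%:R *
       gdens1 L s2 (v 0 e' - (a 0 e')%:~R) else gdens1 L s2 (v 0 e' - (a 0 e')%:~R)).
  apply: eq_bigr => v _; rewrite /gdens (bigD1 e) //= [RHS](bigD1 e) //= eqxx mulrA.
  rewrite !mxE; congr (_ * _ * _); apply: eq_bigr => e' /negbTE ->.
  by rewrite !mxE.
rewrite (sum_rV_prod (fun e' x => if e' == e then (gdens1 L s2 x == 0)%:R *
       gdens1 L s2 (x - (a 0 e')%:~R) else gdens1 L s2 (x - (a 0 e')%:~R))).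
rewrite (bigD1 e) //= eqxx [X in _ * X]big1 ?mulr1; last first.
  move=> e' /negbTE ne; under eq_bigr do rewrite ne.
  rewrite -[RHS](@sum_gdens1_eq1 R L s2 s2_gt0 m) [RHS](reindex_inj (addIr (- (a 0 e')%:~R))) /=.
  by apply: eq_bigr.
apply: le_trans (gdens1_tail s2_gt0 m_gt1 m_big (aL e)).
rewrite [leRHS]big_mkcond /=; apply: ler_sum => v _.
by case: ifP => _; rewrite ?mul1r ?mul0r.
Qed.

(** The chi-square method with two truncations: spikes outside [G] and points of zero noise density
    are discarded, at a cost of [eps] each. What is left is a subprobability [q] whose second moment
    relative to the noise is close to 1. *)
Lemma mixture_indistinguishable (F : finType) (y : F -> 'rV[int]_D) (G : {set F})
    (W : V -> R) (eps : R) :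
  0 <= eps <= 1 / 1000 ->
  (0 < #|F|)%N -> #|~: G|%:R <= eps * #|F|%:R ->
  (forall z e, 2 * `|y z 0%R e| <= L)%N ->
  (forall z, z \in G -> \sum_(z' in G)
     expR (\sum_e (y z 0 e)%:~R * (y z' 0 e)%:~R / s2) <= #|F|%:R * (1 + 2 * eps)) ->
  D%:R * ((2 * L).+1%:R * expR (- (L%:R ^+ 2) / (8 * s2))) <= eps ->
  (forall v, 0 <= W v <= 1) ->
  `|#|F|%:R^-1 * \sum_z \sum_v gdens (v - to_Zp (y z)) * W v - \sum_v gdens v * W v|
  <= 1 / 10.
Proof.
move=> /andP[eps0 eps1] F0 Gbig yL chi tail W01.
have Fp : 0 < #|F|%:R :> R by rewrite ltr0n.
have Fn : #|F|%:R != 0 :> R by rewrite gt_eqF.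
have [g0 g1] := gdens_distr.
pose q (v : V) : R := #|F|%:R^-1 * \sum_(z in G) gdens (v - to_Zp (y z)).
have q0 v : 0 <= q v.
  by rewrite mulr_ge0 ?invr_ge0 ?(ltW Fp) // sumr_ge0 // => z _; exact: gdens_ge0.
have shift1 z : \sum_v gdens (v - to_Zp (y z)) = 1.
  rewrite -[RHS]g1 [RHS](reindex_inj (addIr (- to_Zp (y z)))) /=.
  by apply: eq_bigr.
have badG : #|~: G|%:R / #|F|%:R <= eps :> R.
  by rewrite ler_pdivrMr.
have massG : \sum_v q v = #|G|%:R / #|F|%:R.
  rewrite -mulr_sumr exchange_big /= mulrC; congr (_ * _).
  by under eq_bigr => z _ do rewrite shift1; rewrite sumr_const.
have massG1 : \sum_v q v >= 1 - eps.
  have : #|G|%:R / #|F|%:R + #|~: G|%:R / #|F|%:R = 1 :> R.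
    by rewrite -mulrDl -natrD cardsC mulfV.
  by rewrite massG; lra.
have tailq : \sum_(v | gdens v == 0) q v <= eps.
  rewrite -mulr_sumr exchange_big /= ler_pdivrMl //.
  apply: (@le_trans _ _ (\sum_(z in G) eps)).
    by apply: ler_sum => z _; apply: le_trans tail; exact: gdens_tail.
  rewrite sumr_const -[_ *+ #|_|]mulr_natl ler_wpM2r // ler_nat.
  exact: max_card.
have chiq : \sum_v q v ^+ 2 / gdens v <= 1 + 2 * eps.
  have -> : \sum_v q v ^+ 2 / gdens v = (#|F|%:R ^+ 2)^-1 *
     \sum_(z in G) \sum_(z' in G) \sum_v gdens (v - to_Zp (y z)) *
         gdens (v - to_Zp (y z')) / gdens v.
    rewrite mulr_sumr; under [RHS]eq_bigr => z _ do rewrite exchange_big mulr_sumr.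
    rewrite exchange_big /=; apply: eq_bigr => v _.
    rewrite /q exprMn exprVn -mulrA -mulr_sumr; congr (_ * _).
    rewrite expr2 !mulr_suml; apply: eq_bigr => z _.
    by rewrite mulr_sumr mulr_suml.
  rewrite ler_pdivrMl ?exprn_gt0 //.
  apply: (@le_trans _ _ (\sum_(z in G) #|F|%:R * (1 + 2 * eps))).
    apply: ler_sum => z zG; apply: le_trans (chi z zG).
    apply: ler_sum => z' _; apply: gdens_chi => e.
      by apply: leq_trans (yL z e); rewrite leq_pmull.
    by apply: leq_trans (yL z' e); rewrite leq_pmull.
  rewrite sumr_const -[_ *+ #|_|]mulr_natl mulrA ler_wpM2r //; first by lra.
  by rewrite expr2 ler_wpM2r // ler_nat max_card.
have bad : `|#|F|%:R^-1 * \sum_z \sum_v gdens (v - to_Zp (y z)) * W v -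
    \sum_v q v * W v| <= eps.
  have -> : \sum_v q v * W v =
      #|F|%:R^-1 * \sum_(z in G) \sum_v gdens (v - to_Zp (y z)) * W v.
    rewrite exchange_big /= mulr_sumr; apply: eq_bigr => v _.
    by rewrite /q -mulrA mulr_suml.
  rewrite -mulrBr (bigID (mem G)) /= addrAC subrr add0r.
  have h z : 0 <= \sum_v gdens (v - to_Zp (y z)) * W v <= 1.
    apply/andP; split.
      by apply: sumr_ge0 => v _; rewrite mulr_ge0 ?gdens_ge0 //; case/andP: (W01 v).
    rewrite -(shift1 z); apply: ler_sum => v _; rewrite -[leRHS]mulr1.
    by rewrite ler_wpM2l ?gdens_ge0 //; case/andP: (W01 v).
  rewrite ger0_norm; last first.
    by rewrite mulr_ge0 ?invr_ge0 ?(ltW Fp) // sumr_ge0 // => z _; case/andP: (h z).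
  apply: le_trans badG; rewrite mulrC ler_wpM2r ?invr_ge0 ?(ltW Fp) //.
  rewrite -sum1_card natr_sum; apply: (@le_trans _ _ (\sum_(z in ~: G) 1)).
    rewrite [leRHS](eq_bigl (fun z => z \notin G)); last by move=> z; rewrite inE.
    by apply: ler_sum => z _; case/andP: (h z).
  by [].
have main : \sum_v `|q v - gdens v| <= 9 / 100.
  rewrite (bigID (fun v => gdens v == 0)) /=.
  have -> : \sum_(v | gdens v == 0) `|q v - gdens v| = \sum_(v | gdens v == 0) q v.
    by apply: eq_bigr => v /eqP ->; rewrite subr0 ger0_norm.
  (* The truncated chi-square distance is at most [6 eps]; the weight [k] is taken near its square
     root, [sqrt (6 / 1000)], which nearly minimizes the resulting bound. *)
  pose k : R := 8 / 100.
  have : \sum_(v | gdens v != 0) `|q v - gdens v| <=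
     \sum_(v | gdens v != 0) (k * gdens v + (q v ^+ 2 / gdens v - 2 * q v + gdens v) / k) / 2.
    apply: ler_sum => v gv.
    have gp : 0 < gdens v by rewrite lt_def gv gdens_ge0.
    have -> : q v ^+ 2 / gdens v - 2 * q v + gdens v = `|q v - gdens v| ^+ 2 / gdens v.
      by rewrite real_normK ?num_real //; field.
    set a := `|_|.
    have -> : (k * gdens v + a ^+ 2 / gdens v / k) / 2 =
       a + (k * gdens v - a) ^+ 2 / gdens v / k / 2.
      by rewrite /k; field.
    by rewrite lerDl !divr_ge0 ?sqr_ge0 ?(ltW gp) // /k; lra.
  have -> : \sum_(v | gdens v != 0) (k * gdens v + (q v ^+ 2 / gdens v - 2 * q v + gdens v) / k) / 2
    = (k * 1 + (\sum_v q v ^+ 2 / gdens v - 2 * (\sum_v q v - \sum_(v | gdens v == 0) q v) + 1) / k) / 2.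
    have gz : \sum_(v | gdens v != 0) gdens v = 1.
      rewrite -[RHS]g1 [RHS](bigID (fun v => gdens v == 0)) /=.
      by rewrite [X in _ = X + _]big1 ?add0r // => v /eqP.
    have cz : \sum_(v | gdens v != 0) q v ^+ 2 / gdens v = \sum_v q v ^+ 2 / gdens v.
      rewrite [RHS](bigID (fun v => gdens v == 0)) /=.
      by rewrite [X in _ = X + _]big1 ?add0r // => v /eqP ->; rewrite invr0 mulr0.
    have qz : \sum_(v | gdens v != 0) q v = \sum_v q v - \sum_(v | gdens v == 0) q v.
      by rewrite [X in X - _](bigID (fun v => gdens v == 0)) /= addrAC subrr add0r.
    rewrite -mulr_suml big_split /= -mulr_sumr gz -mulr_suml !big_split /= gz cz.
    by rewrite sumrN -mulr_sumr qz.
  move=> h; rewrite -lerBrDl; apply: le_trans h _.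
  set Q := \sum_v q v in massG1 *; set T := \sum_(v | _) q v in tailq *.
  by move: chiq; set X := \sum_v _ => chiq; rewrite /k; lra.
have -> : #|F|%:R^-1 * \sum_z \sum_v gdens (v - to_Zp (y z)) * W v - \sum_v gdens v * W v
  = (#|F|%:R^-1 * \sum_z \sum_v gdens (v - to_Zp (y z)) * W v - \sum_v q v * W v)
    + \sum_v (q v - gdens v) * W v.
  under [X in _ = _ + X]eq_bigr => v _ do rewrite mulrBl.
  by rewrite big_split /= sumrN; ring.
apply: le_trans (ler_normD _ _) _.
have : `|\sum_v (q v - gdens v) * W v| <= 9 / 100.
  apply: le_trans main; apply: le_trans (ler_norm_sum _ _ _) _.
  apply: ler_sum => v _; rewrite normrM -[leRHS]mulr1 ler_wpM2l //.
  by rewrite ger0_norm; case/andP: (W01 v).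
move: bad; lra.
Qed.

End GaussianVector.

(** * Shifts that almost preserve a law *)

Section Invariance.
Variables (R : realType) (V : finZmodType) (p : V -> R).

Definition shift_defect (h : V) : R := \sum_s `|p (s - h) - p s|.

Lemma shift_defect0 : shift_defect 0 = 0.
Proof. by rewrite /shift_defect big1 // => s _; rewrite subr0 subrr normr0. Qed.

Lemma shift_defectN h : shift_defect (- h) = shift_defect h.
Proof.
rewrite /shift_defect (reindex_inj (addIr (- h))) /=; apply: eq_bigr => s _.
by rewrite opprK subrK distrC.
Qed.

Lemma shift_defectD h h' : shift_defect (h + h') <= shift_defect h + shift_defect h'.
Proof.
rewrite {2}/shift_defect (reindex_inj (addIr (- h'))) /= -big_split /=.
apply: ler_sum => s _; rewrite opprD addrA addrAC.
exact: ler_distD.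
Qed.

Lemma shift_defectMz h (n : int) : shift_defect (h *~ n) <= `|n|%:~R * shift_defect h.
Proof.
have nat_case k : shift_defect (h *+ k) <= k%:R * shift_defect h.
  elim: k => [|k IH]; first by rewrite mulr0n shift_defect0 mul0r.
  rewrite mulrS; apply: le_trans (shift_defectD _ _) _.
  by rewrite -natr1 mulrDl mul1r addrC lerD2r.
case: n => n; first exact: nat_case.
by rewrite NegzE mulrNz shift_defectN normrN; exact: nat_case.
Qed.

Lemma shift_defect_sum (I : finType) (h : I -> V) (n : I -> int) t :
  (forall i, shift_defect (h i) <= t) ->
  shift_defect (\sum_i h i *~ n i) <= (\sum_i `|n i|%:~R) * t.
Proof.
move=> ht; rewrite mulr_suml.
elim/big_rec2: _ => [|i x y _ IH]; first by rewrite shift_defect0.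
apply: le_trans (shift_defectD _ _) _; rewrite lerD //.
by apply: le_trans (shift_defectMz _ _) _; rewrite ler_wpM2l.
Qed.

Lemma shift_defect_test h (U : V -> R) : (forall y, 0 <= U y <= 1) ->
  `|\sum_s p s * U (h - s) - \sum_s p s * U (- s)| <= shift_defect h.
Proof.
move=> U01.
have -> : \sum_s p s * U (- s) = \sum_s p (s - h) * U (h - s).
  rewrite [RHS](reindex_inj (addIr h)) /=; apply: eq_bigr => s _.
  by rewrite addrK opprD addrCA subrr addr0.
rewrite -sumrB; apply: le_trans (ler_norm_sum _ _ _) _; apply: ler_sum => s _.
rewrite -mulrBl normrM distrC -[leRHS]mulr1 ler_wpM2l //.
by rewrite ger0_norm; case/andP: (U01 (h - s)).
Qed.

End Invariance.

(** * Orthogonal projections and spikes rounded to their images *)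

Section Projection.
Variables (R : realType) (D : nat) (P : 'M[R]_D).
Hypothesis P_sym : P^T = P.
Hypothesis P_idem : P *m P = P.

Lemma dot_projection (x y : 'rV[R]_D) :
  \sum_e (x *m P) 0 e * (y *m P) 0 e = \sum_e (x *m P) 0 e * y 0 e.
Proof.
have dotE (a b : 'rV[R]_D) : \sum_e a 0 e * b 0 e = (a *m b^T) 0 0.
  by rewrite mxE; apply: eq_bigr => e _; rewrite mxE.
by rewrite !dotE trmx_mul P_sym mulmxA -(mulmxA x) P_idem.
Qed.

Lemma projection_norm_le (x : 'rV[R]_D) :
  \sum_e (x *m P) 0 e ^+ 2 <= \sum_e x 0 e ^+ 2.
Proof.
have : 0 <= \sum_e (x 0 e - (x *m P) 0 e) ^+ 2 by apply: sumr_ge0 => e _; exact: sqr_ge0.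
have := dot_projection x x.
have -> : \sum_e (x *m P) 0 e * (x *m P) 0 e = \sum_e (x *m P) 0 e ^+ 2.
  by apply: eq_bigr => e _; rewrite expr2.
move=> e1; have -> : \sum_e (x 0 e - (x *m P) 0 e) ^+ 2 = \sum_e x 0 e ^+ 2 -
    2 * \sum_e (x *m P) 0 e * x 0 e + \sum_e (x *m P) 0 e ^+ 2.
  by rewrite mulr_sumr -sumrB -big_split /=; apply: eq_bigr => e _; ring.
rewrite -e1; lra.
Qed.

Lemma projection_entry_le (x : 'rV[R]_D) (a : R) : 0 <= a ->
  (forall e, `|x 0 e| <= a) -> forall e, `|(x *m P) 0 e| <= D%:R * a.
Proof.
move=> a0 xa e.
have D1 : 1 <= D%:R :> R by rewrite ler1n; apply: leq_ltn_trans (ltn_ord e).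
rewrite -(@ler_pXn2r _ 2) ?nnegrE ?mulr_ge0 // real_normK ?num_real //.
apply: (@le_trans _ _ (\sum_e (x *m P) 0 e ^+ 2)).
  by rewrite (bigD1 e) //= lerDl; apply: sumr_ge0 => i _; exact: sqr_ge0.
apply: le_trans (projection_norm_le x) _.
apply: (@le_trans _ _ (\sum_(e < D) a ^+ 2)).
  apply: ler_sum => i _; rewrite -[_ ^+ 2]real_normK ?num_real //.
  by rewrite lerXn2r ?nnegrE.
rewrite sumr_const card_ord -[_ *+ D]mulr_natl exprMn ler_wpM2r ?sqr_ge0 //.
by rewrite expr2 ler_peMl.
Qed.

End Projection.

Lemma mulmxzE (V : zmodType) k l (M : 'M[V]_(k, l)) (n : int) i j :
  (M *~ n) i j = M i j *~ n.
Proof. by case: n => n; rewrite ?NegzE ?mulrNz ?mxE mulmxnE. Qed.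

Section HiddenSpike.
Variables (R : realType) (D B L m : nat) (s2 : R).
Hypothesis s2_gt0 : 0 < s2.
Hypothesis m_gt1 : (1 < m)%N.
Hypothesis m_big : (4 * L < m)%N.
Let X := {ffun 'I_D -> 'I_B}.
Let V := 'rV['Z_m]_D.

Definition int_row (x : X) : 'rV[int]_D := \row_e (x e : nat)%:Z.

Definition box_Zp (x : X) : V := to_Zp m (int_row x).

Definition real_row (x : 'rV[int]_D) : 'rV[R]_D := map_mx intr x.

Variables (F : finType) (spike : F -> 'rV[int]_D) (a : nat).
Hypothesis F_gt0 : (0 < #|F|)%N.
Hypothesis spike_le : forall z e, (`|spike z 0%R e| <= a)%N.
Hypothesis a_gt0 : (0 < a)%N.

Definition spike_diff (v : V) : R :=
  #|F|%:R^-1 * \sum_z gdens L s2 (v - to_Zp m (spike z)) - gdens L s2 v.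

(** Rounding down the coefficients of [x - x *m P] gives an integer combination of differences of
    points of [A], along which the law is almost invariant. What remains of [x] is its projection up
    to [D] fractional multiples of box differences. *)
Lemma round_spike (P : 'M[R]_D) (h : 'I_D -> X) (h0 : X) (x : 'rV[int]_D) :
  P^T = P -> P *m P = P -> (forall e, (`|x 0%R e| <= a)%N) ->
  (exists2 c : 'I_D -> R, real_row x - real_row x *m P =
       \sum_j c j *: (row_of R (h j) - row_of R h0) &
     forall j, `|c j| <= \sum_e `|(real_row x - real_row x *m P) 0 e|) ->
  exists2 n : 'I_D -> int,
    \sum_j `|n j|%:~R <= 3 * (D * D * D * a)%:R :> R &
    forall e, `|(x - \sum_j (int_row (h j) - int_row h0) *~ n j) 0 e|%:~R
              <= (D * (a + B))%:R :> R /\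
      `|((x - \sum_j (int_row (h j) - int_row h0) *~ n j) 0 e)%:~R -
        (real_row x *m P) 0 e| <= (D * B)%:R.
Proof.
move=> PT PP xa [c xP cb].
have xa' e : `|real_row x 0 e| <= a%:R.
  by rewrite mxE -intr_norm -[a%:R]/(a%:Z%:~R) ler_int; have := xa e; lia.
have Pa := projection_entry_le PT PP (ler0n R a) xa'.
pose n j := Num.floor (c j).
have fr j : 0 <= c j - (n j)%:~R <= 1.
  have /andP[l1 l2] := floor_itv (c j); move: l2; rewrite intrD => l2.
  by rewrite /n; apply/andP; split; lra.
have cD j : `|c j| <= D%:R * (a%:R + D%:R * a%:R).
  apply: le_trans (cb j) _.
  apply: (@le_trans _ _ (\sum_(e < D) (a%:R + D%:R * a%:R))).
    apply: ler_sum => e _; rewrite mxE [X in _ + X]mxE.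
    by apply: le_trans (ler_normB _ _) _; rewrite lerD.
  by rewrite sumr_const card_ord -[_ *+ D]mulr_natl.
exists n.
  apply: (@le_trans _ _ (\sum_(j < D) (D%:R * (a%:R + D%:R * a%:R) + 1))).
    apply: ler_sum => j _; have := cD j; have := fr j => /andP[f1 f2] cj.
    rewrite intr_norm.
    have -> : (n j)%:~R = c j - (c j - (n j)%:~R) :> R by ring.
    apply: le_trans (ler_normB _ _) _; rewrite lerD //.
    by rewrite ger0_norm.
  rewrite sumr_const card_ord -[_ *+ D]mulr_natl !natrM.
  have [->|D0] := posnP D; first by rewrite !mul0r mulr0.
  have D1 : 1 <= D%:R :> R by rewrite ler1n.
  have a1 : 1 <= a%:R :> R by rewrite ler1n.
  have DD : D%:R <= D%:R * D%:R :> R by rewrite ler_peMl.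
  have DDa : 1 <= D%:R * D%:R * a%:R :> R.
    by rewrite !mulr_ege1.
  have -> : 3 * (D%:R * D%:R * D%:R * a%:R) = D%:R * (3 * (D%:R * D%:R * a%:R)) :> R by ring.
  rewrite ler_wpM2l //.
  have : D%:R * a%:R <= D%:R * D%:R * a%:R :> R by rewrite ler_wpM2r.
  lra.
set y := x - _.
have ye e : (y 0 e)%:~R - (real_row x *m P) 0 e =
    \sum_j (c j - (n j)%:~R) * ((h j e)%:R - (h0 e)%:R) :> R.
  have hx : (x 0 e)%:~R - (real_row x *m P) 0 e = \sum_j c j * ((h j e)%:R - (h0 e)%:R) :> R.
    have /rowP/(_ e) := xP; rewrite [LHS]mxE [real_row x 0 e]mxE [X in _ + X = _]mxE => ->.
    by rewrite summxE; apply: eq_bigr => j _; rewrite !mxE.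
  have -> : (y 0 e)%:~R = (x 0 e)%:~R - \sum_j (n j)%:~R * ((h j e)%:R - (h0 e)%:R) :> R.
    rewrite /y mxE rmorphD /=; congr (_ + _); rewrite mxE rmorphN; congr (- _).
    rewrite summxE rmorph_sum /=; apply: eq_bigr => j _.
    by rewrite mulrzl mulmxzE rmorphMz /= !mxE intrB -!pmulrn.
  rewrite addrAC hx -sumrB; apply: eq_bigr => j _; ring.
have yb e : `|(y 0 e)%:~R - (real_row x *m P) 0 e| <= (D * B)%:R.
  rewrite ye; apply: le_trans (ler_norm_sum _ _ _) _.
  apply: (@le_trans _ _ (\sum_(j < D) B%:R)); last first.
    by rewrite sumr_const card_ord natrM -[_ *+ D]mulr_natl.
  apply: ler_sum => j _; have /andP[f1 f2] := fr j.
  rewrite normrM -[leRHS]mul1r ler_pM //; first by rewrite ger0_norm.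
  have := ltn_ord (h j e); have := ltn_ord (h0 e); rewrite ler_norml.
  move: (h j e : nat) (h0 e : nat) => u w; rewrite -!(ltr_nat R) => u1 w1.
  have := ler0n R u; have := ler0n R w; lra.
move=> e; split => //.
rewrite intr_norm.
have -> : (y 0 e)%:~R = ((y 0 e)%:~R - (real_row x *m P) 0 e) + (real_row x *m P) 0 e :> R.
  by rewrite subrK.
apply: le_trans (ler_normD _ _) _; apply: le_trans (lerD (yb e) (Pa e)) _.
by rewrite !(natrM, natrD); lra.
Qed.

Variables (K : nat) (t eps : R).
Hypothesis t_ge0 : 0 <= t.
Hypothesis eps_itv : 0 <= eps <= 1 / 1000.
Hypothesis spike_hidden : forall (r : nat) (P : 'M[R]_D), (B ^ r <= K * 3 ^ r)%N ->
  P^T = P -> P *m P = P -> \tr P = r%:R ->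
  exists2 G : {set F}, #|~: G|%:R <= eps * #|F|%:R &
    forall z, z \in G -> \sum_(z' in G) expR
      (\sum_e (real_row (spike z) *m P) 0 e * (real_row (spike z')) 0 e / s2)
      <= #|F|%:R * (1 + eps).
Hypothesis L_big : (2 * (D * (a + B)) <= L)%N.
Hypothesis s2_big : (3 * (D * D * D) * (a + B) * B)%:R <= eps / 4 * s2.
Hypothesis L_tail : D%:R * ((2 * L).+1%:R * expR (- (L%:R ^+ 2) / (8 * s2))) <= eps.
Hypothesis B_gt0 : (0 < B)%N.

(** Replacing every spike by its rounded projection [y z] costs [t] for each unit of coefficient.
    The rounded spikes have nearly the scalar products of the projected ones, so the chi-square
    condition of [spike_hidden] passes to them. *)
Theorem spike_diff_small (p : V -> R) (A : {set X}) (U : V -> R) : distr p ->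
  (#|X| <= K * #|A|)%N ->
  {in A &, forall x y, \sum_s `|p (s - box_Zp x) - p (s - box_Zp y)| <= t} ->
  (forall y, 0 <= U y <= 1) ->
  `|bilin spike_diff p U| <= 1 / 10 + 3 * (D * D * D * a)%:R * t.
Proof.
move=> [p0 p1] Abig Ainv U01.
have [A0|[h0 h0A]] := finset.set_0Vmem A.
  have X0 : (0 < #|X|)%N by apply/card_gt0P; exists [ffun=> Ordinal B_gt0].
  by move: Abig; rewrite A0 cards0 muln0 leqNgt X0.
have [r [P [h [cA PT PP trP [hA dec]]]]] := spanner_projection R h0A.
have Br : (B ^ r <= K * 3 ^ r)%N.
  have BD : (0 < B ^ D)%N by rewrite expn_gt0 B_gt0.
  rewrite -(leq_pmul2l BD); move: Abig; rewrite card_ffun !card_ord => Abig.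
  apply: leq_trans (leq_mul Abig (leqnn _)) _.
  by rewrite -mulnA [leqRHS]mulnCA leq_mul.
have [G Gbig Gchi] := spike_hidden Br PT PP trP.
have rnd z : exists n : {ffun 'I_D -> int},
   \sum_j `|n j|%:~R <= 3 * (D * D * D * a)%:R :> R /\
    forall e, `|(spike z - \sum_j (int_row (h j) - int_row h0) *~ n j) 0 e|%:~R
              <= (D * (a + B))%:R :> R /\
      `|((spike z - \sum_j (int_row (h j) - int_row h0) *~ n j) 0 e)%:~R -
        (real_row (spike z) *m P) 0 e| <= (D * B)%:R.
  have [n n1 n2] := round_spike PT PP (spike_le z) (dec (real_row (spike z))).
  exists [ffun j => n j].
  have -> : \sum_j (int_row (h j) - int_row h0) *~ [ffun j => n j] j =
    \sum_j (int_row (h j) - int_row h0) *~ n j by apply: eq_bigr => j _; rewrite ffunE.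
  by split => //; under eq_bigr do rewrite ffunE.
have [n nP] := choice rnd.
pose delta z := \sum_j (int_row (h j) - int_row h0) *~ n z j.
pose y z := spike z - delta z.
have defd z : shift_defect p (to_Zp m (delta z)) <= 3 * (D * D * D * a)%:R * t.
  have -> : to_Zp m (delta z) = \sum_j (box_Zp (h j) - box_Zp h0) *~ n z j.
    rewrite /delta /to_Zp raddf_sum /=; apply: eq_bigr => j _.
    by rewrite raddfMz raddfB.
  apply: (@le_trans _ _ ((\sum_j `|n z j|%:~R) * t)); last first.
    by rewrite ler_wpM2r //; case: (nP z).
  apply: shift_defect_sum => j.
  apply: le_trans (Ainv _ _ (hA j) h0A).
  rewrite /shift_defect (reindex_inj (addIr (- box_Zp h0))) /=.
  apply: ler_sum => s _.
  by rewrite [- (_ - _)]opprB addrA subrK.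
have Fp : 0 < #|F|%:R :> R by rewrite ltr0n.
pose W s v := U (v - s).
pose mix s := #|F|%:R^-1 * \sum_z \sum_v gdens L s2 (v - to_Zp m (y z)) * U (v - s).
have shiftE (x : 'rV[int]_D) s :
   \sum_v gdens L s2 (v - to_Zp m x) * U (v - s) =
   \sum_v gdens L s2 v * U (v + to_Zp m x - s).
  rewrite (reindex_inj (addIr (to_Zp m x))) /=.
  by apply: eq_bigr => v _; rewrite addrK.
have step1 : `|bilin spike_diff p U -
    \sum_s p s * (mix s - \sum_v gdens L s2 v * U (v - s))| <=
    3 * (D * D * D * a)%:R * t.
  have -> : bilin spike_diff p U - \sum_s p s * (mix s - \sum_v gdens L s2 v * U (v - s)) =
     #|F|%:R^-1 * \sum_z \sum_v gdens L s2 v *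
      (\sum_s p s * U (v + to_Zp m (spike z) - s) - \sum_s p s * U (v + to_Zp m (y z) - s)).
    have E (x : F -> 'rV[int]_D) : \sum_z \sum_v gdens L s2 v * \sum_s p s * U (v + to_Zp m (x z) - s)
      = \sum_s p s * \sum_z \sum_v gdens L s2 (v - to_Zp m (x z)) * U (v - s).
      transitivity (\sum_z \sum_s p s * \sum_v gdens L s2 v * U (v + to_Zp m (x z) - s)).
        apply: eq_bigr => z _; under [RHS]eq_bigr => s _ do rewrite mulr_sumr.
        rewrite exchange_big /=; apply: eq_bigr => v _; rewrite mulr_sumr.
        by apply: eq_bigr => s _; ring.
      rewrite exchange_big /=; apply: eq_bigr => s _; rewrite -mulr_sumr; congr (_ * _).
      by apply: eq_bigr => z _; rewrite shiftE.
    under [in RHS]eq_bigr => z _ do under eq_bigr => v _ do rewrite mulrBr.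
    under [in RHS]eq_bigr => z _ do rewrite sumrB.
    rewrite sumrB !E mulrBr.
    have -> : bilin spike_diff p U = \sum_s p s *
       (#|F|%:R^-1 * \sum_z \sum_v gdens L s2 (v - to_Zp m (spike z)) * U (v - s)
         - \sum_v gdens L s2 v * U (v - s)).
      apply: eq_bigr => s _.
      transitivity (p s * \sum_v (#|F|%:R^-1 * (\sum_z gdens L s2 (v - to_Zp m (spike z)) *
          U (v - s)) - gdens L s2 v * U (v - s))).
        rewrite mulr_sumr; apply: eq_bigr => v _.
        by rewrite /spike_diff -mulr_suml; ring.
      by congr (_ * _); rewrite sumrB -mulr_sumr exchange_big.
    rewrite -sumrB !mulr_sumr -sumrB; apply: eq_bigr => s _; rewrite /mix; ring.
  rewrite normrM ger0_norm ?invr_ge0 ?(ltW Fp) // ler_pdivrMl //.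
  apply: le_trans (ler_norm_sum _ _ _) _.
  apply: (@le_trans _ _ (\sum_(z : F) 3 * (D * D * D * a)%:R * t)); last first.
    by rewrite sumr_const -[_ *+ #|_|]mulr_natl.
  apply: ler_sum => z _; apply: le_trans (ler_norm_sum _ _ _) _.
  apply: (@le_trans _ _ (\sum_v gdens L s2 v * (3 * (D * D * D * a)%:R * t))); last first.
    have g1 : \sum_(v : V) gdens L s2 v = 1 := (gdens_distr D L m s2_gt0).2.
    rewrite -mulr_suml [X in X * _](_ : _ = 1) ?mul1r //; exact: g1.
  apply: ler_sum => v _; have gv : 0 <= gdens L s2 v by exact: gdens_ge0.
  rewrite normrM (ger0_norm gv) ler_wpM2l //.
  pose U' w := U (v + to_Zp m (y z) + w).
  have := @shift_defect_test R V p (to_Zp m (delta z)) U' (fun w => U01 _).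
  move/le_trans/(_ (defd z)).
  have -> : \sum_s p s * U' (to_Zp m (delta z) - s) =
      \sum_s p s * U (v + to_Zp m (spike z) - s).
    apply: eq_bigr => s _; congr (_ * U _).
    by rewrite addrA -(addrA v) -to_ZpD /y subrK.
  by [].
have eps0 : 0 <= eps by case/andP: eps_itv.
have chi z : z \in G -> \sum_(z' in G)
     expR (\sum_e (y z 0 e)%:~R * (y z' 0 e)%:~R / s2) <= #|F|%:R * (1 + 2 * eps).
  move=> zG.
  (* Each entry of a rounded spike is off by at most [D B] from a projection of size at most [D a].
     Summed over the [D] entries, the error of the scalar product is at most [eps / 4] times the
     variance by [s2_big]. *)
  have term z' : \sum_e (y z 0 e)%:~R * (y z' 0 e)%:~R / s2 <=
     \sum_e (real_row (spike z) *m P) 0 e * (real_row (spike z')) 0 e / s2 + eps / 4.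
    rewrite -!mulr_suml -lerBlDl -mulrBl -(dot_projection PT PP) -sumrB.
    rewrite ler_pdivrMr //; apply: le_trans s2_big.
    apply: (@le_trans _ _ (\sum_(e < D) ((3 * (D * D) * (a + B) * B)%:R))); last first.
      rewrite sumr_const card_ord -[_ *+ D]mulr_natl -natrM ler_nat.
      by rewrite (_ : D * _ = 3 * (D * D * D) * (a + B) * B)%N //; ring.
    apply: ler_sum => e _.
    have xb (z1 : F) e1 : `|(real_row (spike z1) *m P) 0 e1| <= (D * a)%:R.
      rewrite natrM; apply: projection_entry_le => // e2.
      by rewrite mxE -intr_norm -[a%:R]/(a%:Z%:~R) ler_int -abszE lez_nat.
    have [_ y1] := (nP z).2 e; have [_ y2] := (nP z').2 e.
    rewrite -/(delta z) -/(y z) in y1; rewrite -/(delta z') -/(y z') in y2.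
    have x1 := xb z e; have x2 := xb z' e.
    move: y1 y2 x1 x2.
    set q1 := (y z 0 e)%:~R; set q2 := (y z' 0 e)%:~R.
    set w1 := (_ *m P) 0 e; set w2 := (_ *m P) 0 e => y1 y2 x1 x2.
    apply: le_trans (ler_norm _) _.
    have -> : q1 * q2 - w1 * w2 = (q1 - w1) * (q2 - w2) + (q1 - w1) * w2 + w1 * (q2 - w2).
      ring.
    apply: le_trans (ler_normD _ _) _; apply: le_trans (lerD (ler_normD _ _) (lexx _)) _.
    rewrite !normrM.
    apply: (@le_trans _ _ ((D * B)%:R * (D * B)%:R + (D * B)%:R * (D * a)%:R +
       (D * a)%:R * (D * B)%:R)).
      by rewrite !lerD // ler_pM.
    rewrite -!natrM -!natrD ler_nat.
    rewrite (_ : 3 * (D * D) * (a + B) * B = D * B * (D * B) + D * B * (D * a) + D * a * (D * B)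
      + (D * D * a * B + 2 * (D * D * B * B)))%N; last by ring.
    exact: leq_addr.
  apply: (@le_trans _ _ (\sum_(z' in G) expR
      (\sum_e (real_row (spike z) *m P) 0 e * (real_row (spike z')) 0 e / s2) * expR (eps / 4))).
    by apply: ler_sum => z' _; rewrite -expRD ler_expR.
  rewrite -mulr_suml.
  apply: le_trans (ler_wpM2r (expR_ge0 _) (Gchi z zG)) _.
  rewrite -mulrA ler_wpM2l ?(ltW Fp) //.
  have eps1 : eps <= 1 / 1000 by case/andP: eps_itv.
  have e4 : expR (eps / 4) <= 1 + eps / 2.
    have l1 : 1 - eps / 4 <= expR (- (eps / 4)) by exact: expR_ge1Dx.
    have : expR (eps / 4) * (1 - eps / 4) <= 1.
      by rewrite -[leRHS](expRxMexpNx_1 (eps / 4)) ler_wpM2l ?expR_ge0.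
    have l0 : 0 < 1 - eps / 4 by lra.
    rewrite -ler_pdivlMr // => /le_trans; apply; rewrite ler_pdivrMr //; nra.
  apply: (@le_trans _ _ ((1 + eps) * (1 + eps / 2))); first by rewrite ler_wpM2l //; lra.
  nra.
have step2 : `|\sum_s p s * (mix s - \sum_v gdens L s2 v * U (v - s))| <= 1 / 10.
  apply: le_trans (ler_norm_sum _ _ _) _.
  apply: (@le_trans _ _ (\sum_s p s * (1 / 10))); last by rewrite -mulr_suml p1 mul1r.
  apply: ler_sum => s _.
  rewrite normrM ger0_norm // ler_wpM2l //.
  apply: (@mixture_indistinguishable R D L m s2 s2_gt0 m_gt1 m_big F y G (fun v => U (v - s)) eps) => //.
  move=> z e; have [+ _] := (nP z).2 e; rewrite -/(delta z) -/(y z) -[(D * _)%:R]/((D * (a + B))%:Z%:~R).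
  rewrite ler_int => yb; apply: leq_trans L_big; rewrite leq_mul2l /=.
  by move: yb; rewrite -abszE lez_nat.
rewrite -[bilin spike_diff p U](subrK (\sum_s p s * (mix s - \sum_v gdens L s2 v * U (v - s)))).
apply: le_trans (ler_normD _ _) _; rewrite addrC lerD //.
Qed.

End HiddenSpike.

Section Indistinguishable.
Variables (R : realType) (D B L m : nat) (s2 : R).
Hypothesis s2_gt0 : 0 < s2.
Hypothesis m_gt1 : (1 < m)%N.
Hypothesis m_big : (4 * L < m)%N.
Let X := {ffun 'I_D -> 'I_B}.
Let V := 'rV['Z_m]_D.

Variables (F : finType) (spike : F -> 'rV[int]_D) (a : nat).
Hypothesis F_gt0 : (0 < #|F|)%N.
Hypothesis spike_le : forall z e, (`|spike z 0%R e| <= a)%N.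
Hypothesis a_gt0 : (0 < a)%N.

Variables (Q : finType) (t eps : R).
Hypothesis t_gt0 : 0 < t.
Hypothesis eps_itv : 0 <= eps <= 1 / 1000.
Hypothesis spike_hidden : forall (r : nat) (P : 'M[R]_D),
  (B ^ r <= 40 * #|Q| * 3 ^ r)%N ->
  P^T = P -> P *m P = P -> \tr P = r%:R ->
  exists2 G : {set F}, #|~: G|%:R <= eps * #|F|%:R &
    forall z, z \in G -> \sum_(z' in G) expR
      (\sum_e (real_row R (spike z) *m P) 0 e * (real_row R (spike z')) 0 e / s2)
      <= #|F|%:R * (1 + eps).
Hypothesis L_big : (2 * (D * (a + B)) <= L)%N.
Hypothesis s2_big : (3 * (D * D * D) * (a + B) * B)%:R <= eps / 4 * s2.
Hypothesis L_tail : D%:R * ((2 * L).+1%:R * expR (- (L%:R ^+ 2) / (8 * s2))) <= eps.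
Hypothesis B_gt0 : (0 < B)%N.
Variables (step : Q -> X -> Q) (out : Q -> V -> R).
Hypothesis out01 : forall q y, 0 <= out q y <= 1.

Let nu := @spike_diff R D L m s2 F spike.

Lemma bilin_spike_le1 (p U : V -> R) : distr p -> (forall y, 0 <= U y <= 1) ->
  `|bilin nu p U| <= 1.
Proof.
move=> [p0 p1] U01.
have [g0 g1] := gdens_distr D L m s2_gt0.
pose T (x : 'rV[int]_D) s := \sum_v gdens L s2 (v - to_Zp m x) * U (v - s).
have T01 x s : 0 <= T x s <= 1.
  apply/andP; split.
    by apply: sumr_ge0 => v _; rewrite mulr_ge0 ?g0 //; case/andP: (U01 (v - s)).
  have <- : \sum_v gdens L s2 (v - to_Zp m x) = 1.
    rewrite -[RHS]g1 [RHS](reindex_inj (addIr (- to_Zp m x))) /=.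
    by apply: eq_bigr.
  apply: ler_sum => v _; rewrite -[leRHS]mulr1 ler_wpM2l ?g0 //.
  by case/andP: (U01 (v - s)).
have Fp : 0 < #|F|%:R :> R by rewrite ltr0n.
have -> : bilin nu p U = \sum_s p s * (#|F|%:R^-1 * \sum_z T (spike z) s - T 0 s).
  apply: eq_bigr => s _.
  transitivity (p s * \sum_v (#|F|%:R^-1 * (\sum_z gdens L s2 (v - to_Zp m (spike z)) *
      U (v - s)) - gdens L s2 v * U (v - s))).
    rewrite mulr_sumr; apply: eq_bigr => v _.
    by rewrite /nu /spike_diff -mulr_suml; ring.
  congr (_ * _); rewrite sumrB -mulr_sumr exchange_big /T; congr (_ - _).
  apply: eq_bigr => v _; rewrite (_ : to_Zp m 0 = 0) ?subr0 //.
  by apply/rowP => e; rewrite !mxE.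
apply: le_trans (ler_norm_sum _ _ _) _; rewrite -[leRHS]p1; apply: ler_sum => s _.
rewrite normrM ger0_norm // -[leRHS]mulr1 ler_wpM2l //.
have : 0 <= #|F|%:R^-1 * \sum_z T (spike z) s <= 1.
  apply/andP; split.
    by rewrite mulr_ge0 ?invr_ge0 ?(ltW Fp) // sumr_ge0 // => z _; case/andP: (T01 (spike z) s).
  rewrite ler_pdivrMl // mulr1 -sum1_card natr_sum; apply: ler_sum => z _.
  by case/andP: (T01 (spike z) s).
move=> /andP[h1 h2]; have /andP[h3 h4] := T01 0 s; rewrite ler_norml; lra.
Qed.

Theorem indistinguishable N q : (0 < N)%N ->
  `|\sum_v nu v * expect (@box_Zp D B m) step out N q v| <=
  20^-1 + (1 / 10 + 3 * (D * D * D * a)%:R * t)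
    + (D%:R * ln m%:R) / (N%:R * (t ^+ 2 / 32)).
Proof.
(* The stream starts from the partial sum 0, a law of entropy 0, so the total entropy available is
   [D ln m]. *)
move=> N0; pose p (s : V) : R := (s == 0)%:R.
have dp : distr p.
  split=> [s|]; first by rewrite /p ler0n.
  by rewrite (bigD1 0) //= /p eqxx big1 ?addr0 // => s /negbTE ->.
have p_bilin (U : V -> R) : bilin nu p U = \sum_v nu v * U v.
  rewrite /bilin (bigD1 0) //= [X in _ + X]big1 ?addr0.
    by apply: eq_bigr => v _; rewrite /p eqxx mul1r subr0.
  by move=> s /negbTE s0; rewrite big1 // => v _; rewrite /p s0 !mul0r.
have p_ent : entropy p = 0.
  rewrite /entropy big1 ?oppr0 // => s _; rewrite /p.
  by case: (s == 0); rewrite ?mul0r // ln1 mulr0.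
have X0 : (0 < #|X|)%N by apply/card_gt0P; exists [ffun=> Ordinal B_gt0].
pose tau : R := 1 / 10 + 3 * (D * D * D * a)%:R * t.
have tau0 : 0 <= tau by rewrite addr_ge0 // !mulr_ge0 // ltW.
have good (p' : V -> R) (A : {set X}) (U : V -> R) : distr p' ->
    (#|X| <= 40 * #|Q| * #|A|)%N ->
    {in A &, forall x y, \sum_s `|p' (s - box_Zp m x) - p' (s - box_Zp m y)| <= t} ->
    (forall y, 0 <= U y <= 1) -> `|bilin nu p' U| <= tau.
  move=> dp' cA inv U01.
  exact: (spike_diff_small s2_gt0 m_gt1 m_big F_gt0 spike_le a_gt0 (ltW t_gt0)
    eps_itv spike_hidden L_big s2_big L_tail B_gt0 dp' cA inv U01).
have := bilin_trajectory step X0 out01 t_gt0 tau0 bilin_spike_le1 good N q dp.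
rewrite p_bilin p_ent subr0.
have -> : ln #|V|%:R = D%:R * ln m%:R :> R.
  rewrite card_mx mul1n card_ord Zp_cast // natrX lnXn ?ltr0n ?(ltnW m_gt1) //.
  by rewrite mulr_natl.
have Np : 0 < N%:R :> R by rewrite ltr0n.
rewrite -ler_pdivlMl // mulrDr mulKf ?gt_eqF // => /le_trans; apply.
by rewrite -/tau [(N%:R * _)^-1]invfM [N%:R^-1 * _]mulrCA mulrA.
Qed.

End Indistinguishable.

(** * From algorithms to state trajectories *)

Section VectorStreams.
Variables (I : finType) (D : nat) (pos : 'I_D -> seq I).

Lemma frequency_cat (s1 s2 : unit_stream I) i :
  frequency (s1 ++ s2) i = frequency s1 i + frequency s2 i.
Proof. by rewrite /frequency big_cat. Qed.

Lemma frequency_flatten (ss : seq (unit_stream I)) i :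
  frequency (flatten ss) i = \sum_(s <- ss) frequency s i.
Proof.
elim: ss => [|s ss IH]; first by rewrite big_nil /frequency big_nil.
by rewrite /= frequency_cat big_cons IH.
Qed.

(** [pos e] lists the matrix entries fed by coordinate [e]: two mirror entries for an off-diagonal
    coordinate, one for a diagonal coordinate. *)
Definition vector_stream (x : 'rV[int]_D) : unit_stream I :=
  flatten [seq flatten (nseq `|x 0 e| [seq (i, x 0 e < 0) | i <- pos e]) | e <- enum 'I_D].

Lemma frequency_vector_stream x i :
  frequency (vector_stream x) i = \sum_e x 0 e * (count_mem i (pos e))%:Z.
Proof.
rewrite frequency_flatten big_map big_enum /=; apply: eq_bigr => e _.
rewrite frequency_flatten big_nseq.
have -> : frequency [seq (i0, x 0 e < 0) | i0 <- pos e] i =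
    (-1) ^+ (x 0 e < 0)%R * (count_mem i (pos e))%:Z.
  elim: (pos e) => [|k l IH]; first by rewrite /frequency big_nil mulr0.
  rewrite /frequency big_cons /= -/(frequency _ _) IH.
  by case: (k == i); rewrite /= ?add0n // add1n intS mulrDr mulr1.
rewrite iter_addr addr0 -mulr_natl mulrA; congr (_ * _).
by rewrite natz mulrC -intEsign.
Qed.

Lemma size_vector_stream (x : 'rV[int]_D) (k b : nat) : (forall e, size (pos e) <= k)%N ->
  (forall e, `|x 0%R e| <= b)%N -> (size (vector_stream x) <= D * (k * b))%N.
Proof.
move=> pk xb; rewrite size_flatten /shape -map_comp sumnE big_map big_enum /=.
rewrite -[X in (_ <= X * _)%N]card_ord -sum_nat_const; apply: leq_sum => e _ /=.
rewrite size_flatten /shape map_nseq sumn_nseq size_map leq_mul //.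
Qed.

End VectorStreams.

Section Yao.
Variables (R : realType) (I : finType) (O : Type).
Variable correct : (I -> int) -> O -> Prop.

(** Yao's principle: otherwise the weighted success of every seed falls short of the guaranteed mean
    by [eta], and integrating over seeds is a contradiction, strict thanks to [eta]. The weights
    need not sum to 1. *)
Lemma average_over_seeds (W S : nat) (J : finType) (u : J -> R) (st : J -> unit_stream I)
    (eta : R) :
  turnstile_solvable R correct W S -> (forall j, 0 <= u j) ->
  (forall j, size (st j) <= W)%N -> 0 < eta ->
  exists2 A : det_algorithm I O, (#|mem_state A| <= 2 ^ S)%N &
    2 / 3 * \sum_j u j - eta <=
    \sum_j u j * `[< correct (frequency (st j)) (run A (st j)) >]%:R.
Proof.
move=> [d [T [P [A [Amem Asucc]]]]] u0 stW eta0.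
apply: contrapT => nA.
pose E j := [set w | correct (frequency (st j)) (run (A w) (st j))]%classic.
have mE j : measurable (E j) by case: (Asucc (st j) (stW j)).
have PE j : ((2 / 3)%:E <= P (E j))%E by case: (Asucc (st j) (stW j)).
pose f w : R := \sum_j u j * \1_(E j) w.
have fub w : f w <= 2 / 3 * \sum_j u j - eta.
  rewrite leNgt; apply/negP => h; apply: nA; exists (A w) => //.
  apply: le_trans (ltW h) _; apply: ler_sum => j _; exact: ler_wpM2l.
have int_f : (\int[P]_w (f w)%:E = \sum_j (u j)%:E * P (E j))%E.
  rewrite /f; under eq_integral do rewrite -sumEFin.
  rewrite ge0_integral_sum //=.
  - apply: eq_bigr => j _; under eq_integral do rewrite EFinM.
    rewrite ge0_integralZl_EFin //=.
    + by rewrite integral_indic // setIT.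
    + by apply/measurable_EFinP.
  - move=> j; apply/measurable_EFinP; apply: measurable_funM => //.
  - by move=> j w _; rewrite lee_fin mulr_ge0.
have lb : ((2 / 3 * \sum_j u j)%:E <= \int[P]_w (f w)%:E)%E.
  rewrite int_f mulr_sumr -sumEFin; apply: lee_sum => j _.
  by rewrite mulrC EFinM lee_wpmul2l // lee_fin.
have mf : measurable_fun setT (fun w => (f w)%:E).
  apply/measurable_EFinP; apply: measurable_sum => j.
  exact: measurable_funM.
have ub : (\int[P]_w (f w)%:E <= (2 / 3 * \sum_j u j - eta)%:E)%E.
  have [c0|c0] := lerP 0 (2 / 3 * \sum_j u j - eta).
    apply: (@le_trans _ _ (\int[P]_w (2 / 3 * \sum_j u j - eta)%:E)%E).
      apply: ge0_le_integral => //.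
      - by move=> w _; rewrite lee_fin sumr_ge0 // => j _; rewrite mulr_ge0.
      - by move=> w _; rewrite lee_fin fub.
    rewrite integral_cst ?measurableT //.
    by rewrite [X in (_ * X)%E]probability_setT mule1.
  (* A negative upper bound for a nonnegative function is absurd as soon as one seed exists, and a
     space of probability 1 is not empty. *)
  have [w _] : exists w : T, True.
    apply: contrapT => none; have := probability_setT P.
    rewrite (_ : setT = set0) ?measure0; first by move=> /eqP; rewrite eqe eq_sym oner_eq0.
    by rewrite -subset0 => w _; apply: none; exists w.
  have : 0 <= f w by rewrite sumr_ge0 // => j _; rewrite mulr_ge0.
  by move=> /le_trans/(_ (fub w)); rewrite leNgt c0.
by have := le_trans lb ub; rewrite lee_fin; lra.
Qed.

End Yao.

Lemma absz_add_le (i j : int) (k l : nat) : (`|i| <= k)%N -> (`|j| <= l)%N ->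
  (absz (i + j)%R <= k + l)%N.
Proof. lia. Qed.

Lemma absz_subn_le (i : int) (s k l : nat) : (`|i| <= k)%N -> (s <= l)%N ->
  (absz (i - s%:Z)%R <= k + l)%N.
Proof. lia. Qed.

Lemma sum_option (R : realType) (T : finType) (G : option T -> R) :
  \sum_o G o = G None + \sum_z G (Some z).
Proof.
rewrite (bigD1 None) //= (reindex_omap Some id) => [|[z|] //].
by congr (_ + _); apply: eq_bigl => z; rewrite eqxx.
Qed.

Section StreamingLowerBound.

Lemma sum_cons_tuple (R : realType) (X : finType) k (G : seq X -> R) :
  \sum_(xs : k.+1.-tuple X) G xs = \sum_x \sum_(xs : k.-tuple X) G (x :: xs).
Proof.
rewrite pair_big /= (reindex (fun z : X * k.-tuple X => [tuple of z.1 :: z.2])) //=.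
exists (fun xs : k.+1.-tuple X => (thead xs, [tuple of behead xs])) => [[x xs] _|xs _] /=.
  by congr (_, _); apply/val_inj.
by rewrite -tuple_eta.
Qed.

Lemma expect_tuple (R : realType) (V : finZmodType) (X Q : finType) (iota : X -> V)
    (step : Q -> X -> Q) (out : Q -> V -> R) k q y :
  expect iota step out k q y = (#|X|%:R ^+ k)^-1 *
    \sum_(xs : k.-tuple X) out (foldl step q xs) (y - \sum_(x <- xs) iota x).
Proof.
elim: k q y => [|k IH] q y.
  rewrite expr0 invr1 mul1r (bigD1 [tuple]) //= big_nil subr0 big1 ?addr0 // => xs.
  by move=> /eqP[]; exact: tuple0.
rewrite (@sum_cons_tuple _ _ _ (fun xs => out (foldl step q xs) (y - \sum_(x <- xs) iota x))).
rewrite /= exprS invfM -mulrA; congr (_ * _); rewrite mulr_sumr.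
apply: eq_bigr => x _; rewrite IH; congr (_ * _); apply: eq_bigr => xs _.
by rewrite big_cons opprD addrA.
Qed.

Variables (R : realType) (D B L m : nat) (s2 : R).
Hypothesis s2_gt0 : 0 < s2.
Hypothesis m_gt1 : (1 < m)%N.
Hypothesis m_big : (4 * L < m)%N.
Let X := {ffun 'I_D -> 'I_B}.
Let V := 'rV['Z_m]_D.
Let Noise := {ffun 'I_D -> 'I_(2 * L).+1}.

Definition noise_row (f : Noise) : 'rV[int]_D := \row_e gval (f e).

Definition noise_weight (f : Noise) : R := \prod_e (gauss s2 (gval (f e)) / gnorm L s2).

Lemma noise_weight_ge0 f : 0 <= noise_weight f.
Proof.
by apply: prodr_ge0 => e _; rewrite divr_ge0 ?expR_ge0 // (le_trans _ (gnorm_ge1 _ s2_gt0)).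
Qed.

Lemma sum_noise_weight : \sum_f noise_weight f = 1.
Proof.
rewrite /noise_weight -(bigA_distr_bigA (fun _ i => gauss s2 (gval i) / gnorm L s2)) /=.
rewrite big1 // => e _; rewrite -mulr_suml -/(gnorm L s2) mulfV // gt_eqF //.
exact: gnorm_gt0.
Qed.

Lemma sum_gdens (G : V -> R) :
  \sum_v gdens L s2 v * G v = \sum_f noise_weight f * G (to_Zp m (noise_row f)).
Proof.
transitivity (\sum_v \sum_f noise_weight f * (to_Zp m (noise_row f) == v)%:R * G v).
  apply: eq_bigr => v _; rewrite -mulr_suml; congr (_ * _).
  rewrite /gdens /gdens1.
  under eq_bigr => e _ do rewrite mulr_sumr.
  rewrite bigA_distr_bigA /=; apply: eq_bigr => f _.
  have [ev|nv] := eqVneq (to_Zp m (noise_row f)) v.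
    rewrite mulr1; apply: eq_bigr => e _; rewrite -ev !mxE eqxx mul1r.
    by rewrite mulrC.
  rewrite mulr0; apply/eqP/prodf_eq0.
  have [e ne] : exists e, (gval (f e))%:~R != v 0 e.
    apply/existsP; apply: contraR nv; rewrite negb_exists => /forallP h.
    by apply/eqP/rowP => e; rewrite !mxE; have := h e; rewrite negbK => /eqP.
  by exists e => //; rewrite (negbTE ne) mul0r mulr0.
rewrite exchange_big /=; apply: eq_bigr => f _.
rewrite (bigD1 (to_Zp m (noise_row f))) //= eqxx mulr1 big1 ?addr0 // => v.
by rewrite eq_sym => /negbTE ->; rewrite mulr0 mul0r.
Qed.

Variables (F : finType) (spike : F -> 'rV[int]_D) (a : nat).
Hypothesis F_gt0 : (0 < #|F|)%N.
Hypothesis spike_le : forall z e, (`|spike z 0%R e| <= a)%N.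
Hypothesis a_gt0 : (0 < a)%N.

Variables (I : finType) (O : Type) (correct : (I -> int) -> O -> Prop).
Variables (W S N : nat) (pos : 'I_D -> seq I) (base : unit_stream I).
Variables (t eps : R).
Hypothesis t_gt0 : 0 < t.
Hypothesis eps_itv : 0 <= eps <= 1 / 1000.
Hypothesis spike_hidden : forall (r : nat) (P : 'M[R]_D),
  (B ^ r <= 40 * 2 ^ S * 3 ^ r)%N ->
  P^T = P -> P *m P = P -> \tr P = r%:R ->
  exists2 G : {set F}, #|~: G|%:R <= eps * #|F|%:R &
    forall z, z \in G -> \sum_(z' in G) expR
      (\sum_e (real_row R (spike z) *m P) 0 e * (real_row R (spike z')) 0 e / s2)
      <= #|F|%:R * (1 + eps).
Hypothesis L_big : (2 * (D * (a + B)) <= L)%N.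
Hypothesis s2_big : (3 * (D * D * D) * (a + B) * B)%:R <= eps / 4 * s2.
Hypothesis L_tail : D%:R * ((2 * L).+1%:R * expR (- (L%:R ^+ 2) / (8 * s2))) <= eps.
Hypothesis B_gt0 : (0 < B)%N.
Hypothesis N_gt0 : (0 < N)%N.
Hypothesis no_overflow : (2 * (L + a + N * B) < m)%N.
Hypothesis pos_size : forall e, (size (pos e) <= 2)%N.
Hypothesis stream_length : (size base + N * (D * (2 * B)) + D * (2 * m) <= W)%N.
Hypothesis t_small : 3 * (D * D * D * a)%:R * t <= 1 / 100.
Hypothesis N_big : D%:R * ln m%:R <= 20^-1 * (N%:R * (t ^+ 2 / 32)).

Definition final_frequency (M : 'rV[int]_D) (i : I) : int :=
  frequency base i + \sum_e M 0 e * (count_mem i (pos e))%:Z.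

Variables (test : O -> bool) (good : Noise -> bool).
Hypothesis good_whp : \sum_(f | ~~ good f) noise_weight f <= 1 / 100.
Hypothesis test_null : forall f o, good f ->
  correct (final_frequency (noise_row f)) o -> test o.
Hypothesis test_spiked : forall f z o, good f ->
  correct (final_frequency (noise_row f + spike z)) o -> ~~ test o.

Let crow (v : V) : 'rV[int]_D := \row_e crep (v 0 e).

(** The padding, then the vector that brings the total to [M]. That vector is decoded from its
    residue mod [m], so the final answer is a function of the state and of an element of the finite
    group, as [expect] requires. *)
Let tail_stream (M : 'rV[int]_D) (xs : seq X) : unit_stream I :=
  flatten [seq vector_stream pos (int_row x) | x <- xs] ++
  vector_stream pos (crow (to_Zp m M - \sum_(x <- xs) box_Zp m x)).

Lemma frequency_tail (M : 'rV[int]_D) (xs : N.-tuple X) :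
  (forall e, `|M 0%R e| <= L + a)%N ->
  frequency (base ++ tail_stream M xs) = final_frequency M.
Proof.
move=> ML; apply/funext => i.
rewrite /tail_stream !frequency_cat frequency_flatten big_map /final_frequency; congr (_ + _).
under eq_bigr do rewrite frequency_vector_stream.
rewrite frequency_vector_stream exchange_big /= -big_split /=; apply: eq_bigr => e _.
rewrite -mulr_suml -mulrDl; congr (_ * _).
pose s := \sum_(x <- xs) (x e : nat).
have sB : (s <= N * B)%N.
  rewrite /s -{2}(size_tuple xs) -sum1_size big_distrl /=; apply: leq_sum => x _.
  by rewrite mul1n ltnW.
have -> : \sum_(x <- xs) int_row x 0 e = s%:Z.
  by rewrite /s -[X in X%:Z]natn -natz !natr_sum; apply: eq_bigr => x _; rewrite mxE natz natn.
have -> : crow (to_Zp m M - \sum_(x <- xs) box_Zp m x) 0 e = M 0 e - s%:Z.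
  rewrite mxE -[RHS](crep_intr m_gt1); last first.
    by apply: leq_ltn_trans no_overflow; rewrite leq_mul2l absz_subn_le.
  congr crep; rewrite rmorphB /= !mxE; congr (_ - _).
  rewrite summxE /s -pmulrn natr_sum; apply: eq_bigr => x _.
  by rewrite !mxE -pmulrn.
by rewrite addrC subrK.
Qed.

Lemma size_tail (M : 'rV[int]_D) (xs : N.-tuple X) :
  (size (base ++ tail_stream M xs) <= W)%N.
Proof.
apply: leq_trans stream_length; rewrite !size_cat addnA leq_add //; last first.
  apply: size_vector_stream => // e.
  rewrite [crow _ _ _]mxE.
  apply: (leq_trans _ (crep_bound m_gt1 _)).
  exact: leq_pmull.
rewrite leq_add2l size_flatten /shape -map_comp sumnE big_map -{2}(size_tuple xs).
rewrite -sum1_size big_distrl /=; apply: leq_sum => x _; rewrite mul1n.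
apply: size_vector_stream => // e; rewrite mxE; exact: (ltnW (ltn_ord (x e))).
Qed.

(** Success on both hypotheses forces an advantage of at least 1/3 - 3/100, after the slack of the
    averaging and twice the probability of bad noise. The indistinguishability bound is 1/20 + 1/10
    + 1/100 + 1/20, which is smaller. *)
Theorem streaming_lower_bound : ~ turnstile_solvable R correct W S.
Proof.
move=> solv.
pose Xs := (N.-tuple X)%type.
have X0 : (0 < #|X|)%N by apply/card_gt0P; exists [ffun=> Ordinal B_gt0].
pose cX : R := (#|X|%:R ^+ N)^-1.
have cX0 : 0 <= cX by rewrite invr_ge0 exprn_ge0.
have cX1 : cX * #|{: Xs}|%:R = 1.
  by rewrite card_tuple natrX mulVf // expf_neq0 // pnatr_eq0 -lt0n.
pose J := (Noise * option F * Xs)%type.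
pose center (j : J) : 'rV[int]_D :=
  noise_row j.1.1 + (if j.1.2 is Some z then spike z else 0).
pose st (j : J) := base ++ tail_stream (center j) j.2.
(* The unspiked inputs and the spiked inputs both receive total weight 1. *)
pose u (j : J) : R := noise_weight j.1.1 * cX * (if j.1.2 is Some _ then #|F|%:R^-1 else 1).
have u0 j : 0 <= u j.
  rewrite /u mulr_ge0 ?mulr_ge0 ?noise_weight_ge0 //.
  by case: (j.1.2) => [z|//]; rewrite invr_ge0.
have Fp : 0 < #|F|%:R :> R by rewrite ltr0n.
have sumJ (H : J -> R) : \sum_j u j * H j =
    (\sum_f noise_weight f * (cX * \sum_xs H (f, None, xs))) +
    #|F|%:R^-1 * \sum_z \sum_f noise_weight f * (cX * \sum_xs H (f, Some z, xs)).
  transitivity (\sum_(p : Noise * option F) \sum_(xs : Xs) u (p, xs) * H (p, xs)).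
    by rewrite pair_big /=; apply: eq_bigr => [[p xs]] _.
  transitivity (\sum_(f : Noise) \sum_(o : option F) \sum_(xs : Xs) u (f, o, xs) * H (f, o, xs)).
    by rewrite [RHS]pair_big /=; apply: eq_bigr => [[f o]] _.
  rewrite exchange_big /= sum_option /=; congr (_ + _).
    apply: eq_bigr => f _; rewrite !mulr_sumr; apply: eq_bigr => xs _.
    by rewrite /u /= mulr1 mulrA.
  rewrite mulr_sumr; apply: eq_bigr => z _; rewrite mulr_sumr; apply: eq_bigr => f _.
  rewrite !mulr_sumr; apply: eq_bigr => xs _; rewrite /u /=; ring.
have sumu : \sum_j u j = 2.
  transitivity (\sum_j u j * 1); first by apply: eq_bigr => j _; rewrite mulr1.
  rewrite sumJ /=.
  have one f : noise_weight f * (cX * \sum_(xs : Xs) 1) = noise_weight f.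
    by rewrite sumr_const cX1 mulr1.
  under eq_bigr do rewrite one.
  rewrite sum_noise_weight sumr_const mulVf ?gt_eqF //.
have eta0 : 0 < 1 / 100 :> R by rewrite divr_gt0.
have [A Amem Asucc] := average_over_seeds solv u0 (fun j => size_tail (center j) j.2) eta0.
pose upd := foldl (@mem_update _ _ A).
pose step (q : mem_state A) (x : X) := upd q (vector_stream pos (int_row x)).
pose out (q : mem_state A) (v : V) : R :=
  (test (mem_output (upd q (vector_stream pos (crow v)))))%:R.
pose q0 := upd (mem_init A) base.
have runE (j : J) : run A (st j) = mem_output (upd (foldl step q0 j.2) (vector_stream pos
     (crow (to_Zp m (center j) - \sum_(x <- j.2) box_Zp m x)))).
  rewrite /run /st /tail_stream !foldl_cat -/(upd _ _) -/q0; congr (mem_output (upd _ _)).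
  rewrite -/(upd (mem_init A) base) -/q0; move: q0.
  elim: (tval j.2) => [//|x xs IH] q /=.
  by rewrite foldl_cat IH.
have out01 q y : 0 <= out q y <= 1 by rewrite /out; case: (test _); rewrite ?lexx ?ler01.
pose E (M : 'rV[int]_D) := expect (@box_Zp D B m) step out N q0 (to_Zp m M).
have EE M : E M = cX * \sum_(xs : Xs) (test (mem_output (upd (foldl step q0 xs)
     (vector_stream pos (crow (to_Zp m M - \sum_(x <- xs) box_Zp m x))))))%:R.
  by rewrite /E expect_tuple.
have cQ (r : nat) : (B ^ r <= 40 * #|mem_state A| * 3 ^ r)%N -> (B ^ r <= 40 * 2 ^ S * 3 ^ r)%N.
  by move/leq_trans; apply; rewrite leq_mul2r leq_mul2l Amem !orbT.
have := indistinguishable s2_gt0 m_gt1 m_big F_gt0 spike_le a_gt0 t_gt0 eps_itv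
  (fun r P h => @spike_hidden r P (cQ r h)) L_big s2_big L_tail B_gt0 step out01 q0 N_gt0.
pose E0 := \sum_f noise_weight f * E (noise_row f).
pose E1 := #|F|%:R^-1 * \sum_z \sum_f noise_weight f * E (noise_row f + spike z).
have -> : \sum_v spike_diff L s2 spike v * expect (@box_Zp D B m) step out N q0 v = E1 - E0.
  transitivity (#|F|%:R^-1 * \sum_z \sum_v gdens L s2 (v - to_Zp m (spike z)) *
      expect (@box_Zp D B m) step out N q0 v -
      \sum_v gdens L s2 v * expect (@box_Zp D B m) step out N q0 v).
    rewrite exchange_big mulr_sumr -sumrB; apply: eq_bigr => v _.
    by rewrite /spike_diff -mulr_suml; ring.
  congr (_ - _); last by rewrite sum_gdens.
  congr (_ * _); apply: eq_bigr => z _; rewrite (reindex_inj (addIr (to_Zp m (spike z)))) /=.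
  under eq_bigr do rewrite addrK.
  rewrite (sum_gdens (fun v => expect (@box_Zp D B m) step out N q0 (v + to_Zp m (spike z)))).
  by apply: eq_bigr => f _; rewrite /E to_ZpD.
have Nt : 0 < N%:R * (t ^+ 2 / 32) by rewrite mulr_gt0 ?ltr0n // divr_gt0 ?exprn_gt0.
have small : D%:R * ln m%:R / (N%:R * (t ^+ 2 / 32)) <= 20^-1.
  by rewrite ler_pdivrMr.
rewrite ler_norml => /andP[low _].
have center_le (j : J) e : (`|center j 0%R e| <= L + a)%N.
  rewrite /center mxE mxE; have h : (`|gval (j.1.1 e)| <= L)%N := gval_bound _.
  case: (j.1.2) => [z|]; last by rewrite mxE addr0 (leq_trans h) // leq_addr.
  exact: absz_add_le.
have succ_le (j : J) : (`[< correct (frequency (st j)) (run A (st j)) >] : nat)%:R <=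
   (if j.1.2 is Some _ then 1 - (test (run A (st j)))%:R else (test (run A (st j)))%:R)
   + (~~ good j.1.1)%:R :> R.
  case: (boolP (good j.1.1)) => gj; last first.
    have -> : (~~ false)%:R = 1 :> R by [].
    have b01 (b : bool) : 0 <= b%:R :> R /\ b%:R <= 1 :> R by case: b; rewrite ?lexx ?ler01.
    have [_ h1] := b01 `[< correct (frequency (st j)) (run A (st j)) >].
    have [h2 h3] := b01 (test (run A (st j))).
    by case: (j.1.2) => [_|]; lra.
  rewrite addr0; case: asboolP => [c|_]; last first.
    by case: (j.1.2) => [_|//]; case: (test _); rewrite ?subrr ?subr0 ?ler01.
  rewrite /st frequency_tail in c; last exact: center_le.
  move: c gj; rewrite -/(st j); case: j => [[f [z|]] xs]; rewrite /center /= => + gj.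
    by move=> c; have /negbTE -> := test_spiked gj c; rewrite subr0.
  by rewrite addr0 => c; have -> := test_null gj c.
have total : 2 / 3 * 2 - 1 / 100 <= (E0 + \sum_f noise_weight f * (~~ good f)%:R) +
    (1 - E1 + \sum_f noise_weight f * (~~ good f)%:R).
  move: Asucc; rewrite sumu => /le_trans; apply.
  apply: le_trans (ler_sum _ (fun j _ => ler_wpM2l (u0 j) (succ_le j))) _.
  rewrite sumJ /= le_eqVlt; apply/orP; left; apply/eqP; congr (_ + _).
    rewrite /E0 -big_split /=; apply: eq_bigr => f _; rewrite -mulrDr; congr (_ * _).
    rewrite big_split /= sumr_const mulrDr EE -[_ *+ #|_|]mulr_natl mulrA cX1 mul1r.
    congr (_ + _); congr (_ * _); apply: eq_bigr => xs _.
    by rewrite runE /center /= addr0.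
  have Fsum (c : R) : #|F|%:R^-1 * \sum_(z : F) c = c.
    by rewrite sumr_const -[_ *+ #|_|]mulr_natl mulKf ?gt_eqF.
  rewrite -[X in X - E1]Fsum -[X in _ - E1 + X]Fsum /E1 -mulrBr -mulrDr; congr (_ * _).
  rewrite -sumrB -big_split /=; apply: eq_bigr => z _.
  rewrite -[X in X - _]sum_noise_weight -sumrB -big_split /=; apply: eq_bigr => f _.
  rewrite -[X in X - _ + _]mulr1 -mulrBr -mulrDr; congr (_ * _).
  rewrite big_split sumrB /= !sumr_const mulrDr mulrBr cX1 EE.
  rewrite -[X in _ + cX * X]mulr_natl mulrA cX1 mul1r.
  congr (_ - _ + _); congr (_ * _); apply: eq_bigr => xs _.
  by rewrite runE /center /=.
have bad : \sum_f noise_weight f * (~~ good f)%:R <= 1 / 100.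
  apply: le_trans good_whp; rewrite [leRHS]big_mkcond /=; apply: ler_sum => f _.
  by case: (good f); rewrite ?mulr0 ?mulr1.
move: low small t_small total bad.
set d1 := D%:R * ln m%:R / _; set d2 := _ * t; set b := \sum_f _.
by clearbody d1 d2 b E0 E1 => *; lra.
Qed.

End StreamingLowerBound.

(** * Spectra of spiked matrices *)

Section RealSpectral.
Variable R : realType.

Lemma dot_ge0 n (v : 'rV[R]_n) : 0 <= (v *m v^T) 0 0.
Proof. by rewrite mxE; apply: sumr_ge0 => i _; rewrite mxE -expr2 sqr_ge0. Qed.

Lemma dot_eq0 n (v : 'rV[R]_n) : (v *m v^T) 0 0 = 0 -> v = 0.
Proof.
rewrite mxE => /eqP; rewrite psumr_eq0 => [/allP z|i _]; last by rewrite mxE -expr2 sqr_ge0.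
apply/rowP => i; have := z i (mem_index_enum i).
by rewrite /= [X in _ * X]mxE -expr2 sqrf_eq0 [RHS]mxE => /eqP.
Qed.

Lemma dotC n (u v : 'rV[R]_n) : (u *m v^T) 0 0 = (v *m u^T) 0 0.
Proof. by rewrite -[v *m u^T]trmxK trmx_mul trmxK [in RHS]mxE. Qed.

(** A complex eigenvector [x + i y] with eigenvalue [a + i b] exists. Symmetry gives
    [b (|x|^2 + |y|^2) = 0], so [b = 0], and whichever of [x] and [y] is nonzero is a real
    eigenvector. *)
Lemma symmetric_eigenvector n (M : 'M[R]_n) : (0 < n)%N -> M^T = M ->
  exists (a : R) (v : 'rV[R]_n), v != 0 /\ v *m M = a *: v.
Proof.
move=> n0 MT.
have [mu /eigenvalueP[w wM w0]] := eigenvalue_closed (map_mx (real_complex R) M) n0.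
pose x := map_mx (@complex.Re R) w; pose y := map_mx (@complex.Im R) w.
pose a := complex.Re mu; pose b := complex.Im mu.
have ReM (z : R[i]) (r : R) : complex.Re (z * (real_complex R r)) = complex.Re z * r.
  by case: z => u v /=; rewrite mulr0 subr0.
have ImM (z : R[i]) (r : R) : complex.Im (z * (real_complex R r)) = complex.Im z * r.
  by case: z => u v /=; rewrite mulr0 add0r.
have xM : x *m M = a *: x - b *: y.
  apply/rowP => k; have /rowP/(_ k) := wM; rewrite !mxE => /(congr1 (@complex.Re R)).
  rewrite raddf_sum /= => e; transitivity (complex.Re (mu * w 0 k)).
    by rewrite -e; apply: eq_bigr => j _; rewrite !mxE ReM.
  by rewrite /a /b; case: mu {wM a b e} => u v; case: (w 0 k).
have yM : y *m M = b *: x + a *: y.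
  apply/rowP => k; have /rowP/(_ k) := wM; rewrite !mxE => /(congr1 (@complex.Im R)).
  rewrite raddf_sum /= => e; transitivity (complex.Im (mu * w 0 k)).
    by rewrite -e; apply: eq_bigr => j _; rewrite !mxE ImM.
  by rewrite /a /b; case: mu {wM a b e xM} => u v; case: (w 0 k) => * /=; rewrite addrC.
have xy0 : (x != 0) || (y != 0).
  apply: contraR w0; rewrite negb_or !negbK => /andP[/eqP x0 /eqP y0].
  apply/eqP/rowP => k; have /rowP/(_ k) := x0; have /rowP/(_ k) := y0.
  by rewrite !mxE; case: (w 0 k) => u v /= -> ->.
pose sx := (x *m x^T) 0 0; pose sy := (y *m y^T) 0 0.
have b0 : b = 0.
  have e1 : (x *m M *m y^T) 0 0 = (y *m M *m x^T) 0 0.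
    have -> : y *m M *m x^T = (x *m M *m y^T)^T by rewrite !trmx_mul !trmxK MT mulmxA.
    by rewrite [RHS]mxE.
  have dl (c d : R) (p q r : 'rV[R]_n) : ((c *: p + d *: q) *m r^T) 0 0 =
      c * (p *m r^T) 0 0 + d * (q *m r^T) 0 0.
    by rewrite mulmxDl -!scalemxAl !mxE.
  move: e1; rewrite xM yM -scaleNr !dl (dotC y x) -/sx -/sy => e1.
  have : b * (sx + sy) = 0 by lra.
  move=> /eqP; rewrite mulf_eq0 => /orP[/eqP //|].
  rewrite paddr_eq0 ?dot_ge0 // => /andP[/eqP sx0 /eqP sy0].
  by move: xy0; rewrite (dot_eq0 sx0) (dot_eq0 sy0) eqxx.
case/orP: xy0 => h; [exists a, x|exists a, y]; split => //.
  by rewrite xM b0 scale0r subr0.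
by rewrite yM b0 scale0r add0r.
Qed.

(** The reflection in the hyperplane orthogonal to [e0 - v] exchanges the unit vectors [e0] and
    [v]. *)
Lemma householder n (v : 'rV[R]_(1 + n)) : (v *m v^T) 0 0 = 1 ->
  exists H : 'M[R]_(1 + n), [/\ H^T = H, H *m H = 1%:M & delta_mx 0 0 *m H = v].
Proof.
move=> v1; pose e0 : 'rV[R]_(1 + n) := delta_mx 0 0; pose w := e0 - v.
have [w0|w0] := eqVneq w 0.
  exists 1%:M; split; rewrite ?trmx1 ?mulmx1 //.
  by apply/eqP; rewrite -subr_eq0; apply/eqP.
pose s := (w *m w^T) 0 0.
have s0 : s != 0 by apply: contra_neq w0 => /dot_eq0.
have ww : w *m w^T = s%:M by rewrite [LHS]mx11_scalar.
pose H := 1%:M - (2 / s) *: (w^T *m w).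
have HT : H^T = H by rewrite /H linearB /= trmx1 linearZ /= trmx_mul trmxK.
exists H; split => //.
  have NN : w^T *m w *m (w^T *m w) = s *: (w^T *m w).
    by rewrite mulmxA -(mulmxA _ w) ww mul_mx_scalar -scalemxAl.
  rewrite /H mulmxBr mulmx1 mulmxBl mul1mx -scalemxAl -scalemxAr NN !scalerA.
  have -> : 2 / s * (2 / s) * s = 2 / s + 2 / s by field.
  by rewrite scalerDl opprB addrK subrK.
have ev : (e0 *m v^T) 0 0 = (e0 *m e0^T) 0 0 - s / 2.
  rewrite /s /w linearB /= mulmxBl !mulmxBr !mxE.
  have := dotC e0 v; have := v1.
  have : (e0 *m e0^T) 0 0 = 1 by rewrite -rowE !mxE eqxx.
  rewrite !mxE => -> -> ->; lra.
have ew : e0 *m w^T = (s / 2)%:M.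
  rewrite [LHS]mx11_scalar /w linearB /= mulmxBr; congr (_%:M).
  by rewrite mxE [X in _ + X]mxE ev; lra.
rewrite /H mulmxBr mulmx1 -scalemxAr mulmxA ew mul_scalar_mx scalerA.
have -> : 2 / s * (s / 2) = 1 by field.
by rewrite scale1r /w opprB addrCA subrr addr0.
Qed.

(** Deflation: conjugating by a reflection that carries the first unit vector to an eigenvector
    splits off a 1 x 1 block. *)
Theorem real_spectral n (M : 'M[R]_n) : M^T = M ->
  exists (Q : 'M[R]_n) (l : 'rV[R]_n), Q *m Q^T = 1%:M /\ M = Q^T *m diag_mx l *m Q.
Proof.
elim: n M => [|n IH] M MT.
  by exists 1%:M, 0; split; apply/matrixP => -[].
have [a [v0 [v00 v0M]]] := symmetric_eigenvector (ltn0Sn n) MT.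
pose s := (v0 *m v0^T) 0 0.
have s0 : 0 < s.
  by rewrite lt_def dot_ge0 andbT; apply: contra_neq v00 => /dot_eq0.
pose v := (Num.sqrt s)^-1 *: v0.
have v1 : (v *m v^T) 0 0 = 1.
  rewrite /v linearZ /= -scalemxAl -scalemxAr scalerA mxE -/s -invfM -expr2.
  by rewrite sqr_sqrtr ?mulVf ?gt_eqF // ltW.
have vM : v *m M = a *: v by rewrite /v -scalemxAl v0M !scalerA mulrC.
have [H [HT HH He]] := @householder n v v1.
pose M1 : 'M[R]_(1 + n) := H *m M *m H.
have M1T : M1^T = M1 by rewrite /M1 !trmx_mul HT MT mulmxA.
have vH : v *m H = delta_mx 0 0 by rewrite -He -mulmxA HH mulmx1.
have eM1 : delta_mx 0 0 *m M1 = a *: delta_mx 0 0 :> 'rV_(1 + n).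
  by rewrite /M1 !mulmxA He vM -scalemxAl vH.
have ME : M = H *m (M1 *m H).
  by rewrite /M1 !mulmxA HH mul1mx -mulmxA HH mulmx1.
clearbody M1.
have row0 j : M1 0 j = a *+ (j == 0).
  have /rowP/(_ j) := eM1; rewrite -rowE !mxE eqxx /= => ->.
  by rewrite eq_sym mulr_natr.
have M1E : M1 = block_mx a%:M 0 0 (drsubmx M1).
  rewrite -{1}[M1]submxK; congr block_mx.
  - apply/matrixP => i j; rewrite !mxE !ord1 !lshift0 row0 eqxx.
    by rewrite mulr1n.
  - by apply/matrixP => i j; rewrite !mxE !ord1 lshift0 row0.
  - apply/matrixP => i j; rewrite !mxE !ord1 lshift0 -M1T mxE row0.
    by [].
have [|Q' [l' [Q'Q M'E]]] := IH (drsubmx M1).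
  by rewrite trmx_drsub M1T.
pose K : 'M[R]_(1 + n) := block_mx 1%:M 0 0 Q'.
have KT : K^T = block_mx 1%:M 0 0 Q'^T by rewrite /K tr_block_mx !trmx0 trmx1.
have KK : K *m K^T = 1%:M.
  rewrite KT /K mulmx_block !(mulmx0, mul0mx, addr0, add0r, mulmx1) Q'Q.
  by rewrite -scalar_mx_block.
have KD : K^T *m diag_mx (row_mx a%:M l') *m K = M1.
  rewrite [RHS]M1E M'E KT /K diag_mx_row !mulmx_block.
  rewrite !(mulmx0, mul0mx, addr0, add0r, mulmx1, mul1mx).
  by congr block_mx; apply/matrixP => i j; rewrite !mxE !ord1 mulr1n.
exists (K *m H), (row_mx a%:M l'); split.
  by rewrite trmx_mul HT mulmxA -(mulmxA K) HH mulmx1.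
by rewrite trmx_mul HT {1}ME -KD !mulmxA.
Qed.

End RealSpectral.

Section EigenvalueList.
Variable R : realType.

Lemma char_poly_orthogonal n (Q : 'M[R]_n) (l : 'rV[R]_n) : Q *m Q^T = 1%:M ->
  char_poly (Q^T *m diag_mx l *m Q) = \prod_i ('X - (l 0 i)%:P).
Proof.
move=> QQ; have QTQ : Q^T *m Q = 1%:M by exact: mulmx1C.
have -> : \prod_i ('X - (l 0 i)%:P) = char_poly (diag_mx l).
  rewrite char_poly_trig; first by apply: eq_bigr => i _; rewrite mxE eqxx mulr1n.
  by apply/is_trig_mxP => i j ij; rewrite mxE -val_eqE ltn_eqF.
rewrite /char_poly /char_poly_mx !map_mxM.
have mQ : map_mx (@polyC R) Q^T *m map_mx polyC Q = 1%:M by rewrite -map_mxM QTQ map_mx1.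
have e : 'X%:M = map_mx (@polyC R) Q^T *m 'X%:M *m map_mx polyC Q :> 'M[{poly R}]_n.
  by rewrite mul_mx_scalar -scalemxAl mQ scalemx1.
rewrite {1}e -mulmxBl -mulmxBr !det_mulmx mulrC mulrA -det_mulmx.
by rewrite (mulmx1C mQ) det1 mul1r.
Qed.

Lemma eigenvalues_perm n (M : 'M[R]_n) (s : seq R) :
  char_poly M = \prod_(y <- s) ('X - y%:P) -> perm_eq (eigenvalues M) s.
Proof.
move=> cM; apply/allP => x _; apply/eqP.
rewrite -(mu_prod_XsubC x s) -cM /eigenvalues; set p := char_poly M.
have p0 : p != 0 by rewrite monic_neq0 // char_poly_monic.
rewrite count_flatten -map_comp sumnE big_map.
have [xr|xr] := boolP (x \in rootsR p).
  rewrite (bigD1_seq x) //= ?uniq_roots // count_nseq /= eqxx mul1n big1 ?addn0 // => y yx.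
  by rewrite count_nseq /= (negbTE yx) mul0n.
rewrite big1_seq; last first.
  move=> y /andP[_ yr]; rewrite /= count_nseq /=; case: eqP => [yx|_]; last by rewrite mul0n.
  by move: xr; rewrite -yx yr.
apply/esym/eqP; rewrite -leqn0 leqNgt mup_geq //; apply: contra xr.
rewrite expr1 dvdp_XsubCl => rx.
by have := roots_on_rootsR p0 x; rewrite in_itv /= rx => <-.
Qed.

Lemma lambda_min_le n (M : 'M[R]_n) x : x \in eigenvalues M -> lambda_min M <= x.
Proof.
rewrite /lambda_min /eigenvalues; set p := char_poly M.
have p0 : p != 0 by rewrite monic_neq0 // char_poly_monic.
have mu_gt0 y : y \in rootsR p -> (0 < mup y p)%N.
  move=> yr; rewrite mup_geq // expr1 dvdp_XsubCl.
  by have := roots_on_rootsR p0 y; rewrite yr in_itv /= => ->.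
have : sorted <%R (rootsR p) by exact: sorted_roots.
case: (rootsR p) mu_gt0 => [//|r rs] mu_gt0 srt.
have mr := mu_gt0 r (mem_head _ _); rewrite /=.
case: (mup r p) mr => [//|k] _ /= xin.
have : x \in r :: rs.
  move: xin; rewrite inE mem_cat => /orP[/eqP ->|/orP[]]; first exact: mem_head.
    by rewrite mem_nseq => /andP[_ /eqP ->]; exact: mem_head.
  by move=> /flatten_mapP[y yrs]; rewrite mem_nseq => /andP[_ /eqP ->]; rewrite inE yrs orbT.
rewrite inE => /orP[/eqP -> //|xrs].
by apply: ltW; move: srt; rewrite /= lt_path_sortedE => /andP[/allP/(_ x xrs)].
Qed.

End EigenvalueList.

Section SpikedSpectrum.
Variables (R : realType) (n : nat).

Definition quad (M : 'M[R]_n) (x : 'rV[R]_n) : R := (x *m M *m x^T) 0 0.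
Definition sqn (x : 'rV[R]_n) : R := (x *m x^T) 0 0.

(** The trace condition expresses that the form effectively has dimension [d] inside [n]: it makes
    the Schatten norm grow like [d^(1/q)] and not [n^(1/q)]. *)
Definition bounded_form (E : 'M[R]_n) (kappa : R) (d : nat) : Prop :=
  [/\ E^T = E, forall x, 0 <= quad E x <= kappa * sqn x & \tr E <= kappa * d%:R].

Variables (E : 'M[R]_n) (u : 'rV[R]_n) (a kappa : R) (d : nat).
Hypothesis E_bounded : bounded_form E kappa d.
Hypothesis a_ge0 : 0 <= a.
Hypothesis kappa_ge0 : 0 <= kappa.
Hypothesis u_norm : sqn u = d%:R.
Let M := E - a *: (u^T *m u).

Lemma spiked_sym : M^T = M.
Proof.
have [ET _ _] := E_bounded.
by rewrite /M linearB /= linearZ /= trmx_mul trmxK ET.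
Qed.

Variables (Q : 'M[R]_n) (l : 'rV[R]_n).
Hypothesis QQ : Q *m Q^T = 1%:M.
Hypothesis MQ : M = Q^T *m diag_mx l *m Q.

Let al i := (row i Q *m u^T) 0 0 ^+ 2.

Lemma quad_spiked x : quad M x = quad E x - a * (x *m u^T) 0 0 ^+ 2.
Proof.
rewrite /quad /M mulmxBr mulmxBl -scalemxAr -scalemxAl.
rewrite mxE [X in _ + X]mxE [X in _ - X]mxE; congr (_ - _ * _).
have -> : x *m (u^T *m u) *m x^T = (x *m u^T) *m (u *m x^T) by rewrite !mulmxA.
by rewrite mxE big_ord1 (dotC u x) -expr2.
Qed.

Lemma sum_overlap (x : 'rV[R]_n) : \sum_i (row i Q *m x^T) 0 0 ^+ 2 = sqn x.
Proof.
have QTQ : Q^T *m Q = 1%:M by exact: mulmx1C.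
have -> : sqn x = ((Q *m x^T)^T *m (Q *m x^T)) 0 0.
  by rewrite trmx_mul trmxK mulmxA -(mulmxA x) QTQ mulmx1.
rewrite mxE; apply: eq_bigr => i _; rewrite [(_^T) _ _]mxE -expr2; congr (_ ^+ 2).
by rewrite -row_mul mxE.
Qed.

Lemma row_norm i : sqn (row i Q) = 1.
Proof.
have <- : (Q *m Q^T) i i = 1 by rewrite QQ mxE eqxx.
by rewrite /sqn !mxE; apply: eq_bigr => j _; rewrite !mxE.
Qed.

Lemma eigen_quad i : l 0 i = quad M (row i Q).
Proof.
rewrite /quad MQ rowE trmx_mul !mulmxA.
rewrite -[delta_mx 0 i *m Q *m Q^T]mulmxA QQ mulmx1 -[_ *m Q *m Q^T]mulmxA QQ mulmx1.
rewrite -rowE mxE (bigD1 i) //= !mxE !eqxx mulr1 mulr1n big1 ?addr0 // => j ji.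
by rewrite !mxE eq_sym (negbTE ji) mulr0n mul0r.
Qed.

Lemma sum_quad_rows : \sum_i quad E (row i Q) = \tr E.
Proof.
have QTQ : Q^T *m Q = 1%:M by exact: mulmx1C.
have -> : \tr E = \tr (Q *m E *m Q^T) by rewrite mxtrace_mulC mulmxA QTQ mul1mx.
rewrite /mxtrace; apply: eq_bigr => i _; rewrite /quad -row_mul !mxE.
by apply: eq_bigr => j _; rewrite !mxE.
Qed.

Lemma overlap_sum : \sum_i al i = d%:R.
Proof. by rewrite sum_overlap. Qed.

Lemma neg_eigen_le i : - (a * al i) <= l 0 i.
Proof.
have [_ Eq _] := E_bounded.
rewrite eigen_quad quad_spiked -/(al i).
by case/andP: (Eq (row i Q)); lra.
Qed.

Lemma pos_eigen_le i : l 0 i <= quad E (row i Q).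
Proof. by rewrite eigen_quad quad_spiked gerBl mulr_ge0 // sqr_ge0. Qed.

Lemma quad_row_le i : 0 <= quad E (row i Q) <= kappa.
Proof. by have [_ /(_ (row i Q)) + _] := E_bounded; rewrite row_norm mulr1. Qed.

(** [quad M u] is the sum of the eigenvalues with the nonnegative weights [al], of total [d], and it
    is at most [(kappa - a d) d]. *)
Lemma exists_low_eigenvalue : (0 < d)%N -> exists i, l 0 i <= kappa - a * d%:R.
Proof.
move=> d0; have [_ Eq _] := E_bounded.
apply: contrapT => none.
have big i : kappa - a * d%:R < l 0 i by rewrite ltNge; apply/negP => h; apply: none; exists i.
have dp : 0 < d%:R :> R by rewrite ltr0n.
have qu : quad M u = \sum_i l 0 i * al i.
  have -> : quad M u = ((Q *m u^T)^T *m diag_mx l *m (Q *m u^T)) 0 0.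
    by rewrite /quad MQ trmx_mul trmxK !mulmxA.
  rewrite mxE; apply: eq_bigr => i _.
  rewrite mxE (bigD1 i) //= big1 ?addr0 => [|j ji]; last first.
    by rewrite !mxE (negbTE ji) mulr0n mulr0.
  rewrite [(_^T) _ _]mxE [diag_mx l _ _]mxE eqxx mulr1n /al -row_mul [row _ _ _ _]mxE.
  by ring.
have h1 : quad M u <= (kappa - a * d%:R) * d%:R.
  rewrite quad_spiked -/(sqn u) u_norm expr2; have /andP[_] := Eq u; rewrite u_norm; lra.
have [i ali] : exists i, 0 < al i.
  apply: contrapT => z; have : \sum_i al i <= 0.
    by apply: sumr_le0 => i _; rewrite leNgt; apply/negP => h; apply: z; exists i.
  by rewrite overlap_sum leNgt dp.
have : \sum_i (l 0 i - (kappa - a * d%:R)) * al i <= 0.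
  under eq_bigr do rewrite mulrBl.
  by rewrite sumrB -qu -mulr_sumr overlap_sum subr_le0.
have pos j : 0 <= (l 0 j - (kappa - a * d%:R)) * al j.
  by rewrite mulr_ge0 ?sqr_ge0 // subr_ge0 ltW.
rewrite (bigD1 i) //=; apply/negP; rewrite -ltNge.
apply: ltr_pwDl; first by rewrite mulr_gt0 // subr_gt0.
by apply: sumr_ge0 => j _.
Qed.

Lemma abs_eigen_le i : `|l 0 i| <= Num.max (a * d%:R) kappa.
Proof.
rewrite ler_norml; apply/andP; split.
  rewrite lerNl le_max; apply/orP; left; have := neg_eigen_le i.
  have : a * al i <= a * d%:R.
    rewrite ler_wpM2l // -overlap_sum (bigD1 i) //= lerDl.
    by apply: sumr_ge0 => j _; exact: sqr_ge0.
  lra.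
rewrite le_max; apply/orP; right; apply: le_trans (pos_eigen_le i) _.
by case/andP: (quad_row_le i).
Qed.

Lemma powR_le_linear (x y q : R) : 1 <= q -> 0 <= x <= y -> x `^ q <= x * y `^ (q - 1).
Proof.
move=> q1 /andP[x0 xy]; have q0 : 0 < q by lra.
rewrite -(mulr_powRB1 x0 q0) ler_wpM2l //.
by rewrite ge0_ler_powR ?nnegrE ?subr_ge0 // (le_trans x0).
Qed.

(** This replaces the triangle inequality for Schatten norms. A negative eigenvalue is charged to
    the overlap [al i] with the spike, a nonnegative one to the bounded part; the charges sum to
    [a d] and to the trace. Linearizing the powers leaves [X^q + Y^q <= (X + Y)^q]. *)
Lemma sum_pow_eigen (q : R) : 1 <= q ->
  \sum_i `|l 0 i| `^ q <= (a * d%:R + d%:R `^ q^-1 * kappa) `^ q.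
Proof.
move=> q1; have q0 : 0 < q by lra.
have d0 : 0 <= d%:R :> R by [].
have [_ _ trE] := E_bounded.
have term i : `|l 0 i| `^ q <= a * al i * (a * d%:R) `^ (q - 1) +
     quad E (row i Q) * kappa `^ (q - 1).
  have [Ei0 Eik] := andP (quad_row_le i).
  have al0 : 0 <= al i by exact: sqr_ge0.
  have ald : al i <= d%:R.
    by rewrite -overlap_sum (bigD1 i) //= lerDl; apply: sumr_ge0 => j _; exact: sqr_ge0.
  have [l0|l0] := lerP 0 (l 0 i).
    rewrite ger0_norm //; apply: (@le_trans _ _ (quad E (row i Q) `^ q)).
      by rewrite ge0_ler_powR ?nnegrE ?pos_eigen_le // ltW.
    apply: le_trans (powR_le_linear q1 (quad_row_le i)) _.
    by rewrite lerDr mulr_ge0 ?powR_ge0 // mulr_ge0.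
  rewrite ltr0_norm //; apply: (@le_trans _ _ ((a * al i) `^ q)).
    have aal : 0 <= a * al i by rewrite mulr_ge0.
    rewrite ge0_ler_powR ?nnegrE ?aal ?(ltW q0) //; first by lra.
    by have := neg_eigen_le i; lra.
  apply: le_trans (powR_le_linear (y := a * d%:R) q1 _) _.
    by rewrite mulr_ge0 //= ler_wpM2l.
  by rewrite lerDl mulr_ge0 ?powR_ge0.
apply: le_trans (ler_sum _ (fun i _ => term i)) _.
rewrite big_split /= -!mulr_suml -mulr_sumr overlap_sum sum_quad_rows.
set X := a * d%:R; set Y := d%:R `^ q^-1 * kappa.
have X0 : 0 <= X by rewrite mulr_ge0.
have Y0 : 0 <= Y by rewrite mulr_ge0 ?powR_ge0.
have -> : X * X `^ (q - 1) = X `^ q by exact: mulr_powRB1.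
have YE : \tr E * kappa `^ (q - 1) <= Y `^ q.
  apply: (@le_trans _ _ (kappa * d%:R * kappa `^ (q - 1))).
    by rewrite ler_wpM2r ?powR_ge0.
  rewrite mulrAC mulr_powRB1 // /Y powRM ?powR_ge0 // -powRrM mulVf ?gt_eqF // powRr1 //.
  by rewrite mulrC.
apply: le_trans (lerD (lexx _) YE) _.
have -> : (X + Y) `^ q = X * (X + Y) `^ (q - 1) + Y * (X + Y) `^ (q - 1).
  by rewrite -mulrDl mulr_powRB1 // addr_ge0.
by rewrite lerD // powR_le_linear // ?X0 ?Y0 /= ?lerDl ?lerDr.
Qed.

End SpikedSpectrum.

Section SpikedNorms.
Variables (R : realType) (n : nat).
Variables (E : 'M[R]_n) (u : 'rV[R]_n) (a kappa : R) (d : nat).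
Hypothesis E_bounded : bounded_form E kappa d.
Hypothesis a_ge0 : 0 <= a.
Hypothesis kappa_ge0 : 0 <= kappa.
Hypothesis u_norm : sqn u = d%:R.
Let M := E - a *: (u^T *m u).

Lemma eigenvalues_diag (N Q : 'M[R]_n) (l : 'rV[R]_n) : Q *m Q^T = 1%:M ->
  N = Q^T *m diag_mx l *m Q -> perm_eq (eigenvalues N) [seq l 0 i | i <- index_enum 'I_n].
Proof.
move=> QQ NQ; apply: eigenvalues_perm; rewrite NQ char_poly_orthogonal // big_map.
by [].
Qed.

Lemma gram_diag (Q : 'M[R]_n) (l : 'rV[R]_n) : Q *m Q^T = 1%:M ->
  M = Q^T *m diag_mx l *m Q -> M^T *m M = Q^T *m diag_mx (\row_i l 0 i ^+ 2) *m Q.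
Proof.
move=> QQ MQ; rewrite (spiked_sym u a E_bounded) -/M MQ !mulmxA -[_ *m Q *m Q^T]mulmxA QQ mulmx1.
rewrite -[_ *m diag_mx l *m diag_mx l]mulmxA mulmx_diag; congr (_ *m diag_mx _ *m _).
Qed.

Lemma singular_values_diag (Q : 'M[R]_n) (l : 'rV[R]_n) : Q *m Q^T = 1%:M ->
  M = Q^T *m diag_mx l *m Q ->
  perm_eq (singular_values M) [seq `|l 0 i| | i <- index_enum 'I_n].
Proof.
move=> QQ MQ; rewrite /singular_values.
have -> : [seq `|l 0 i| | i <- index_enum 'I_n] =
    [seq Num.sqrt x | x <- [seq (\row_i l 0 i ^+ 2) 0 i | i <- index_enum 'I_n]].
  by rewrite -map_comp; apply: eq_map => i /=; rewrite mxE sqrtr_sqr.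
exact: perm_map (eigenvalues_diag QQ (gram_diag QQ MQ)).
Qed.

Lemma spiked_lambda_min : (0 < d)%N ->
  (exists2 y, y \in eigenvalues M & y <= kappa - a * d%:R) /\
  lambda_min M <= kappa - a * d%:R.
Proof.
move=> d0; have [Q [l [QQ MQ]]] := real_spectral (spiked_sym u a E_bounded).
have [i li] := exists_low_eigenvalue E_bounded u_norm QQ MQ d0.
have lin : l 0 i \in eigenvalues M.
  by rewrite (perm_mem (eigenvalues_diag QQ MQ)) map_f // mem_index_enum.
split; first by exists (l 0 i).
exact: le_trans (lambda_min_le lin) li.
Qed.

Lemma spiked_schatten (q : R) : 1 <= q ->
  schatten_norm q%:E M <= a * d%:R + d%:R `^ q^-1 * kappa.
Proof.
move=> q1; have q0 : 0 < q by lra.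
have [Q [l [QQ MQ]]] := real_spectral (spiked_sym u a E_bounded).
rewrite /schatten_norm (perm_big _ (singular_values_diag QQ MQ)) big_map.
set Z := a * d%:R + _.
have Z0 : 0 <= Z by rewrite addr_ge0 // mulr_ge0 ?powR_ge0.
have -> : Z = (Z `^ q) `^ q^-1 by rewrite -powRrM mulfV ?gt_eqF // powRr1.
rewrite ge0_ler_powR ?nnegrE ?invr_ge0 ?(ltW q0) ?powR_ge0 //.
  by apply: sumr_ge0 => i _; exact: powR_ge0.
exact: (sum_pow_eigen E_bounded a_ge0 kappa_ge0 u_norm QQ MQ q1).
Qed.

Lemma spiked_schatten_infty : schatten_norm +oo%E M <= a * d%:R + kappa.
Proof.
have [Q [l [QQ MQ]]] := real_spectral (spiked_sym u a E_bounded).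
have ad0 : 0 <= a * d%:R by rewrite mulr_ge0.
rewrite /schatten_norm (perm_big _ (singular_values_diag QQ MQ)) big_map.
apply: (big_ind (fun x => x <= a * d%:R + kappa)) => [|x y hx hy|i _]; first by rewrite addr_ge0.
  by rewrite ge_max hx.
apply: le_trans (abs_eigen_le E_bounded a_ge0 u_norm QQ MQ i) _.
by rewrite ge_max lerDl lerDr kappa_ge0.
Qed.

Lemma spiked_frobenius : frobenius_norm M <= a * d%:R + Num.sqrt d%:R * kappa.
Proof.
have [Q [l [QQ MQ]]] := real_spectral (spiked_sym u a E_bounded).
set Z := a * d%:R + _.
have Z0 : 0 <= Z by rewrite addr_ge0 // mulr_ge0 ?sqrtr_ge0.
have -> : Z = Num.sqrt (Z ^+ 2) by rewrite sqrtr_sqr ger0_norm.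
rewrite /frobenius_norm ler_wsqrtr //.
have -> : \sum_(i < n) \sum_(j < n) M i j ^+ 2 = \tr (M^T *m M).
  rewrite /mxtrace exchange_big /=; apply: eq_bigr => i _; rewrite mxE.
  by apply: eq_bigr => j _; rewrite [(_^T) _ _]mxE expr2.
rewrite (gram_diag QQ MQ) mxtrace_mulC mulmxA QQ mul1mx /mxtrace.
have le12 : (1 : R) <= 2 by lra.
have := sum_pow_eigen E_bounded a_ge0 kappa_ge0 u_norm QQ MQ le12.
rewrite powR12_sqrt // -/Z powR_mulrn //; apply: le_trans; apply: ler_sum => i _.
by rewrite !mxE eqxx mulr1n powR_mulrn // real_normK ?num_real.
Qed.

End SpikedNorms.

(** * From correct answers to spike detectors *)

Section Separation.
Variables (R : realType) (n : nat).
Let I := ('I_n * 'I_n)%type.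

Definition null_class (kappa : R) (d : nat) (f : I -> int) : Prop :=
  bounded_form (matrix_of R f) kappa d.

Definition spike_class (kappa a : R) (d : nat) (f : I -> int) : Prop :=
  exists (E : 'M[R]_n) (u : 'rV[R]_n), [/\ bounded_form E kappa d, sqn u = d%:R &
    matrix_of R f = E - a *: (u^T *m u)].

(* Any [test] deciding between the two classes from a correct answer turns the
   algorithm into a detector of spikes; [eps1] bounds the accuracy [eps] and [e]
   the loss that it causes on the bounded part. *)
Definition separates (O : Type) (correct : (I -> int) -> O -> Prop) (eps1 e : R)
    (d : nat) : Prop :=
  forall kappa a : R, 0 <= kappa -> 0 < a ->
    kappa * (1 + e) < (1 - eps1) * a * d%:R ->
    exists test : O -> bool,
      (forall f o, null_class kappa d f -> correct f o -> test o) /\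
      (forall f o, spike_class kappa a d f -> correct f o -> ~~ test o).

Variables (eps eps1 : R) (d : nat).
Hypothesis eps_gt0 : 0 < eps.
Hypothesis eps_le : eps <= eps1.
Hypothesis eps1_lt1 : eps1 < 1.
Hypothesis d_gt0 : (0 < d)%N.

Lemma psd_separates_norm (p : \bar R) (e : R) :
  (forall (E : 'M[R]_n) (u : 'rV[R]_n) (a kappa : R), bounded_form E kappa d ->
     0 <= a -> 0 <= kappa -> sqn u = d%:R ->
     eps * schatten_norm p (E - a *: (u^T *m u)) <= eps * (a * d%:R) + e * kappa) ->
  separates (@psd_test R n eps p) eps1 e d.
Proof.
move=> norm_le kappa a k0 a0 gap; exists id; split => [f o [fT fq _] fc|f o [E [u [Eb un fE]]] fc].
  apply: (fc fT).1; split => // x.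
  by have /andP[] := fq x^T; rewrite /quad trmxK.
have dp : 0 < d%:R :> R by rewrite ltr0n.
have ad0 : 0 < a * d%:R by rewrite mulr_gt0.
have gap' : kappa * (1 + e) < (1 - eps) * (a * d%:R).
  apply: lt_le_trans gap _; rewrite -mulrA.
  by apply: ler_wpM2r; [exact: ltW|rewrite lerD2l lerN2].
have fT : (matrix_of R f)^T = matrix_of R f by rewrite fE; exact: spiked_sym Eb.
have lm := (spiked_lambda_min a Eb un d_gt0).2.
have ns := norm_le E u a kappa Eb (ltW a0) k0 un.
rewrite ((fc fT).2) //.
  (* The specification says nothing at the zero matrix, so it is excluded: it would give
     [a d <= kappa], against the gap. *)
  move=> f0; have [_ /(_ u)/andP[_ qu] _] := Eb.
  have : quad (matrix_of R f) u = 0 by rewrite f0 /quad mulmx0 mul0mx mxE.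
  rewrite fE quad_spiked -/(sqn u) un; rewrite un in qu.
  have : 0 <= eps * schatten_norm p (E - a *: (u^T *m u)).
    apply: mulr_ge0; first exact: ltW.
    case: p {fc norm_le ns} => [q| |] /=; [exact: powR_ge0| |exact: lexx].
    rewrite big_map; apply: (big_ind (fun x => 0 <= x)) => [//|x y x0 y0|i _].
      by rewrite le_max x0.
    exact: sqrtr_ge0.
  move=> s0 qE.
  have e1 : kappa * d%:R < a * d%:R * d%:R.
    rewrite ltr_pM2r //; nra.
  nra.
by rewrite fE mulNr; nra.
Qed.

Lemma psd_separates (q : R) : 1 <= q ->
  separates (@psd_test R n eps q%:E) eps1 (eps * d%:R `^ q^-1) d.
Proof.
move=> q1; apply: psd_separates_norm => E u a kappa Eb a0 k0 un.
rewrite -mulrA -mulrDr ler_wpM2l ?(ltW eps_gt0) //.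
exact: spiked_schatten.
Qed.

Lemma psd_separates_infty : separates (@psd_test R n eps +oo%E) eps1 eps d.
Proof.
apply: psd_separates_norm => E u a kappa Eb a0 k0 un.
rewrite -mulrDr ler_wpM2l ?(ltW eps_gt0) //.
exact: spiked_schatten_infty.
Qed.

(** The threshold [- th] is the error allowed on the unspiked side. On the spiked side the lowest
    eigenvalue is at most [kappa - a d] with error [eps a d + th], so [th] is paid twice; this is
    the 2 in [e]. *)
Lemma eigenvalue_separates : (d <= n)%N ->
  separates (@eigenvalue_approximation R n eps) eps1 (2 * eps * Num.sqrt d%:R) d.
Proof.
move=> dn kappa a k0 a0 gap.
have dp : 0 < d%:R :> R by rewrite ltr0n.
pose th := eps * (Num.sqrt d%:R * kappa).
have ad0 : 0 < a * d%:R by rewrite mulr_gt0.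
have gap' : kappa + 2 * th < (1 - eps) * (a * d%:R).
  apply: (@lt_le_trans _ _ ((1 - eps1) * (a * d%:R))).
    rewrite [ltRHS]mulrA; apply: le_lt_trans gap; rewrite /th; lra.
  by apply: ler_wpM2r; [exact: ltW|rewrite lerD2l lerN2].
exists (fun out => [forall i, - th <= out 0 i]).
split => [f o fb fc|f o [E [u [Eb un fE]]] fc].
  have [fT fq _] := fb; have [lam lamE lamP] := fc fT.
  (* Any vector of squared norm [d] serves here, multiplied by 0, to view the unspiked matrix as a
     spiked one and reuse the Frobenius bound. Its existence uses [d <= n]. *)
  pose u : 'rV[R]_n := \row_i (i < d)%N%:R.
  have un : sqn u = d%:R.
    rewrite /sqn mxE; under eq_bigr do rewrite !mxE -natrM mulnb andbb.
    rewrite -natr_sum; congr (_%:R); rewrite -(big_mkord xpredT (fun i => (i < d)%N : nat)).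
    rewrite (@big_cat_nat _ _ _ d) //= -[X in _ = X]addn0; congr (_ + _)%N.
      rewrite big_nat (eq_bigr (fun=> 1%N)) => [|i /andP[_ ->] //].
      by rewrite -big_nat sum_nat_const_nat subn0 muln1.
    by rewrite big_nat big1 // => i /andP[di _]; rewrite ltnNge di.
  have fE : matrix_of R f = matrix_of R f - 0 *: (u^T *m u) by rewrite scale0r subr0.
  have frob : frobenius_norm (matrix_of R f) <= Num.sqrt d%:R * kappa.
    by have := spiked_frobenius fb (lexx 0) k0 un; rewrite -fE mul0r add0r.
  have [Q [l [QQ MQ]]] := real_spectral fT.
  apply/forallP => i; have := lamP i.
  have : tnth lam i \in eigenvalues (matrix_of R f).
    by rewrite -(perm_mem lamE) mem_tnth.
  rewrite (perm_mem (eigenvalues_diag QQ MQ)) => /mapP[j _ ->].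
  rewrite {1}fE in MQ; rewrite (eigen_quad QQ MQ) -fE.
  have /andP[q0 _] := fq (row j Q).
  rewrite ler_norml => /andP[lo _].
  have : eps * frobenius_norm (matrix_of R f) <= th by rewrite ler_wpM2l // ltW.
  move: lo q0; set x := o 0 i; set y := quad _ _; lra.
have fT : (matrix_of R f)^T = matrix_of R f by rewrite fE; exact: spiked_sym Eb.
have [lam lamE lamP] := fc fT.
have [[y yin ylow] _] := spiked_lambda_min a Eb un d_gt0.
have frob := spiked_frobenius Eb (ltW a0) k0 un.
rewrite -fE in yin frob.
have : y \in lam by rewrite (perm_mem lamE).
move=> /tnthP[i yi]; apply/forallPn; exists i; rewrite -ltNge.
have := lamP i; rewrite -yi ler_norml => /andP[_ up].
have : eps * frobenius_norm (matrix_of R f) <= eps * (a * d%:R) + th.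
  by rewrite /th -mulrDr ler_wpM2l // ltW.
move: up gap'; set x := o 0 i; rewrite mulrBl mul1r; lra.
Qed.

End Separation.

(** * Operator norm of the noise *)

Section NoiseConcentration.
Variables (R : realType) (D L : nat) (s2 : R).
Hypothesis s2_gt0 : 0 < s2.
Let Noise := {ffun 'I_D -> 'I_(2 * L).+1}.

(** The tilt [k] is integral, so that completing the square turns the tilted sum into a shifted
    lattice window, to which [gauss_window] applies. *)
Lemma noise_mgf (k : 'I_D -> int) :
  \sum_(f : Noise) noise_weight s2 f * expR (\sum_e (k e)%:~R * (noise_row f 0 e)%:~R / s2)
    <= expR (\sum_e (k e)%:~R ^+ 2 / (2 * s2)).
Proof.
have g0 : 0 < gnorm L s2 by exact: gnorm_gt0.
rewrite expR_sum.
have -> : \sum_(f : Noise) noise_weight s2 f *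
      expR (\sum_e (k e)%:~R * (noise_row f 0 e)%:~R / s2) =
    \prod_e \sum_(i < (2 * L).+1) (gauss s2 (gval i) / gnorm L s2) *
      expR ((k e)%:~R * (gval i)%:~R / s2).
  rewrite bigA_distr_bigA /=; apply: eq_bigr => f _.
  rewrite /noise_weight expR_sum -big_split /=; apply: eq_bigr => e _.
  by rewrite mxE.
apply: ler_prod => e _; apply/andP; split.
  by apply: sumr_ge0 => i _; rewrite mulr_ge0 ?expR_ge0 // divr_ge0 ?expR_ge0 // ltW.
under eq_bigr do rewrite mulrAC.
rewrite -mulr_suml ler_pdivrMr //; exact: gauss_mgf.
Qed.

Lemma noise_chernoff (k : 'I_D -> int) (tau : R) :
  \sum_(f : Noise | tau < \sum_e (k e)%:~R * (noise_row f 0 e)%:~R) noise_weight s2 f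
    <= expR (\sum_e (k e)%:~R ^+ 2 / (2 * s2) - tau / s2).
Proof.
rewrite expRD expRN ler_pdivlMr ?expR_gt0 //; apply: le_trans (noise_mgf k).
rewrite mulr_suml big_mkcond /=; apply: ler_sum => f _; case: ifP => [lt|_].
  apply: ler_wpM2l; first exact: noise_weight_ge0.
  by rewrite ler_expR -mulr_suml ler_pM2r ?invr_gt0 // ltW.
by rewrite mulr_ge0 ?expR_ge0 // noise_weight_ge0.
Qed.
End NoiseConcentration.

(** Variance 1/2 makes the weights [exp (- i^2)], at most [2^-|i|], whose sum is 3. The bound serves
    to count lattice points in a ball. *)
Lemma gnorm_half_le (R : realType) (K : nat) : gnorm K (2^-1 : R) <= 3.
Proof.
pose F (i : int) : R := gauss 2^-1 i.
have F2 (k : nat) : F k%:Z <= (2 ^+ k)^-1 /\ F (- k%:Z) <= (2 ^+ k)^-1.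
  have F1 : F k%:Z <= (2 ^+ k)^-1.
    rewrite /F /gauss mulfV // divr1 expRN lef_pV2 ?posrE ?expR_gt0 ?exprn_gt0 //.
    apply: (@le_trans _ _ (expR 1 ^+ k)).
      by rewrite lerXn2r ?nnegrE ?expR_ge0 //; have := expR_ge1Dx (1 : R); lra.
    rewrite -expRM_natl mulr1 ler_expR -pmulrn -natrX ler_nat.
    by case: k => // k; rewrite expnS expn1 leq_pmull.
  by split; rewrite // /F gaussN.
suff : gnorm K (2^-1 : R) <= 3 - 2 * (2 ^+ K)^-1.
  by move/le_trans; apply; rewrite gerBl mulr_ge0 // invr_ge0 exprn_ge0.
elim: K => [|K IH].
  rewrite /gnorm big_ord_recl big_ord0 addr0 expr0 invr1 mulr1.
  have := (F2 0%N).1; rewrite expr0 invr1 /F /gval subr0; lra.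
have gE k : gnorm k (2^-1 : R) = \sum_(0 <= i < (2 * k).+1) F (i%:Z - k%:Z) by rewrite big_mkord.
rewrite gE mulnS addSn add1n big_nat_recl // big_nat_recr //= sub0r.
under eq_bigr => i _ do rewrite -addn1 -[K.+1]addn1 !PoszD opprD addrACA subrr addr0.
rewrite -gE.
have -> : (2 * K).+2%:Z - K.+1%:Z = K.+1%:Z by lia.
have [h1 h2] := F2 K.+1; move: IH h1 h2; rewrite exprS invfM.
set x := (2 ^+ K)^-1; lra.
Qed.

Section PairForm.
Variables (R : realType) (d : nat).
Hypothesis d_gt0 : (0 < d)%N.

Definition pair_index := {p : 'I_d * 'I_d | (p.1 < p.2)%N}.
Notation D := #|{: pair_index}|.

Definition pair_of (e : 'I_D) : 'I_d * 'I_d := val (enum_val e).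

(** The quadratic form of the symmetric matrix with zero diagonal and upper triangle [M]. *)
Definition pair_form (M : 'rV[R]_D) (x : 'rV[R]_d) : R :=
  \sum_e M 0 e * (2 * x 0 (pair_of e).1 * x 0 (pair_of e).2).

Let polar (M : 'rV[R]_D) (x y : 'rV[R]_d) : R :=
  \sum_e M 0 e * (x 0 (pair_of e).1 * y 0 (pair_of e).2 + x 0 (pair_of e).2 * y 0 (pair_of e).1).

Lemma sqnE (x : 'rV[R]_d) : sqn x = \sum_i x 0 i ^+ 2.
Proof. by rewrite /sqn mxE; apply: eq_bigr => i _; rewrite mxE expr2. Qed.

Lemma sqn_ge0 (x : 'rV[R]_d) : 0 <= sqn x.
Proof. by rewrite sqnE sumr_ge0 // => i _; exact: sqr_ge0. Qed.

Lemma sqnZ (c : R) (x : 'rV[R]_d) : sqn (c *: x) = c ^+ 2 * sqn x.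
Proof. by rewrite !sqnE mulr_sumr; apply: eq_bigr => i _; rewrite mxE exprMn. Qed.

Lemma sqn_parallelogram (x y : 'rV[R]_d) : sqn (x + y) + sqn (x - y) = 2 * (sqn x + sqn y).
Proof.
rewrite !sqnE -!big_split /= mulr_sumr; apply: eq_bigr => i _; rewrite !mxE; ring.
Qed.

Lemma pair_formZ M c x : pair_form M (c *: x) = c ^+ 2 * pair_form M x.
Proof. by rewrite /pair_form mulr_sumr; apply: eq_bigr => e _; rewrite !mxE; ring. Qed.

Lemma pair_form_polar M x y : pair_form M (x + y) - pair_form M (x - y) = 4 * polar M x y.
Proof.
rewrite /pair_form /polar mulr_sumr -sumrB; apply: eq_bigr => e _; rewrite !mxE; ring.
Qed.

Lemma pair_formD M x y : pair_form M (x + y) = pair_form M x + 2 * polar M x y + pair_form M y.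
Proof.
rewrite /pair_form /polar mulr_sumr -!big_split /=; apply: eq_bigr => e _; rewrite !mxE; ring.
Qed.

Lemma polarZ M c x y : c != 0 -> polar M (c *: x) (c^-1 *: y) = polar M x y.
Proof.
move=> c0; rewrite /polar; apply: eq_bigr => e _; rewrite !mxE; field.
exact: c0.
Qed.

Section Net.
Variables (M : 'rV[R]_D) (T : R).
Hypothesis net_le : forall X : 'rV[int]_d, 2 * sqn (real_row R X) <= 17 * d%:R ->
  `|pair_form M (real_row R X)| <= T.

(* Rounding [2 sqrt d v / |v|] to the integer grid moves it by at most [sqrt d / 2]:
   the values of the form at grid points control it up to [9/16] of its norm. *)
Lemma net_improve (K : R) : 0 <= K -> (forall v, `|pair_form M v| <= K * sqn v) ->
  forall v, `|pair_form M v| <= (T / (4 * d%:R) + 9 / 16 * K) * sqn v.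
Proof.
move=> K0 KP v; have dp : 0 < d%:R :> R by rewrite ltr0n.
have polar_le x y : `|polar M x y| <= K / 2 * (sqn x + sqn y).
  have : `|4 * polar M x y| <= K * (2 * (sqn x + sqn y)).
    rewrite -pair_form_polar -sqn_parallelogram mulrDr (le_trans (ler_normB _ _)) //.
    exact: lerD.
  by rewrite normrM (ger0_norm (_ : 0 <= 4)) //; lra.
have [v0|] := eqVneq (sqn v) 0.
  by have := KP v; rewrite v0 !mulr0.
move=> vn; have vp : 0 < sqn v by rewrite lt_neqAle eq_sym vn sqn_ge0.
pose c := Num.sqrt (4 * d%:R / sqn v).
have c2 : c ^+ 2 = 4 * d%:R / sqn v by rewrite sqr_sqrtr // divr_ge0 ?mulr_ge0 // ltW.
pose w := c *: v.
have wn : sqn w = 4 * d%:R by rewrite sqnZ c2 divfK.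
pose X : 'rV[int]_d := \row_i Num.floor (w 0 i + 2^-1).
pose r := real_row R X - w.
have rn : sqn r <= d%:R / 4.
  rewrite sqnE; have -> : d%:R / 4 = \sum_(i < d) (4^-1 : R).
    by rewrite sumr_const card_ord mulr_natl.
  apply: ler_sum => i _; rewrite !mxE.
  have /andP[h1 h2] := floor_itv (w 0 i + 2^-1).
  rewrite rmorphD /= in h2.
  rewrite mxE in h1 h2 *; nra.
have Xw : real_row R X = w + r by rewrite /r addrC subrK.
have rn0 := sqn_ge0 r.
(* The parallelogram law gives [|w + r|^2 <= 2 (4 d + d / 4) = 17 d / 2], the radius of the net. *)
have Xn : 2 * sqn (real_row R X) <= 17 * d%:R.
  have := sqn_parallelogram w r; have := sqn_ge0 (w - r); rewrite -Xw wn; lra.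
have key : `|pair_form M w| <= T + 9 / 4 * K * d%:R.
  have -> : pair_form M w = pair_form M (real_row R X) - 2 * polar M w r - pair_form M r.
    by rewrite Xw pair_formD; ring.
  have h1 := net_le Xn.
  (* Halving [w] and doubling [r] leaves the polar form unchanged and brings both squared norms to
     at most [d]. Together with the form of [r] the loss is [9/4 K d], that is [9/16 K] relative to
     [|w|^2 = 4 d]. *)
  have h2 : `|2 * polar M w r| <= 2 * K * d%:R.
    have half0 : (2^-1 : R) != 0 by [].
    rewrite normrM (ger0_norm (_ : 0 <= 2)) // -(polarZ _ _ _ half0) invrK.
    have := polar_le (2^-1 *: w) (2 *: r); rewrite (sqnZ _ w) (sqnZ _ r) wn.
    have : K * sqn r <= K * (d%:R / 4) by rewrite ler_wpM2l.
    lra.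
  have h3 := KP r.
  have h4 : K * sqn r <= K * (d%:R / 4) by rewrite ler_wpM2l.
  apply: le_trans (ler_normB _ _) _; apply: le_trans (lerD (ler_normB _ _) (lexx _)) _.
  lra.
have : pair_form M w = 4 * d%:R / sqn v * pair_form M v by rewrite pair_formZ c2.
have s0 : 0 < 4 * d%:R / sqn v by rewrite divr_gt0 // mulr_gt0.
move=> e; rewrite e normrM (gtr0_norm s0) in key.
rewrite -(ler_pM2l s0); apply: le_trans key _; rewrite le_eqVlt; apply/orP; left; apply/eqP; field.
by rewrite vn gt_eqF.
Qed.

Lemma pair_form_bounded : exists2 K, 0 <= K & forall v, `|pair_form M v| <= K * sqn v.
Proof.
exists (\sum_e `|M 0 e|); first by apply: sumr_ge0.
move=> v; rewrite mulr_suml (le_trans (ler_norm_sum _ _ _)) //; apply: ler_sum => e _.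
rewrite normrM ler_wpM2l //.
have ne : (pair_of e).2 != (pair_of e).1.
  by rewrite /pair_of; case: (enum_val e) => p /= h; rewrite -val_eqE /= gtn_eqF.
rewrite sqnE (bigD1 (pair_of e).1) //= (bigD1 (pair_of e).2) //= addrA.
set s := \sum_(i | _) _; have s0 : 0 <= s by apply: sumr_ge0 => i _; exact: sqr_ge0.
apply: (@le_trans _ _ (v 0 (pair_of e).1 ^+ 2 + v 0 (pair_of e).2 ^+ 2)); last by rewrite lerDl.
rewrite ler_norml; move: (v 0 _) (v 0 _) => x y.
have := sqr_ge0 (x + y); have := sqr_ge0 (x - y); rewrite sqrrB sqrrD => h1 h2.
by apply/andP; split; lra.
Qed.

(** The infimum of the valid constants is at most [T / (4 d)] plus 9/16 of itself by [net_improve].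
    The crude bound [pair_form_bounded] shows that some constant is valid. *)
Lemma net_bound v : `|pair_form M v| <= 4 / 7 * (T / d%:R) * sqn v.
Proof.
have dp : 0 < d%:R :> R by rewrite ltr0n.
have T0 : 0 <= T.
  apply: le_trans (net_le (_ : 2 * sqn (real_row R 0) <= _)); first exact: normr_ge0.
  rewrite sqnE big1 ?mulr0 ?mulr_ge0 // => i _; by rewrite !mxE expr0n.
pose A := [set K : R | 0 <= K /\ forall v, `|pair_form M v| <= K * sqn v]%classic.
have A0 : (A !=set0)%classic by have [K K0 KP] := pair_form_bounded; exists K.
have Alb : has_lbound A by exists 0 => K [].
have step K : A K -> A (T / (4 * d%:R) + 9 / 16 * K).
  move=> [K0 KP]; split; last exact: net_improve.
  by rewrite addr_ge0 ?divr_ge0 ?mulr_ge0 // ltW.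
have [v0|vn] := eqVneq (sqn v) 0.
  by have [K K0 /(_ v)] := pair_form_bounded; rewrite v0 !mulr0.
have vp : 0 < sqn v by rewrite lt_neqAle eq_sym vn sqn_ge0.
have infA : inf A <= 4 / 7 * (T / d%:R).
  have h : 16 / 9 * (inf A - T / (4 * d%:R)) <= inf A.
    apply: lb_le_inf => // K AK.
    have := ge_inf Alb (step K AK); lra.
  have e : T / (4 * d%:R) = (T / d%:R) / 4 by field; rewrite gt_eqF.
  rewrite e in h; lra.
rewrite -ler_pdivrMr //; apply: le_trans infA; apply: lb_le_inf => // K [_ KP].
by rewrite ler_pdivrMr.
Qed.
End Net.

Variables (L k0 : nat).
Hypothesis k0_gt0 : (0 < k0)%N.
Let s2 : R := k0%:R ^+ 2 * d%:R.
Notation Noise := {ffun 'I_D -> 'I_(2 * L).+1}.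

(** 54 rounds up [4/7 * 93], the factor of [net_bound] times the threshold of [noise_form_tail]. *)
Definition good_noise (f : Noise) : bool :=
  `[< forall v, `|pair_form (real_row R (noise_row f)) v| <= 54 * (k0%:R * d%:R) * sqn v >].

Lemma sum_pairs (F : 'I_d -> 'I_d -> R) :
  \sum_e F (pair_of e).1 (pair_of e).2 = \sum_(i < d) \sum_(j < d | (i < j)%N) F i j.
Proof.
rewrite pair_big_dep /= -(big_enum_val (fun p : pair_index => F (val p).1 (val p).2)) /=.
rewrite [RHS](@reindex_omap _ _ _ _ pair_index (fun p => val p) insub) /=; last first.
  by move=> p hp; rewrite insubT.
by apply: eq_bigl => p; rewrite (valP p) valK eqxx.
Qed.

(** Chernoff with the integral tilt [k0 * 2 X_i X_j]: the quadratic term is at most [289/4 d], so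
    the threshold 93 leaves a decay of [20 d]. This beats the [21/2 d] in the size of the net. *)
Lemma noise_form_tail (X : 'rV[int]_d) : 2 * sqn (real_row R X) <= 17 * d%:R ->
  \sum_(f : Noise | 93 * (k0%:R * d%:R ^+ 2) <
      `|pair_form (real_row R (noise_row f)) (real_row R X)|) noise_weight s2 f
    <= 2 * expR (- (20 * d%:R)).
Proof.
move=> Xn; have dp : 0 < d%:R :> R by rewrite ltr0n.
have kp : 0 < k0%:R :> R by rewrite ltr0n.
have s20 : 0 < s2 by rewrite /s2 mulr_gt0 ?exprn_gt0.
pose T : R := 93 * (k0%:R * d%:R ^+ 2).
pose k (e : 'I_D) : int := k0%:Z * (2 * X 0 (pair_of e).1 * X 0 (pair_of e).2).
pose Q (f : Noise) := pair_form (real_row R (noise_row f)) (real_row R X).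
have kQ f : \sum_e (k e)%:~R * (noise_row f 0 e)%:~R = k0%:R * Q f.
  rewrite /Q /pair_form mulr_sumr; apply: eq_bigr => e _.
  by rewrite !mxE /k !rmorphM /= -!pmulrn; ring.
have kN f : \sum_e (- k e)%:~R * (noise_row f 0 e)%:~R = - (k0%:R * Q f).
  by rewrite -kQ -sumrN; apply: eq_bigr => e _; rewrite rmorphN mulNr.
have var : \sum_e (k e)%:~R ^+ 2 / (2 * s2) - (k0%:R * T) / s2 <= - (20 * d%:R).
  pose x (i : 'I_d) : R := (X 0 i)%:~R ^+ 2.
  have x0 i : 0 <= x i by exact: sqr_ge0.
  have xs : \sum_i x i = sqn (real_row R X).
    by rewrite sqnE; apply: eq_bigr => i _; rewrite mxE.
  have e1 : \sum_e (k e)%:~R ^+ 2 / (2 * s2) =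
      2 / d%:R * \sum_(i < d) \sum_(j < d | (i < j)%N) x i * x j.
    rewrite -sum_pairs mulr_sumr; apply: eq_bigr => e _.
    rewrite /k /x /s2 !rmorphM /= -!pmulrn; field.
    by rewrite !gt_eqF.
  have e2 : 2 * (\sum_(i < d) \sum_(j < d | (i < j)%N) x i * x j) <= sqn (real_row R X) ^+ 2.
    rewrite -xs expr2 mulr_suml.
    under [leRHS]eq_bigr => i _ do rewrite mulr_sumr.
    have -> : 2 * (\sum_(i < d) \sum_(j < d | (i < j)%N) x i * x j) =
        \sum_(i < d) \sum_(j < d | (i < j)%N) x i * x j + \sum_(i < d) \sum_(j < d | (j < i)%N) x i * x j.
      rewrite mulr_natl mulr2n; congr (_ + _).
      rewrite (exchange_big_dep xpredT) //=; apply: eq_bigr => i _.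
      by apply: eq_bigr => j _; rewrite mulrC.
    rewrite -big_split /=; apply: ler_sum => i _.
    rewrite [X in X + _]big_mkcond [X in _ + X]big_mkcond -big_split /=.
    apply: ler_sum => j _; have := mulr_ge0 (x0 i) (x0 j).
    by case: ltngtP => _; rewrite ?addr0 ?add0r.
  have e3 : sqn (real_row R X) ^+ 2 <= (17 / 2 * d%:R) ^+ 2.
    rewrite lerXn2r ?nnegrE ?sqn_ge0 ?mulr_ge0 //; lra.
  have e4 : k0%:R * T / s2 = 93 * d%:R.
    by rewrite /T /s2; field; rewrite !gt_eqF.
  rewrite e1 e4; set Z := \sum_i _ in e2 *.
  have : 2 / d%:R * Z <= (17 / 2 * d%:R) ^+ 2 / d%:R.
    rewrite mulrAC ler_pM2r ?invr_gt0 //; exact: le_trans e3.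
  have -> : (17 / 2 * d%:R) ^+ 2 / d%:R = 289 / 4 * d%:R :> R by field; rewrite gt_eqF.
  move: dp; set y := d%:R; lra.
have varN : \sum_e (- k e)%:~R ^+ 2 / (2 * s2) - (k0%:R * T) / s2 <= - (20 * d%:R).
  by under eq_bigr do rewrite rmorphN sqrrN.
have c1 := le_trans (noise_chernoff L s20 k (k0%:R * T)) (_ : _ <= expR (- (20 * d%:R))).
have c2 := le_trans (noise_chernoff L s20 (fun e => - k e) (k0%:R * T)) (_ : _ <= expR (- (20 * d%:R))).
rewrite !ler_expR in c1 c2; have {c1} := c1 var; have {c2} := c2 varN.
rewrite big_mkcond [in X in _ -> X -> _]big_mkcond [in X in _ -> _ -> X]big_mkcond /= => c2 c1.
rewrite [leRHS]mulr_natl mulr2n; apply: le_trans _ (lerD c1 c2); rewrite -big_split /=.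
apply: ler_sum => f _; rewrite kQ kN -/(Q f) -/T.
have w0 : 0 <= noise_weight s2 f by exact: noise_weight_ge0.
rewrite -mulrN !ltr_pM2l //.
rewrite lter_normr; case: ltP => _; case: ltP => _ /=; rewrite ?addr0 ?add0r ?lerDl ?lexx //.
Qed.

Lemma noise_row_surj (K : nat) (X : 'rV[int]_d) : (forall i, `|X 0%R i| <= K)%N ->
  exists g : {ffun 'I_d -> 'I_(2 * K).+1}, noise_row g = X.
Proof.
move=> XK; exists [ffun i => inord (absz (X 0%R i + K%:Z)%R)].
apply/rowP => i; rewrite mxE ffunE /gval inordK; have := XK i; lia.
Qed.

(** Lattice points [X] of the ball satisfy [1 <= exp (17/2 d - |X|^2)], and the sum of
    [exp (- |X|^2)] factors over coordinates into at most [3^d <= exp (2 d)]. *)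
Lemma card_net (K : nat) :
  \sum_(g : {ffun 'I_d -> 'I_(2 * K).+1} | 2 * sqn (real_row R (noise_row g)) <= 17 * d%:R) 1
    <= expR (21 / 2 * d%:R) :> R.
Proof.
have -> : 21 / 2 * d%:R = 17 / 2 * d%:R + d%:R * 2 :> R by field.
rewrite expRD mulrC expRM_natl.
apply: (@le_trans _ _ (expR (17 / 2 * d%:R) * \prod_(i < d) gnorm K (2^-1 : R))).
  rewrite /gnorm bigA_distr_bigA /= mulr_sumr big_mkcond /=; apply: ler_sum => g _.
  case: ifP => [gs|_]; last first.
    by rewrite mulr_ge0 ?expR_ge0 // prodr_ge0 // => i _; exact: expR_ge0.
  rewrite -expR_sum -expRD -[leLHS]expR0 ler_expR.
  rewrite sqnE in gs.
  have -> : \sum_i - (gval (g i))%:~R ^+ 2 / (2 * 2^-1) =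
      - \sum_i (real_row R (noise_row g)) 0 i ^+ 2.
    by rewrite -sumrN; apply: eq_bigr => i _; rewrite !mxE mulfV // divr1.
  move: gs; set s := \sum_i _; lra.
apply: ler_wpM2l; first exact: expR_ge0.
rewrite prodr_const card_ord lerXn2r ?nnegrE ?expR_ge0 //.
  by rewrite (le_trans _ (gnorm_ge1 _ _)) // invr_gt0.
apply: le_trans (gnorm_half_le R K) _; have := expR_ge1Dx (2 : R); lra.
Qed.

Lemma good_noise_whp : \sum_(f : Noise | ~~ good_noise f) noise_weight s2 f <= 1 / 100.
Proof.
have dp : 0 < d%:R :> R by rewrite ltr0n.
have d1 : 1 <= d%:R :> R by rewrite ler1n.
have kp : 0 < k0%:R :> R by rewrite ltr0n.
have s20 : 0 < s2 by rewrite /s2 mulr_gt0 ?exprn_gt0.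
pose T : R := 93 * (k0%:R * d%:R ^+ 2).
(* Points of the ball have coordinates at most [3 d], since [17 d / 2 <= 9 d^2]. *)
pose Net := {ffun 'I_d -> 'I_(2 * (3 * d)).+1}.
pose small (X : 'rV[int]_d) := 2 * sqn (real_row R X) <= 17 * d%:R.
pose w f := noise_weight s2 (f : Noise).
have w0 f : 0 <= w f by exact: noise_weight_ge0.
have far f : ~~ good_noise f -> exists2 g : Net, small (noise_row g) &
    T < `|pair_form (real_row R (noise_row f)) (real_row R (noise_row g))|.
  move=> bad; apply: contrapT => none; move: bad; apply/negP; rewrite negbK; apply/asboolP => v.
  have h (X : 'rV[int]_d) : small X -> `|pair_form (real_row R (noise_row f)) (real_row R X)| <= T.
    move=> Xs; rewrite leNgt; apply/negP => lt; apply: none.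
    have [i|g gX] := @noise_row_surj (3 * d)%N X; last by exists g; rewrite gX.
    have t0 : 0 <= (3 * d)%N%:Z%:~R :> R by rewrite -pmulrn ler0n.
    rewrite -lez_nat abszE -(ler_int R) intr_norm -ler_sqr ?nnegrE //.
    rewrite real_normK ?num_real //.
    have : (X 0 i)%:~R ^+ 2 <= sqn (real_row R X) :> R.
      rewrite sqnE (bigD1 i) //= mxE lerDl; apply: sumr_ge0 => j _; exact: sqr_ge0.
    have -> : (3 * d)%N%:Z%:~R = 3 * d%:R :> R by rewrite -pmulrn natrM.
    move: Xs; rewrite /small; set y := sqn _; set x := _ ^+ 2; nra.
  have := net_bound h v => /le_trans; apply; apply: ler_wpM2r; first exact: sqn_ge0.
  have -> : T / d%:R = 93 * (k0%:R * d%:R) by rewrite /T; field; rewrite gt_eqF.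
  have : 0 <= k0%:R * d%:R :> R by rewrite mulr_ge0.
  lra.
have union f : (if ~~ good_noise f then w f else 0) <=
    \sum_(g : Net | small (noise_row g))
      (if T < `|pair_form (real_row R (noise_row f)) (real_row R (noise_row g))| then w f else 0).
  case: ifP => [/far[g gs gT]|_]; last by apply: sumr_ge0 => g _; case: ifP.
  by rewrite (bigD1 g) //= gT lerDl; apply: sumr_ge0 => g' _; case: ifP.
rewrite big_mkcond /=; apply: le_trans (ler_sum _ (fun f _ => union f)) _.
rewrite exchange_big /=.
apply: (@le_trans _ _ (\sum_(g : Net | small (noise_row g)) 1 * (2 * expR (- (20 * d%:R))))).
  apply: ler_sum => g gs; rewrite mul1r -big_mkcond /=; exact: noise_form_tail gs.
rewrite -mulr_suml.
apply: (@le_trans _ _ (expR (21 / 2 * d%:R) * (2 * expR (- (20 * d%:R))))).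
  by apply: ler_wpM2r (card_net _); rewrite mulr_ge0 ?expR_ge0.
rewrite mulrCA -expRD.
have : expR (21 / 2 * d%:R - 20 * d%:R) <= (expR 1 ^+ 9)^-1 :> R.
  by rewrite -expRM_natl mulr1 -expRN ler_expR; lra.
have : (expR 1 ^+ 9)^-1 <= (2 ^+ 9)^-1 :> R.
  rewrite lef_pV2 ?posrE ?exprn_gt0 ?expR_gt0 //.
  by rewrite lerXn2r ?nnegrE ?expR_ge0 //; have := expR_ge1Dx (1 : R); lra.
have -> : (2 ^+ 9)^-1 = 512^-1 :> R by rewrite -natrX.
lra.
Qed.
End PairForm.

(** * Hard instances *)

Section HiddenSpike.
Variables (R : realType) (d : nat).
Notation D := #|{: pair_index d}|.
Notation signs := {ffun 'I_d -> bool}.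

Definition sign_row (u : signs) : 'rV[R]_D :=
  \row_e (sgn R u (pair_of e).1 * sgn R u (pair_of e).2).

Lemma pair_of_lt (e : 'I_D) : ((pair_of e).1 < (pair_of e).2)%N.
Proof. exact: (valP (enum_val e)). Qed.

Lemma pair_of_inj : injective (@pair_of d).
Proof. by move=> e e' /val_inj /enum_val_inj. Qed.

(** For two distinct pairs some index lies in the first and not in the second; flipping its sign
    cancels the sum. *)
Lemma sum_sign_row (e e' : 'I_D) :
  \sum_u sign_row u 0 e * sign_row u 0 e' = (e == e')%:R * #|signs|%:R.
Proof.
have [->|ne] := eqVneq e e'.
  rewrite mul1r; under eq_bigr do rewrite !mxE mulrACA !sgn_sqr mul1r.
  by rewrite sumr_const.
rewrite mul0r.
have [k ke ke'] : exists2 k : 'I_d, (k == (pair_of e).1) (+) (k == (pair_of e).2) &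
    (k != (pair_of e').1) && (k != (pair_of e').2).
  have := pair_of_lt e; have := pair_of_lt e'.
  have : pair_of e != pair_of e' by apply: contra ne => /eqP /pair_of_inj ->.
  case: (pair_of e) (pair_of e') => [i j] [i' j'] /= pq lt' lt.
  have ij : (i == j) = false by rewrite -val_eqE /= ltn_eqF.
  have [/orP i_in|i_out] := boolP ((i == i') || (i == j')); last first.
    by exists i; rewrite ?eqxx ?ij // -negb_or.
  exists j; first by rewrite eqxx eq_sym ij.
  rewrite -negb_or; apply: contra pq => /orP j_in; rewrite xpair_eqE.
  move: i_in j_in; rewrite -!val_eqE /= => i_in j_in.
  by apply/andP; split; apply/eqP; case: i_in => /eqP; case: j_in => /eqP; lia.
rewrite (sum_flip k) big1 // => u _.
rewrite !mxE !sgn_flip; case/andP: ke' => k1 k2.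
rewrite ![_ == k]eq_sym (negbTE k1) (negbTE k2).
case: eqP ke => [_|_] /=; case: eqP => _ // _; rewrite ?mulNr ?mulrN ?mulNr; lra.
Qed.

Variable P : 'M[R]_D.
Hypothesis P_sym : P^T = P.
Hypothesis P_idem : P *m P = P.

(** The entries of a random [sign_row] are uncorrelated with variance 1, so its squared projection
    has mean [tr P]. *)
Lemma sum_sign_projection :
  \sum_u \sum_e (sign_row u *m P) 0 e ^+ 2 = #|signs|%:R * \tr P.
Proof.
have e1 u : \sum_e (sign_row u *m P) 0 e ^+ 2 =
    \sum_e \sum_k P k e * (sign_row u 0 k * sign_row u 0 e).
  have := dot_projection P_sym P_idem (sign_row u) (sign_row u).
  under eq_bigr do rewrite -expr2; move=> ->; apply: eq_bigr => e _.
  by rewrite mxE mulr_suml; apply: eq_bigr => k _; rewrite mulrAC mulrC.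
under eq_bigr do rewrite e1.
rewrite exchange_big /= /mxtrace mulr_sumr; apply: eq_bigr => e _.
rewrite exchange_big /= (bigD1 e) //= -mulr_sumr sum_sign_row eqxx mul1r mulrC.
by rewrite big1 ?addr0 // => k ke; rewrite -mulr_sumr sum_sign_row (negbTE ke) mul0r mulr0.
Qed.

Let sym_coef (x : 'rV[R]_D) (i j : 'I_d) : R :=
  \sum_e x 0 e * ((pair_of e == (i, j))%:R + (pair_of e == (j, i))%:R).

Lemma sum_sym_coef (x : 'rV[R]_D) (H : 'I_d -> 'I_d -> R) :
  \sum_i \sum_j sym_coef x i j * H i j =
  \sum_e x 0 e * (H (pair_of e).1 (pair_of e).2 + H (pair_of e).2 (pair_of e).1).
Proof.
rewrite pair_big /=; under eq_bigr do rewrite mulr_suml.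
rewrite exchange_big /=; apply: eq_bigr => e _.
under eq_bigr do rewrite -mulrA; rewrite -mulr_sumr; congr (_ * _).
under eq_bigr do rewrite mulrDl; rewrite big_split /=; congr (_ + _).
  rewrite (bigD1 (pair_of e)) //= -surjective_pairing eqxx mul1r big1 ?addr0 // => p.
  by rewrite -surjective_pairing eq_sym => /negbTE ->; rewrite mul0r.
rewrite (bigD1 ((pair_of e).2, (pair_of e).1)) //= -surjective_pairing eqxx mul1r.
rewrite big1 ?addr0 // => -[i j] /= ne; case: eqP => [h|_]; last by rewrite mul0r.
by move: ne; rewrite h eqxx.
Qed.

Lemma sym_coef_pair (x : 'rV[R]_D) e : sym_coef x (pair_of e).1 (pair_of e).2 = x 0 e.
Proof.
rewrite /sym_coef (bigD1 e) //= -surjective_pairing eqxx.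
have swap e' : (pair_of e' == ((pair_of e).2, (pair_of e).1)) = false.
  apply/eqP => h; have := pair_of_lt e'; have := pair_of_lt e; rewrite h /=; lia.
rewrite swap addr0 mulr1 big1 ?addr0 // => e' ne.
rewrite swap addr0.
by case: eqP => [/pair_of_inj h|_]; rewrite ?mulr0 //; rewrite h eqxx in ne.
Qed.

Lemma sym_coefC x i j : sym_coef x i j = sym_coef x j i.
Proof. by apply: eq_bigr => e _; rewrite addrC. Qed.

Lemma sum_exp_sign_row (x : 'rV[R]_D) : 256 * \sum_e x 0 e ^+ 2 <= 1 ->
  \sum_u expR (\sum_e x 0 e * sign_row u 0 e) <=
  #|signs|%:R * expR (32 * \sum_e x 0 e ^+ 2).
Proof.
move=> x_small.
have sq : \sum_i \sum_j sym_coef x i j ^+ 2 = 2 * \sum_e x 0 e ^+ 2.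
  under eq_bigr => i _ do under eq_bigr => j _ do rewrite expr2.
  rewrite sum_sym_coef mulr_sumr; apply: eq_bigr => e _.
  rewrite [sym_coef x _ (pair_of e).1]sym_coefC sym_coef_pair; ring.
have diag i : sym_coef x i i = 0.
  rewrite /sym_coef big1 // => e _; case: eqP => [h|_]; last by rewrite addr0 mulr0.
  by have := pair_of_lt e; rewrite h ltnn.
have := rademacher_chaos (sym_coefC x) diag.
rewrite sq mulrA -natrM mulrA -natrM => /(_ x_small).
apply: le_trans; rewrite le_eqVlt; apply/orP; left; apply/eqP.
apply: eq_bigr => u _; congr expR.
rewrite sum_sym_coef mulr_sumr; apply: eq_bigr => e _; rewrite mxE.
by rewrite [sgn R u (pair_of e).2 * _]mulrC; field.
Qed.

Definition pair_spike (a : nat) (u : signs) : 'rV[int]_D :=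
  \row_e - (a%:Z * ((-1) ^+ u (pair_of e).1 * (-1) ^+ u (pair_of e).2)).

Lemma real_pair_spike a u : real_row R (pair_spike a u) = - (a%:R : R) *: sign_row u.
Proof.
by apply/rowP => e; rewrite !mxE /sgn rmorphN !rmorphM /= !rmorphXn /= !rmorphN1 -pmulrn mulNr.
Qed.

(** The mean squared projection is [r], so by Markov all but a fraction [eps] of the sign vectors
    have at most [r / eps]. For these the chaos bound is [exp y] with [2 y <= eps]. *)
Lemma pair_spike_hidden (a r : nat) (s2 eps : R) : 0 < eps -> eps <= 1 / 4 -> \tr P = r%:R ->
  64 * (a%:R ^+ 2 / s2) ^+ 2 * r%:R <= eps ^+ 2 ->
  exists2 G : {set signs}, #|~: G|%:R <= eps * #|signs|%:R &
    forall z, z \in G -> \sum_(z' in G) expR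
      (\sum_e (real_row R (pair_spike a z) *m P) 0 e * (real_row R (pair_spike a z')) 0 e / s2)
      <= #|signs|%:R * (1 + eps).
Proof.
move=> eps0 eps1 trP r_small.
pose nrm u := \sum_e (sign_row u *m P) 0 e ^+ 2.
have nrm0 u : 0 <= nrm u by apply: sumr_ge0 => e _; exact: sqr_ge0.
have tot : \sum_u nrm u = #|signs|%:R * r%:R by rewrite sum_sign_projection trP.
exists [set u | eps * nrm u <= r%:R] => [|z].
  (* In rank 0 the Markov argument would divide by 0, but all projections vanish. *)
  case: r => [|r] in trP r_small tot *.
    rewrite mulr0 in tot.
    have z0 u : nrm u = 0.
      apply/eqP; rewrite eq_le nrm0 andbT -tot (bigD1 u) //= lerDl; exact: sumr_ge0.
    rewrite (_ : ~: _ = finset.set0) ?cards0 ?mulr_ge0 ?(ltW eps0) //.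
    by apply/setP => u; rewrite !inE z0 mulr0 lexx.
  rewrite -(ler_pM2r (_ : 0 < r.+1%:R)) ?ltr0n // -mulrA -tot mulr_sumr.
  rewrite -sum1_card natr_sum mulr_suml big_mkcond /=; apply: ler_sum => u _.
  rewrite !inE -ltNge mul1r; case: ltP => [/ltW //|_].
  by rewrite mulr_ge0 // ltW.
rewrite inE => zG; set th := a%:R ^+ 2 / s2 in r_small.
have -> : \sum_(z' in [set u | eps * nrm u <= r%:R]) expR (\sum_e
      (real_row R (pair_spike a z) *m P) 0 e * real_row R (pair_spike a z') 0 e / s2) =
    \sum_(z' in [set u | eps * nrm u <= r%:R])
      expR (\sum_e (th *: (sign_row z *m P)) 0 e * sign_row z' 0 e).
  apply: eq_bigr => z' _; congr expR; apply: eq_bigr => e _.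
  rewrite !real_pair_spike -scalemxAl [in LHS]mxE [X in _ * X / _]mxE [in RHS]mxE /th; ring.
apply: (@le_trans _ _ (\sum_z' expR (\sum_e (th *: (sign_row z *m P)) 0 e * sign_row z' 0 e))).
  rewrite big_mkcond /=; apply: ler_sum => u _; case: ifP => // _; exact: expR_ge0.
have sq : \sum_e (th *: (sign_row z *m P)) 0 e ^+ 2 = th ^+ 2 * nrm z.
  by rewrite mulr_sumr; apply: eq_bigr => e _; rewrite mxE exprMn.
have small : 64 * (th ^+ 2 * nrm z) <= eps.
  rewrite -(ler_pM2l eps0) -expr2; apply: le_trans r_small.
  have : th ^+ 2 * (eps * nrm z) <= th ^+ 2 * r%:R by rewrite ler_wpM2l ?sqr_ge0.
  lra.
have q0 : 0 <= th ^+ 2 * nrm z by rewrite mulr_ge0 ?sqr_ge0.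
have h256 : 256 * \sum_e (th *: (sign_row z *m P)) 0 e ^+ 2 <= 1 by rewrite sq; lra.
apply: le_trans (sum_exp_sign_row h256) _; rewrite sq ler_wpM2l //.
set y := 32 * _; have y0 : 0 <= y by rewrite mulr_ge0.
have y1 : 2 * y <= eps by rewrite /y; lra.
have := expR_ge1Dx (- y); rewrite expRN -[leRHS]mul1r ler_pdivlMr ?expR_gt0 //.
have := expR_gt0 y; nra.
Qed.

End HiddenSpike.

(* The box of increments has side [B], the noise has variance [B ^ 4 * d] and is
   truncated at [B ^ 3 * d], there are [B ^ 10] increments, and vectors are reduced
   modulo [B ^ 12]; any sufficiently separated powers of [B] would do. [K] and
   [eps] are variables because conversion unfolds large numerals. *)
Section Calibration.
Variables (R : realType) (D d B C a W S : nat) (K eps : R).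
Hypothesis KE : K = 24 * 1000.
Hypothesis epsE : eps = 1 / 1000.
Let b : R := B%:R.
Hypothesis d_gt0 : (0 < d)%N.
Hypothesis D_le : (D <= d * d)%N.
Hypothesis C_gt0 : (0 < C)%N.
Hypothesis a_gt0 : (0 < a)%N.
Hypothesis a_le : (a <= C * B ^ 2)%N.
Let K0 : 0 <= K. Proof. by rewrite KE; lra. Qed.
Hypothesis B_big : K * (C%:R * d%:R ^+ 6) <= b.
Hypothesis S_gt0 : (0 < S)%N.

Let x : R := C%:R * d%:R ^+ 6.

Let c1 : 1 <= C%:R :> R. Proof. by rewrite ler1n. Qed.
Let d1 : 1 <= d%:R :> R. Proof. by rewrite ler1n. Qed.
Let x1 : 1 <= x.
Proof. by rewrite /x mulr_ege1 // exprn_ege1. Qed.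
Let b_big : K <= b.
Proof. by apply: le_trans B_big; exact: (ler_peMr K0 x1). Qed.
Let b1 : 1 <= b. Proof. by apply: le_trans b_big; rewrite KE; lra. Qed.
Let b0 : 0 < b. Proof. exact: lt_le_trans b1. Qed.
Let bX k : 0 < b ^+ k. Proof. exact: exprn_gt0. Qed.

(** The arithmetic behind the calibration: one extra factor [B] pays for a constant up to [K] times
    a polynomial up to [C d^6]. *)
Let absorb k (y : R) j : k <= K -> 0 <= y <= x -> k * y * b ^+ j <= b ^+ j.+1.
Proof.
move=> k1 /andP[y0 yx]; rewrite exprS ler_wpM2r ?(ltW (bX _)) //.
apply: le_trans B_big; apply: (@le_trans _ _ (K * y)); first exact: ler_wpM2r.
exact: (ler_wpM2l K0).
Qed.

Let mono i j : (i <= j)%N -> b ^+ i <= b ^+ j.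
Proof. exact: ler_weXn2l. Qed.

Let d_pow i : (i <= 6)%N -> 0 <= (d%:R : R) ^+ i <= x.
Proof.
move=> i6; rewrite exprn_ge0 //= /x.
apply: (@le_trans _ _ (d%:R ^+ 6)); first exact: ler_weXn2l.
by rewrite ler_peMl // exprn_ge0.
Qed.

Let Dc_pow i : (i <= 3)%N -> 0 <= (C%:R * D%:R ^+ i : R) <= x.
Proof.
move=> i3; rewrite mulr_ge0 ?exprn_ge0 //= /x ler_wpM2l //.
apply: (@le_trans _ _ ((d%:R ^+ 2) ^+ i)).
  by rewrite lerXn2r ?nnegrE ?exprn_ge0 // expr2 -natrM ler_nat.
by rewrite -exprM ler_weXn2l //; case: i i3 => [|[|[|[|]]]].
Qed.

Let aB_le : (a + B)%:R <= 2 * (C%:R * b ^+ 2) :> R.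
Proof.
rewrite natrD; have h1 : a%:R <= C%:R * b ^+ 2 :> R by rewrite -natrX -natrM ler_nat.
suff : b <= C%:R * b ^+ 2 by rewrite -/b; lra.
apply: (@le_trans _ _ (b ^+ 2)); first by rewrite -{1}[b]expr1; exact: mono.
by rewrite ler_peMl // ltW.
Qed.

Let a_le' : a%:R <= C%:R * b ^+ 2 :> R.
Proof. by rewrite -natrX -natrM ler_nat. Qed.

Lemma calibrated_L_big : (2 * (D * (a + B)) <= B ^ 3 * d)%N.
Proof.
rewrite -(ler_nat R) [leRHS]natrM natrX !natrM -/b.
apply: (@le_trans _ _ (4 * (C%:R * D%:R ^+ 1) * b ^+ 2)).
  have := ler_wpM2l (ler0n R D) aB_le; rewrite expr1; lra.
apply: (@le_trans _ _ (b ^+ 3)); first by apply: absorb; [rewrite ?KE; lra|exact: Dc_pow].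
by rewrite ler_peMr // ltW.
Qed.

(** This condition dictates [K]: the 6 from the left side, the 4 from [eps / 4] and the 1000 from
    [eps] multiply to [24 * 1000]. *)
Lemma calibrated_s2_big :
  (3 * (D * D * D) * (a + B) * B)%:R <= eps / 4 * ((B ^ 2)%:R ^+ 2 * d%:R) :> R.
Proof.
rewrite natrX -/b.
have -> : (3 * (D * D * D) * (a + B) * B)%:R = 3 * (D%:R ^+ 3 * b * (a + B)%:R).
  by rewrite !natrM -/b; ring.
have h : 24 * 1000 * (C%:R * D%:R ^+ 3) * b ^+ 3 <= b ^+ 4 by apply: absorb; [rewrite ?KE; lra|exact: Dc_pow].
apply: (@le_trans _ _ (6 * (C%:R * D%:R ^+ 3) * b ^+ 3)).
  have D30 : 0 <= D%:R ^+ 3 * b :> R by rewrite mulr_ge0 ?exprn_ge0 // ltW.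
  have := ler_wpM2l D30 aB_le; lra.
have : b ^+ 4 <= (b ^+ 2) ^+ 2 * d%:R by rewrite -exprM ler_peMr // ltW.
rewrite epsE; lra.
Qed.

Lemma calibrated_tail :
  D%:R * ((2 * (B ^ 3 * d)).+1%:R *
    expR (- ((B ^ 3 * d)%:R ^+ 2) / (8 * ((B ^ 2)%:R ^+ 2 * d%:R)))) <= eps :> R.
Proof.
have e1 : (B ^ 3 * d)%:R = b ^+ 3 * d%:R by rewrite natrM natrX.
have e2 : (2 * (B ^ 3 * d)).+1%:R = 2 * (b ^+ 3 * d%:R) + 1 by rewrite -addn1 natrD natrM e1.
rewrite e2 e1 natrX -/b.
have dn : d%:R != 0 :> R by rewrite gt_eqF // (lt_le_trans _ d1).
have bn : b != 0 by rewrite gt_eqF.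
have -> : - (b ^+ 3 * d%:R) ^+ 2 / (8 * ((b ^+ 2) ^+ 2 * d%:R)) = - (b ^+ 2 * d%:R / 8).
  by field; rewrite dn bn.
rewrite expRN mulrA ler_pdivrMr ?expR_gt0 //.
(* A polynomial lower bound for the exponential is enough: [1 + y <= expR y] raised to the fourth
   power gives [b^8], against a prefactor of at most [b^4]. *)
have e3 : (b ^+ 2 / 32) ^+ 4 <= expR (b ^+ 2 * d%:R / 8).
  apply: (@le_trans _ _ (expR (b ^+ 2 / 32) ^+ 4)).
    rewrite lerXn2r ?nnegrE ?expR_ge0 ?divr_ge0 ?exprn_ge0 ?(ltW b0) //.
    by have := expR_ge1Dx (b ^+ 2 / 32); lra.
  rewrite -expRM_natl ler_expR.
  have : b ^+ 2 <= b ^+ 2 * d%:R by rewrite ler_peMr // ltW.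
  lra.
have eps0 : 0 <= eps by rewrite epsE; lra.
apply: (@le_trans _ _ (eps * (b ^+ 2 / 32) ^+ 4)); last exact: ler_wpM2l eps0 _ _ e3.
apply: (@le_trans _ _ (b ^+ 4)).
  have h1 : 3 * (d%:R ^+ 3) * b ^+ 3 <= b ^+ 4 by apply: absorb; [rewrite ?KE; lra|exact: d_pow].
  apply: le_trans h1.
  have dd : D%:R <= d%:R ^+ 2 :> R by rewrite expr2 -natrM ler_nat.
  have bd : 1 <= b ^+ 3 * d%:R by rewrite mulr_ege1 // exprn_ege1.
  apply: (@le_trans _ _ (d%:R ^+ 2 * (3 * (b ^+ 3 * d%:R)))); last by rewrite le_eqVlt; apply/orP; left; apply/eqP; ring.
  by apply: ler_pM => //; [rewrite addr_ge0 ?mulr_ge0 // ?exprn_ge0 // ltW|lra].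
have -> : eps * (b ^+ 2 / 32) ^+ 4 = b ^+ 4 * (eps * b * (b / 32 ^+ 2) * (b / 32) ^+ 2) by field.
have eb : 1 <= eps * b.
  have := ler_wpM2l eps0 b_big; rewrite epsE KE; lra.
have b32 : 1 <= b / 32 by move: b_big; rewrite KE; lra.
have b1024 : 1 <= b / 32 ^+ 2 by move: b_big; rewrite KE; lra.
by rewrite ler_peMr ?(ltW (bX _)) // mulr_ege1 ?exprn_ege1 // mulr_ege1.
Qed.

Lemma calibrated_no_overflow : (2 * (B ^ 3 * d + a + B ^ 10 * B) < B ^ 12)%N.
Proof.
rewrite -expnSr -(ltr_nat R) natrX natrM !natrD natrM !natrX -/b.
have h1 : 1 * d%:R ^+ 1 * b ^+ 3 <= b ^+ 4 by apply: absorb; [rewrite ?KE; lra|exact: d_pow].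
have h2 : 1 * (C%:R * D%:R ^+ 0) * b ^+ 2 <= b ^+ 3 by apply: absorb; [rewrite ?KE; lra|exact: Dc_pow].
have h3 : b ^+ 4 <= b ^+ 11 by exact: mono.
have h4 : b ^+ 3 <= b ^+ 11 by exact: mono.
have h5 : K * b ^+ 11 <= b ^+ 12 by rewrite [leRHS]exprS ler_wpM2r // ltW.
rewrite KE in h5; have := bX 11; rewrite expr0 expr1 in h1 h2; move: a_le'; lra.
Qed.

Lemma calibrated_length (k : nat) : (k <= B ^ 13)%N -> (B ^ 14 <= W)%N ->
  (k + B ^ 10 * (D * (2 * B)) + D * (2 * B ^ 12) <= W)%N.
Proof.
move=> kB; apply: leq_trans; rewrite -(ler_nat R) !natrD natrX.
have -> : (B ^ 10 * (D * (2 * B)))%:R = 2 * (D%:R * b ^+ 11) :> R.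
  by rewrite natrM natrX !natrM -/b; ring.
have -> : (D * (2 * B ^ 12))%:R = 2 * (D%:R * b ^+ 12) :> R.
  by rewrite natrM natrM natrX -/b; ring.
rewrite -/b.
have h0 : k%:R <= b ^+ 13 by rewrite -natrX ler_nat.
have DC : D%:R <= C%:R * D%:R ^+ 1 :> R by rewrite expr1 -[leLHS]mul1r ler_wpM2r.
have h1 : 24 * 1000 * (C%:R * D%:R ^+ 1) * b ^+ 11 <= b ^+ 12 by apply: absorb; [rewrite ?KE; lra|exact: Dc_pow].
have h2 : 24 * 1000 * (C%:R * D%:R ^+ 1) * b ^+ 12 <= b ^+ 13 by apply: absorb; [rewrite ?KE; lra|exact: Dc_pow].
have h3 : b ^+ 12 <= b ^+ 13 by exact: mono.
have h5 : K * b ^+ 13 <= b ^+ 14 by rewrite [leRHS]exprS ler_wpM2r // ltW.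
have h6 : D%:R * b ^+ 11 <= C%:R * D%:R ^+ 1 * b ^+ 11 by rewrite ler_wpM2r // ltW.
have h7 : D%:R * b ^+ 12 <= C%:R * D%:R ^+ 1 * b ^+ 12 by rewrite ler_wpM2r // ltW.
rewrite KE in h5; have := bX 13; lra.
Qed.

Lemma calibrated_t_small : 3 * (D * D * D * a)%:R * (b ^+ 4)^-1 <= 1 / 100.
Proof.
have D3 : (D * D * D * a)%:R = D%:R ^+ 3 * a%:R :> R by rewrite !natrM; ring.
rewrite D3 ler_pdivrMr //.
have h : 24 * 1000 * (C%:R * D%:R ^+ 3) * b ^+ 2 <= b ^+ 3 by apply: absorb; [rewrite ?KE; lra|exact: Dc_pow].
have h3 : b ^+ 3 <= b ^+ 4 by exact: mono.
have D30 : 0 <= D%:R ^+ 3 :> R by rewrite exprn_ge0.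
have := ler_wpM2l D30 a_le'; have := bX 4; lra.
Qed.

Lemma calibrated_N_big :
  D%:R * ln (B ^ 12)%:R <= 20^-1 * ((B ^ 10)%:R * ((b ^+ 4)^-1 ^+ 2 / 32)).
Proof.
have -> : (B ^ 10)%:R * ((b ^+ 4)^-1 ^+ 2 / 32) = b ^+ 2 / 32.
  by rewrite natrX -/b; field; rewrite gt_eqF.
rewrite natrX lnXn // -[_ *+ 12]mulr_natl.
have lnb : ln b <= b.
  rewrite -[leRHS]expRK ler_ln ?posrE ?expR_gt0 //; have := expR_ge1Dx b; lra.
have h : 24 * 1000 * (C%:R * D%:R ^+ 1) * b ^+ 1 <= b ^+ 2 by apply: absorb; [rewrite ?KE; lra|exact: Dc_pow].
have DC : D%:R <= C%:R * D%:R ^+ 1 :> R by rewrite expr1 -[leLHS]mul1r ler_wpM2r.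
have h1 : D%:R * b <= C%:R * D%:R ^+ 1 * b by rewrite ler_wpM2r // ltW.
have h2 : D%:R * ln b <= D%:R * b by rewrite ler_wpM2l.
have := bX 2; rewrite -/b; rewrite [b ^+ 1]expr1 in h; lra.
Qed.

(** [40 <= 2^6] and [S >= 1] bound the constant and [2^S] by [7 S] in logarithms, while [9 <= B]
    lets [3^r] consume at most half of [r ln B]. *)
Lemma rank_le (r : nat) : (B ^ r <= 40 * 2 ^ S * 3 ^ r)%N -> r%:R * ln b <= 14 * S%:R.
Proof.
move=> h; have {}h : b ^+ r <= 40 * 2 ^+ S * 3 ^+ r.
  by rewrite -!natrX -!natrM ler_nat.
have S1 : 1 <= S%:R :> R by rewrite ler1n.
have ln2 : ln 2 <= 1 :> R.
  by rewrite -[leRHS]expRK ler_ln ?posrE ?expR_gt0 //; have := expR_ge1Dx (1 : R); lra.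
have ln3 : 2 * ln 3 <= ln b.
  rewrite mulr_natl -lnXn // ler_ln ?posrE ?exprn_gt0 //.
  by apply: le_trans b_big; rewrite KE expr2; lra.
have h64 : 40 <= 2 ^+ 6 :> R by rewrite !exprS expr0; lra.
have p2 : 0 < 2 ^+ S :> R by rewrite exprn_gt0.
have p3 : 0 < 3 ^+ r :> R by rewrite exprn_gt0.
have p6 : 0 < 2 ^+ 6 :> R by rewrite exprn_gt0.
have : ln (b ^+ r) <= ln (2 ^+ 6 * 2 ^+ S * 3 ^+ r).
  rewrite ler_ln ?posrE ?mulr_gt0 //; apply: le_trans h _.
  by rewrite (ler_wpM2r (ltW p3)) // (ler_wpM2r (ltW p2)).
rewrite lnM ?posrE ?mulr_gt0 // lnM ?posrE // !lnXn //.
rewrite -[ln b *+ r]mulr_natl -[ln 2 *+ 6]mulr_natl -[ln 2 *+ S]mulr_natl -[ln 3 *+ r]mulr_natl.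
have : r%:R * (2 * ln 3) <= r%:R * ln b by rewrite ler_wpM2l.
have : S%:R * ln 2 <= S%:R * 1 :> R by rewrite ler_wpM2l.
lra.
Qed.

Variables (F : finType) (spike : F -> 'rV[int]_D).
Hypothesis F_gt0 : (0 < #|F|)%N.
Hypothesis spike_le : forall z e, (`|spike z 0%R e| <= a)%N.
Variables (I : finType) (O : Type) (correct : (I -> int) -> O -> Prop).
Variables (pos : 'I_D -> seq I) (base : unit_stream I).
Hypothesis W_big : (B ^ 14 <= W)%N.
Hypothesis base_size : (size base <= B ^ 13)%N.
Hypothesis pos_size : forall e, (size (pos e) <= 2)%N.
Let s2 : R := (B ^ 2)%:R ^+ 2 * d%:R.
Hypothesis spike_hidden : forall (r : nat) (P : 'M[R]_D),
  r%:R * ln b <= 14 * S%:R -> P^T = P -> P *m P = P -> \tr P = r%:R ->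
  exists2 G : {set F}, #|~: G|%:R <= eps * #|F|%:R &
    forall z, z \in G -> \sum_(z' in G) expR
      (\sum_e (real_row R (spike z) *m P) 0 e * (real_row R (spike z')) 0 e / s2)
      <= #|F|%:R * (1 + eps).
Variables (test : O -> bool) (good : {ffun 'I_D -> 'I_(2 * (B ^ 3 * d)).+1} -> bool).
Hypothesis good_whp : \sum_(f | ~~ good f) noise_weight s2 f <= 1 / 100.
Hypothesis test_null : forall f o, good f ->
  correct (final_frequency pos base (noise_row f)) o -> test o.
Hypothesis test_spiked : forall f z o, good f ->
  correct (final_frequency pos base (noise_row f + spike z)) o -> ~~ test o.

Lemma calibrated_lower_bound : ~ turnstile_solvable R correct W S.
Proof.
have B0 : (0 < B)%N by rewrite -(ltr_nat R).
have s20 : 0 < s2 by rewrite /s2 mulr_gt0 ?exprn_gt0 // ltr0n // expn_gt0 B0.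
have over := calibrated_no_overflow.
have m1 : (1 < B ^ 12)%N.
  rewrite -(ltr_nat R) natrX -/b; apply: (@lt_le_trans _ _ (b ^+ 1)); last exact: mono.
  by rewrite expr1; apply: lt_le_trans b_big; rewrite KE; lra.
have L4 : (4 * (B ^ 3 * d) < B ^ 12)%N.
  rewrite -(ltr_nat R) natrX natrM [(B ^ 3 * d)%:R]natrM natrX -/b.
  have h1 : 1 * d%:R ^+ 1 * b ^+ 3 <= b ^+ 4 by apply: absorb; [rewrite KE; lra|exact: d_pow].
  have h3 : b ^+ 4 <= b ^+ 11 by exact: mono.
  have h5 : K * b ^+ 11 <= b ^+ 12 by rewrite [leRHS]exprS ler_wpM2r // ltW.
  rewrite KE in h5; have := bX 11; rewrite expr1 in h1; lra.
have t0 : 0 < (b ^+ 4)^-1 by rewrite invr_gt0.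
have eps_itv : 0 <= eps <= 1 / 1000 by rewrite epsE lexx andbT; lra.
have N0 : (0 < B ^ 10)%N by rewrite expn_gt0 B0.
exact: (@streaming_lower_bound R D B (B ^ 3 * d) (B ^ 12) s2 s20 m1 L4 F spike a F_gt0 spike_le
  a_gt0 I O correct W S (B ^ 10) pos base (b ^+ 4)^-1 eps t0 eps_itv
  (fun r P h => spike_hidden (rank_le h)) calibrated_L_big
  calibrated_s2_big calibrated_tail B0 N0 over pos_size (calibrated_length base_size W_big)
  calibrated_t_small calibrated_N_big test good good_whp test_null test_spiked).
Qed.
End Calibration.

(** * The matrix produced by a stream, and the two families of instances *)

Section FinalMatrix.
Variables (R : realType) (n D : nat).
Local Notation I := ('I_n * 'I_n)%type.
Variables (pos : 'I_D -> seq I) (base : unit_stream I).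

Lemma sum_final_frequency (M : 'rV[int]_D) (h : I -> R) :
  \sum_p (final_frequency pos base M p)%:~R * h p =
  \sum_(u <- base) (-1) ^+ u.2 * h u.1 + \sum_e (M 0 e)%:~R * \sum_(p <- pos e) h p.
Proof.
have count_sum (s : seq I) : \sum_p (count_mem p s)%:R * h p = \sum_(p <- s) h p.
  elim: s => [|q s IH]; first by rewrite big_nil big1 // => p _; rewrite mul0r.
  rewrite big_cons -IH.
  under eq_bigr do rewrite /= natrD mulrDl.
  rewrite big_split /= (bigD1 q) //= eqxx mul1r big1 ?addr0 // => p /negbTE.
  by rewrite eq_sym => ->; rewrite mul0r.
have freq_sum : \sum_p (frequency base p)%:~R * h p = \sum_(u <- base) (-1) ^+ u.2 * h u.1.
  rewrite /frequency; elim: base => [|u s IH].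
    by rewrite big_nil big1 // => p _; rewrite big_nil mul0r.
  rewrite big_cons -IH.
  have E p : (\sum_(v <- u :: s | v.1 == p) (-1) ^+ v.2 : int)%:~R * h p =
      (u.1 == p)%:R * ((-1) ^+ u.2 * h u.1) + (\sum_(v <- s | v.1 == p) (-1) ^+ v.2 : int)%:~R * h p.
    rewrite big_cons; case: eqP => [->|_]; last by rewrite mul0r add0r.
    by rewrite rmorphD /= mulrDl mul1r rmorphXn /= rmorphN1.
  under eq_bigr do rewrite E.
  rewrite big_split /= (bigD1 u.1) //= eqxx mul1r big1 ?addr0 // => p /negbTE.
  by rewrite eq_sym => ->; rewrite mul0r.
rewrite -freq_sum.
under eq_bigr do rewrite /final_frequency rmorphD /= mulrDl.
rewrite big_split /=; congr (_ + _).
under eq_bigr do rewrite rmorph_sum /= mulr_suml.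
rewrite exchange_big /=; apply: eq_bigr => e _; rewrite -count_sum mulr_sumr.
by apply: eq_bigr => p _; rewrite rmorphM /= -pmulrn mulrA.
Qed.

Lemma quad_final_frequency (M : 'rV[int]_D) (x : 'rV[R]_n) :
  quad (matrix_of R (final_frequency pos base M)) x =
  \sum_(u <- base) (-1) ^+ u.2 * (x 0 u.1.1 * x 0 u.1.2) +
  \sum_e (M 0 e)%:~R * \sum_(p <- pos e) x 0 p.1 * x 0 p.2.
Proof.
rewrite -(sum_final_frequency M (fun p => x 0 p.1 * x 0 p.2)) /quad mxE.
under eq_bigr do rewrite mxE mulr_suml.
rewrite exchange_big pair_big /=; apply: eq_bigr => -[i j] _.
by rewrite !mxE /= mulrCA mulrA.
Qed.

Lemma trace_final_frequency (M : 'rV[int]_D) :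
  \tr (matrix_of R (final_frequency pos base M)) =
  \sum_(u <- base) (-1) ^+ u.2 * (u.1.1 == u.1.2)%:R +
  \sum_e (M 0 e)%:~R * \sum_(p <- pos e) (p.1 == p.2)%:R.
Proof.
rewrite -(sum_final_frequency M (fun p => (p.1 == p.2)%:R)) /mxtrace.
under eq_bigr do rewrite mxE.
rewrite -(pair_big xpredT xpredT (fun i j => (final_frequency pos base M (i, j))%:~R * (i == j)%:R)) /=.
apply: eq_bigr => i _; rewrite (bigD1 i) //= eqxx mulr1 big1 ?addr0 // => j ji.
by rewrite eq_sym (negbTE ji) mulr0.
Qed.

Lemma final_frequency_sym (M : 'rV[int]_D) :
  (forall e i j, count_mem (i, j) (pos e) = count_mem (j, i) (pos e)) ->
  (forall u, u \in base -> u.1.1 = u.1.2) ->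
  (matrix_of R (final_frequency pos base M))^T = matrix_of R (final_frequency pos base M).
Proof.
move=> pos_sym base_diag; apply/matrixP => i j; rewrite !mxE; congr (_%:~R).
rewrite /final_frequency; congr (_ + _); last by apply: eq_bigr => e _; rewrite pos_sym.
rewrite /frequency big_seq_cond [RHS]big_seq_cond; apply: eq_bigl => -[[k l] s].
case: (boolP (_ \in _)) => //= /base_diag /= ->.
by rewrite !xpair_eqE andbC.
Qed.
End FinalMatrix.

Lemma sqr_sum_pairs (R : realType) (d : nat) (v : 'I_d -> R) :
  (\sum_i v i) ^+ 2 = \sum_i v i ^+ 2 + \sum_e 2 * v (pair_of e).1 * v (pair_of e).2.
Proof.
have -> : \sum_e 2 * v (@pair_of d e).1 * v (pair_of e).2 =
    \sum_e 2 * (v (pair_of e).1 * v (pair_of e).2).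
  by apply: eq_bigr => e _; rewrite mulrA.
rewrite -mulr_sumr (sum_pairs (fun i j => v i * v j)) mulr_natl mulr2n.
rewrite [X in _ = _ + (X + _)](exchange_big_dep xpredT) //=.
rewrite -!big_split /= expr2 mulr_suml; apply: eq_bigr => i _.
rewrite mulr_sumr [X in _ = _ + (X + _)]big_mkcond [X in _ = _ + (_ + X)]big_mkcond /=.
rewrite -big_split /= (bigD1 i) //= [X in _ = _ + X](bigD1 i) //= ltnn addr0 add0r expr2.
congr (_ + _); apply: eq_bigr => j ji.
have : (i : nat) != j by rewrite eq_sym.
by case: ltngtP; rewrite ?addr0 ?add0r // mulrC.
Qed.

Section PairInstance.
Variables (R : realType) (n d B C a W S : nat) (K eps eps1 e : R).
Variables (O : Type) (correct : ('I_n * 'I_n -> int) -> O -> Prop).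
Hypothesis KE : K = 24 * 1000.
Hypothesis epsE : eps = 1 / 1000.
Hypothesis dn : (d <= n)%N.
Hypothesis d_gt0 : (0 < d)%N.
Hypothesis C_gt0 : (0 < C)%N.
Hypothesis a_gt0 : (0 < a)%N.
Hypothesis a_le : (a <= C * B ^ 2)%N.
Hypothesis B_big : K * (C%:R * d%:R ^+ 6) <= B%:R.
Hypothesis S_gt0 : (0 < S)%N.
Hypothesis W_big : (B ^ 14 <= W)%N.
Hypothesis sep : separates correct eps1 e d.
Hypothesis gap :
  (2 * (54 * (B ^ 2 * d)%:R) + a%:R) * (1 + e) < (1 - eps1) * a%:R * d%:R.
Hypothesis S_small : forall r : nat, r%:R * ln (B%:R : R) <= 14 * S%:R ->
  64 * (a%:R ^+ 2 / ((B ^ 2)%:R ^+ 2 * d%:R)) ^+ 2 * r%:R <= eps ^+ 2.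

Notation D := #|{: pair_index d}|.
Let w : 'I_d -> 'I_n := widen_ord dn.
Let q := (54 * (B ^ 2 * d))%N.
Let pos (k : 'I_D) : seq ('I_n * 'I_n) :=
  [:: (w (pair_of k).1, w (pair_of k).2); (w (pair_of k).2, w (pair_of k).1)].
(** Shifts the leading [d] x [d] block by [q] times the identity; [q] bounds the form of good noise,
    so the shifted noise is positive semidefinite. *)
Let base : unit_stream ('I_n * 'I_n) :=
  flatten [seq nseq q ((w i, w i), false) | i <- enum 'I_d].

Let big_base (h : 'I_n * 'I_n -> R) :
  \sum_(u <- base) (-1) ^+ u.2 * h u.1 = q%:R * \sum_i h (w i, w i).
Proof.
rewrite /base big_flatten /= big_map big_enum /= mulr_sumr; apply: eq_bigr => i _.
by rewrite big_nseq iter_addr_0 /= mul1r mulr_natl.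
Qed.

Let restrict (x : 'rV[R]_n) : 'rV[R]_d := \row_i x 0 (w i).

Let sqn_restrict (x : 'rV[R]_n) : sqn (restrict x) <= sqn x.
Proof.
rewrite !sqnE.
rewrite [leRHS](bigID (fun i : 'I_n => (i < d)%N)) /=.
rewrite -[leLHS]addr0 lerD //; last by apply: sumr_ge0 => i _; exact: sqr_ge0.
rewrite (big_ord_narrow dn); apply: ler_sum => i _; by rewrite mxE.
Qed.

Let mat (M : 'rV[int]_D) : 'M[R]_n := matrix_of R (final_frequency pos base M).

Let quad_mat (M : 'rV[int]_D) x :
  quad (mat M) x = q%:R * sqn (restrict x) + pair_form (real_row R M) (restrict x).
Proof.
rewrite /mat quad_final_frequency (big_base (fun p => x 0 p.1 * x 0 p.2)) /=; congr (_ + _).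
  by rewrite sqnE; congr (_ * _); apply: eq_bigr => i _; rewrite mxE expr2.
apply: eq_bigr => k _; rewrite !mxE big_cons big_seq1 /=; ring.
Qed.

Let trace_mat M : \tr (mat M) = q%:R * d%:R.
Proof.
rewrite /mat trace_final_frequency (big_base (fun p => (p.1 == p.2)%:R)) /=.
under eq_bigr do rewrite eqxx.
rewrite sumr_const card_ord big1 ?addr0 // => k _.
have ne : (pair_of k).1 != (pair_of k).2 by rewrite -val_eqE /= ltn_eqF // pair_of_lt.
have wne : (w (pair_of k).1 == w (pair_of k).2) = false.
  by rewrite -val_eqE /= val_eqE (negbTE ne).
by rewrite big_cons big_seq1 /= [w (pair_of k).2 == _]eq_sym wne addr0 mulr0.
Qed.

Let mat_sym M : (mat M)^T = mat M.
Proof.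
apply: final_frequency_sym => [k i j|u].
  by rewrite /= !xpair_eqE !addn0 addnC; congr (_ + _)%N; rewrite andbC.
by move=> /flatten_mapP[i _ /nseqP[-> _]].
Qed.

(** Shifted good noise lies between 0 and [2 q]. The spike has no diagonal, so completing it to
    [a u u^T] adds [a] times the identity of the block to the bounded part. *)
Let kappa : R := 2 * q%:R + a%:R.

Let null_mat (f : {ffun 'I_D -> 'I_(2 * (B ^ 3 * d)).+1}) :
  good_noise R (B ^ 2) f -> bounded_form (mat (noise_row f)) kappa d.
Proof.
move=> /asboolP gf; split; first exact: mat_sym.
  move=> x; have := gf (restrict x); rewrite quad_mat.
  have -> : 54 * ((B ^ 2)%:R * d%:R) = q%:R :> R by rewrite /q !natrM.
  have a0 : 0 <= a%:R * sqn x by rewrite mulr_ge0 ?sqn_ge0.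
  have := ler_wpM2l (ler0n R q) (sqn_restrict x).
  rewrite ler_norml /kappa => h /andP[h1 h2]; apply/andP; split; lra.
by rewrite trace_mat /kappa ler_wpM2r //; have := ler0n R a; have := ler0n R q; lra.
Qed.

Let direction (z : {ffun 'I_d -> bool}) : 'rV[R]_n :=
  \row_i (if insub (i : nat) is Some j then sgn R z j else 0).

Let directionE z i : direction z 0 (w i) = sgn R z i.
Proof. by rewrite mxE /= valK. Qed.

Let sum_direction z (h : 'I_n -> R -> R) : (forall i, h i 0 = 0) ->
  \sum_i h i (direction z 0 i) = \sum_i h (w i) (sgn R z i).
Proof.
move=> h0; rewrite (bigID (fun i : 'I_n => (i < d)%N)) /= [X in _ + X]big1 => [|i di].
  rewrite addr0 (big_ord_narrow dn); apply: eq_bigr => i _; by rewrite directionE.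
by rewrite mxE insubF ?h0 //; apply: negbTE.
Qed.

Let spiked_mat (f : {ffun 'I_D -> 'I_(2 * (B ^ 3 * d)).+1}) z :
  good_noise R (B ^ 2) f ->
  exists (E : 'M[R]_n) (u : 'rV[R]_n), [/\ bounded_form E kappa d, sqn u = d%:R &
    mat (noise_row f + pair_spike a z) = E - a%:R *: (u^T *m u)].
Proof.
move=> /asboolP gf; pose u := direction z.
have un : sqn u = d%:R.
  rewrite sqnE (sum_direction z (h := fun _ y => y ^+ 2)) ?expr0n //.
  under eq_bigr do rewrite expr2 sgn_sqr.
  by rewrite sumr_const card_ord.
exists (mat (noise_row f + pair_spike a z) + a%:R *: (u^T *m u)), u; split => //; last by rewrite addrK.
split; first by rewrite linearD /= mat_sym linearZ /= trmx_mul trmxK.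
  move=> x; have := gf (restrict x).
  have -> : 54 * ((B ^ 2)%:R * d%:R) = q%:R :> R by rewrite /q !natrM.
  have -> : quad (mat (noise_row f + pair_spike a z) + a%:R *: (u^T *m u)) x =
      (q%:R + a%:R) * sqn (restrict x) + pair_form (real_row R (noise_row f)) (restrict x).
    have xu : (x *m u^T) 0 0 = \sum_i sgn R z i * restrict x 0 i.
      rewrite mxE; under eq_bigr do rewrite [_^T _ _]mxE.
      rewrite (sum_direction z (h := fun i y => x 0 i * y)) => [|i]; last by rewrite mulr0.
      by apply: eq_bigr => i _; rewrite [in RHS]mxE mulrC.
    have := quad_spiked (mat (noise_row f + pair_spike a z) + a%:R *: (u^T *m u)) u a%:R x.
    rewrite addrK quad_mat xu => /esym/eqP; rewrite subr_eq => /eqP ->.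
    have -> : pair_form (real_row R (noise_row f + pair_spike a z)) (restrict x) =
        pair_form (real_row R (noise_row f)) (restrict x) -
        a%:R * ((\sum_i sgn R z i * restrict x 0 i) ^+ 2 - sqn (restrict x)).
      rewrite sqr_sum_pairs.
      have -> : \sum_i (sgn R z i * restrict x 0 i) ^+ 2 = sqn (restrict x).
        by rewrite sqnE; apply: eq_bigr => i _; rewrite exprMn expr2 sgn_sqr mul1r.
      rewrite [sqn _ + _]addrC addrK mulr_sumr -sumrN -big_split /=; apply: eq_bigr => k _.
      have -> : real_row R (noise_row f + pair_spike a z) =
          real_row R (noise_row f) - a%:R *: sign_row R z.
        by rewrite -scaleNr -real_pair_spike; exact: map_mxD.
      rewrite !mxE; ring.
    ring.
  have a0 : 0 <= a%:R * sqn (restrict x) by rewrite mulr_ge0 ?sqn_ge0.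
  have := ler_wpM2l (ler0n R q) (sqn_restrict x).
  have := ler_wpM2l (ler0n R a) (sqn_restrict x).
  rewrite ler_norml /kappa => h h' /andP[h1 h2]; apply/andP; split; lra.
rewrite linearD /= trace_mat linearZ /= mxtrace_mulC.
have -> : \tr (u *m u^T) = d%:R by rewrite /mxtrace big_ord1 -un.
by rewrite /kappa -mulrDl ler_wpM2r //; have := ler0n R q; lra.
Qed.

Lemma pair_instance : ~ turnstile_solvable R correct W S.
Proof.
have [|||test [test0 test1]] := sep (kappa := kappa) (a := a%:R).
- by rewrite /kappa addr_ge0 ?mulr_ge0.
- by rewrite ltr0n.
- by rewrite /kappa /q natrM.
have DD : (D <= d * d)%N.
  rewrite card_sig; apply: leq_trans (max_card _) _.
  by rewrite card_prod card_ord.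
have B2 : (0 < B ^ 2)%N.
  rewrite expn_gt0 orbF -(ltr0n R); apply: lt_le_trans B_big.
  by rewrite KE !mulr_gt0 ?exprn_gt0 ?ltr0n //; lra.
have eps0 : 0 < eps by rewrite epsE; lra.
have epsq : eps <= 1 / 4 by rewrite epsE; lra.
have F0 : (0 < #|{ffun 'I_d -> bool}|)%N by apply/card_gt0P; exists [ffun=> true].
apply: (@calibrated_lower_bound R D d B C a W S K eps KE epsE d_gt0 DD C_gt0 a_gt0 a_le B_big S_gt0
  _ (pair_spike a) F0 _ _ O correct pos base W_big _ _ _ test (good_noise R (B ^ 2))) => //.
- move=> z k; rewrite mxE abszN abszM.
  by rewrite abszM !abszX /= !exp1n !muln1.
- rewrite /base size_flatten /shape -map_comp sumnE big_map big_enum /=.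
  under eq_bigr do rewrite size_nseq.
  rewrite sum_nat_const card_ord.
  have dB : (54 * d ^ 2 <= B)%N.
    rewrite -(ler_nat R) natrM natrX; apply: le_trans B_big; apply: ler_pM => //.
      by rewrite KE; lra.
    apply: (@le_trans _ _ (d%:R ^+ 6)); first by rewrite ler_weXn2l // ler1n.
    by rewrite ler_peMl ?exprn_ge0 // ler1n.
  have -> : (d * (54 * (B ^ 2 * d)) = 54 * d ^ 2 * B ^ 2)%N by rewrite !expnS !expn0; ring.
  apply: leq_trans (leq_mul dB (leqnn (B ^ 2))) _.
  by rewrite -expnS leq_pexp2l // -(ltr0n R) ; move: B2; rewrite expn_gt0 orbF ltr0n.
- by move=> r P rS PT PP trP; apply: (pair_spike_hidden PT PP eps0 epsq trP (S_small rS)).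
- exact: good_noise_whp.
- by move=> f o gf co; apply: test0 co; exact: null_mat.
- by move=> f z o gf co; apply: test1 co; exact: spiked_mat.
Qed.
End PairInstance.

Section SingleEntryInstance.
Variables (R : realType) (n B C a W S : nat) (K eps eps1 e : R).
Variables (O : Type) (correct : ('I_n * 'I_n -> int) -> O -> Prop).
Hypothesis KE : K = 24 * 1000.
Hypothesis epsE : eps = 1 / 1000.
Hypothesis n_gt0 : (0 < n)%N.
Hypothesis C_gt0 : (0 < C)%N.
Hypothesis a_gt0 : (0 < a)%N.
Hypothesis a_le : (a <= C * B ^ 2)%N.
Hypothesis B_big : K * C%:R <= B%:R.
Hypothesis S_gt0 : (0 < S)%N.
Hypothesis W_big : (B ^ 14 <= W)%N.
Hypothesis sep : separates correct eps1 e 1.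
Hypothesis gap : 2 * (54 * (B ^ 2)%:R) * (1 + e) < (1 - eps1) * a%:R.
Hypothesis S_small : 14 * S%:R < ln (B%:R : R).

Let K0 : 0 < K. Proof. by rewrite KE; lra. Qed.
Let i0 : 'I_n := Ordinal n_gt0.
Let q := (54 * B ^ 2)%N.
Let pos (k : 'I_1) : seq ('I_n * 'I_n) := [:: (i0, i0)].
Let base : unit_stream ('I_n * 'I_n) := nseq q ((i0, i0), false).

Let big_base (h : 'I_n * 'I_n -> R) :
  \sum_(u <- base) (-1) ^+ u.2 * h u.1 = q%:R * h (i0, i0).
Proof. by rewrite /base big_nseq iter_addr_0 /= mul1r mulr_natl. Qed.

Let mat (M : 'rV[int]_1) : 'M[R]_n := matrix_of R (final_frequency pos base M).

Let quad_mat (M : 'rV[int]_1) x : quad (mat M) x = (q%:R + (M 0 0)%:~R) * x 0 i0 ^+ 2.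
Proof.
rewrite /mat quad_final_frequency (big_base (fun p => x 0 p.1 * x 0 p.2)) /=.
by rewrite big_ord1 big_seq1 mulrDl expr2.
Qed.

Let trace_mat M : \tr (mat M) = q%:R + (M 0 0)%:~R.
Proof.
rewrite /mat trace_final_frequency (big_base (fun p => (p.1 == p.2)%:R)) /=.
by rewrite big_ord1 big_seq1 eqxx !mulr1.
Qed.

Let mat_sym M : (mat M)^T = mat M.
Proof.
apply: final_frequency_sym => [k i j|u].
  by rewrite /= !xpair_eqE andbC.
by move=> /nseqP[-> _].
Qed.

Let kappa : R := 2 * q%:R.
Let spike (z : unit) : 'rV[int]_1 := \row_k - a%:Z.
Let s2 : R := (B ^ 2)%:R ^+ 2 * 1%:R.
Notation Noise := {ffun 'I_1 -> 'I_(2 * (B ^ 3 * 1)).+1}.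
Let good (f : Noise) : bool := `|(noise_row f 0 0)%:~R| <= q%:R :> R.

Let x0_le (x : 'rV[R]_n) : x 0 i0 ^+ 2 <= sqn x.
Proof. by rewrite sqnE (bigD1 i0) //= lerDl; apply: sumr_ge0 => i _; exact: sqr_ge0. Qed.

Let null_mat (f : Noise) : good f -> bounded_form (mat (noise_row f)) kappa 1.
Proof.
rewrite /good ler_norml => /andP[g1 g2]; split; first exact: mat_sym.
  move=> x; rewrite quad_mat; have := x0_le x; have := sqr_ge0 (x 0 i0).
  move: (_ ^+ 2) => y y0 yx; rewrite /kappa; apply/andP; split; first nra.
  apply: (@le_trans _ _ (2 * q%:R * y)); first nra.
  by apply: ler_wpM2l yx; rewrite mulr_ge0.
rewrite trace_mat /kappa mulr1; lra.
Qed.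

Let spiked_mat (f : Noise) z : good f ->
  exists (E : 'M[R]_n) (u : 'rV[R]_n), [/\ bounded_form E kappa 1, sqn u = 1%:R &
    mat (noise_row f + spike z) = E - a%:R *: (u^T *m u)].
Proof.
move=> gf; exists (mat (noise_row f)), (delta_mx 0 i0); split; first exact: null_mat.
  rewrite sqnE (bigD1 i0) //= !mxE !eqxx expr1n big1 ?addr0 // => i ni.
  by rewrite mxE eqxx (negbTE ni) expr0n.
apply/matrixP => i j; rewrite !mxE big_ord1 !mxE /final_frequency !big_ord1 !eqxx /=.
rewrite addn0 !mxE !rmorphD /= !rmorphM /= rmorphD /= rmorphN /= -!pmulrn.
rewrite xpair_eqE [i0 == i]eq_sym [i0 == j]eq_sym.
by case: (i == i0); case: (j == i0) => /=; ring.
Qed.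

Let good_whp : \sum_(f : Noise | ~~ good f) noise_weight s2 f <= 1 / 100.
Proof.
have B0 : 0 < B%:R :> R.
  by apply: lt_le_trans B_big; rewrite mulr_gt0 ?ltr0n.
have s20 : 0 < s2 by rewrite /s2 mulr1 natrX !exprn_gt0.
have Bn : (B ^ 2)%:R != 0 :> R by rewrite natrX expf_neq0 // gt_eqF.
pose c (f : Noise) : R := (noise_row f 0 0)%:~R.
(* With tilt [B^2] or [- B^2] the Chernoff exponent is [1/2 - 54]. *)
pose tau : R := (B ^ 2)%:R * q%:R.
have tail (k : int) : (k%:~R : R) ^+ 2 = (B ^ 2)%:R ^+ 2 ->
    \sum_(f : Noise | tau < k%:~R * c f) noise_weight s2 f <= expR (- 53).
  move=> kB; have := noise_chernoff (B ^ 3 * 1) s20 (fun _ : 'I_1 => k) tau.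
  under eq_bigl do rewrite big_ord1.
  move/le_trans; apply; rewrite ler_expR big_ord1 kB /s2 mulr1.
  have -> : tau / (B ^ 2)%:R ^+ 2 = 54.
    have -> : tau = 54 * (B ^ 2)%:R ^+ 2 by rewrite /tau /q [(54 * _)%:R]natrM expr2 mulrCA.
    by rewrite mulfK // expf_neq0.
  have -> : (B ^ 2)%:R ^+ 2 / (2 * (B ^ 2)%:R ^+ 2) = 2^-1 :> R.
    by rewrite invfM mulrCA mulfV ?mulr1 // expf_neq0.
  lra.
have t1 := tail (B ^ 2)%N%:Z (erefl _).
have t2 := tail (- (B ^ 2)%N%:Z); rewrite rmorphN sqrrN in t2; have {}t2 := t2 (erefl _).
rewrite [leLHS]big_mkcond /= in t1; rewrite [leLHS]big_mkcond /= in t2.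
rewrite [leLHS]big_mkcond /=.
have B20 : 0 < (B ^ 2)%:R :> R by rewrite natrX exprn_gt0.
have : \sum_(f : Noise) (if ~~ good f then noise_weight s2 f else 0) <= expR (- 53) + expR (- 53).
  apply: le_trans _ (lerD t1 t2); rewrite -big_split /=; apply: ler_sum => f _.
  rewrite /good -ltNge -/(c f) /tau -pmulrn mulNr -mulrN !ltr_pM2l //.
  have w0 : 0 <= noise_weight s2 f by exact: noise_weight_ge0.
  rewrite lter_normr; case: ltP => _; case: ltP => _ /=; rewrite ?addr0 ?add0r ?lerDl ?lexx //.
move/le_trans; apply.
have : expR (- 53) <= (expR 1 ^+ 8)^-1 :> R.
  by rewrite -expRM_natl mulr1 -expRN ler_expR; lra.
have : (expR 1 ^+ 8)^-1 <= (2 ^+ 8)^-1 :> R.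
  rewrite lef_pV2 ?posrE ?exprn_gt0 ?expR_gt0 //.
  by rewrite lerXn2r ?nnegrE ?expR_ge0 //; have := expR_ge1Dx (1 : R); lra.
have -> : (2 ^+ 8)^-1 = 256^-1 :> R by rewrite -natrX.
lra.
Qed.

Lemma single_entry_instance : ~ turnstile_solvable R correct W S.
Proof.
have [|||test [test0 test1]] := sep (kappa := kappa) (a := a%:R).
- by rewrite /kappa mulr_ge0.
- by rewrite ltr0n.
- by rewrite mulr1 /kappa /q natrM.
have B0 : (0 < B)%N.
  by rewrite -(ltr0n R); apply: lt_le_trans B_big; rewrite mulr_gt0 ?ltr0n.
have eps0 : 0 <= eps by rewrite epsE; lra.
have F0 : (0 < #|{: unit}|)%N by rewrite card_unit.
have Bb : K * (C%:R * 1%:R ^+ 6) <= B%:R by rewrite expr1n mulr1.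
apply: (@calibrated_lower_bound R 1 1 B C a W S K eps KE epsE isT isT C_gt0 a_gt0 a_le Bb S_gt0
  _ spike F0 _ _ O correct pos base W_big _ _ _ test good) => //.
- by move=> z k; rewrite mxE abszN.
- rewrite /base size_nseq /q.
  have B54 : (54 <= B)%N.
    rewrite -(ler_nat R); apply: le_trans B_big; rewrite -[leLHS]mulr1; apply: ler_pM => //.
      by rewrite KE; lra.
    by rewrite ler1n.
  apply: leq_trans (leq_mul B54 (leqnn (B ^ 2))) _.
  by rewrite -expnS leq_pexp2l.
(* A projection of positive rank would need [ln B <= 14 S], so only [P = 0] is left. Nothing of the
   input is visible then, and even a single deterministic spike is hidden. *)
- move=> [|r] P rS _ _ trP; last first.
    suff : 14 * S%:R < 14 * S%:R :> R by rewrite ltxx.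
    apply: (lt_le_trans S_small); apply: le_trans rS.
    by rewrite ler_peMl ?ler1n // ln_ge0 // ler1n.
  exists [set: unit] => [|z _].
    by rewrite finset.setCT cards0 mulr_ge0.
  rewrite (eq_bigr (fun=> 1)) => [|z' _].
    by rewrite sumr_const cardsT card_unit mulr1n mul1r lerDl.
  have P0 : P = 0.
    by apply/matrixP => i j; rewrite !ord1 mxE; move: trP; rewrite /mxtrace big_ord1.
  by rewrite big_ord1 P0 mulmx0 mxE !mul0r expR0.
- by move=> f o gf co; apply: test0 co; exact: null_mat.
- by move=> f z o gf co; apply: test1 co; exact: spiked_mat.
Qed.
End SingleEntryInstance.

(** * Space lower bounds *)

Section Bounds.
Variables (R : realType) (n : nat) (eps1 K eps A : R).
Variables (O : Type) (correct : ('I_n * 'I_n -> int) -> O -> Prop).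
Hypothesis eps1_itv : 0 <= eps1 < 1.
Let g : R := 1 - eps1.
Let g0 : 0 < g. Proof. by rewrite /g subr_gt0; case/andP: eps1_itv. Qed.
Let g1 : g <= 1. Proof. by rewrite /g gerBl; case/andP: eps1_itv. Qed.

(** An algorithm with one state answers alike on the empty stream and after one decrement of a
    diagonal entry. The total success on the two exceeds 1, so some seed is right on both, against
    [separates]. *)
Lemma space_gt0 (W S : nat) (e : R) : (0 < n)%N -> (0 < W)%N ->
  separates correct eps1 e 1 -> turnstile_solvable R correct W S -> (0 < S)%N.
Proof.
move=> n0 W0 sep solv; rewrite lt0n; apply/eqP => S0; rewrite S0 in solv.
have [|||test [test0 test1]] := sep 0 1 => //; first by rewrite mul0r !mulr1.
pose i0 := Ordinal n0.
pose st (b : bool) : unit_stream ('I_n * 'I_n) := if b then [:: ((i0, i0), true)] else [::].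
have st_size b : (size (st b) <= W)%N by case: b.
have eta0 : 0 < 1 / 100 :> R by rewrite divr_gt0.
have [alg Amem Asucc] := average_over_seeds solv (fun=> ler01 : 0 <= 1 :> R) st_size eta0.
have states (x y : mem_state alg) : x = y.
  have /fintype_le1P h : (#|mem_state alg| <= 1)%N by [].
  exact: h.
have same b : run alg (st b) = mem_output (mem_init alg).
  rewrite /run; congr mem_output; exact: states.
have f0 : null_class (0 : R) 1 (frequency (st false)).
  have -> : frequency (st false) = fun=> 0 by apply/funext => i; rewrite /frequency big_nil.
  rewrite /null_class; have -> : matrix_of R (fun=> 0) = 0 :> 'M[R]_n by apply/matrixP => i j; rewrite !mxE.
  split; [exact: trmx0| |by rewrite mxtrace0 mul0r].
  by move=> x; rewrite /quad mulmx0 mul0mx mxE mul0r lexx.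
have f1 : spike_class (0 : R) 1 1 (frequency (st true)).
  exists 0, (delta_mx 0 i0); split.
  - split; [exact: trmx0| |by rewrite mxtrace0 mul0r].
    by move=> x; rewrite /quad mulmx0 mul0mx mxE mul0r lexx.
  - rewrite sqnE (bigD1 i0) //= !mxE !eqxx expr1n big1 ?addr0 // => i ni.
    by rewrite mxE eqxx (negbTE ni) expr0n.
  apply/matrixP => i j; rewrite !mxE /frequency big_cons big_nil big_ord1 !mxE eqxx /=.
  rewrite xpair_eqE [i0 == i]eq_sym [i0 == j]eq_sym.
  by case: (i == i0); case: (j == i0) => /=; rewrite ?addr0 ?rmorphN1 ?expr1; lra.
have [c0 c1] : correct (frequency (st false)) (run alg (st false)) /\
    correct (frequency (st true)) (run alg (st true)).
  move: Asucc; rewrite !big_bool /=.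
  case: asboolP => [h1|_]; case: asboolP => [h2|_] //=; rewrite ?mulr0 ?mulr1; lra.
have := test0 _ _ f0 c0; have := test1 _ _ f1 c1; rewrite !same => /negbTE ->.
by [].
Qed.

Lemma single_entry_bound (B W S C : nat) (e : R) :
  K = 24 * 1000 -> eps = 1 / 1000 -> A = 217 -> (0 < n)%N -> (0 < S)%N ->
  (B ^ 14 <= W)%N -> 3 * A / g <= C%:R -> K * C%:R <= B%:R :> R -> 0 <= e <= 2 ->
  separates correct eps1 e 1 -> turnstile_solvable R correct W S -> ln (B%:R : R) <= 14 * S%:R.
Proof.
move=> KE epsE AE n0 S0 BW Cg CB /andP[e0 e2] sep solv; rewrite leNgt; apply/negP => small.
have K0 : 0 < K by rewrite KE; lra.
have A162 : 162 <= A by rewrite AE; lra.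
have inst a := @single_entry_instance R n B C a W S K eps eps1 e O correct KE epsE.
move: {KE epsE AE} A162 => A162; have A1 : 1 <= A by lra.
have C1 : 1 <= C%:R :> R.
  apply: le_trans Cg; rewrite ler_pdivlMr // mul1r; apply: le_trans g1 _; lra.
have C0 : (0 < C)%N by rewrite -(ltr0n R); lra.
have Cp : 0 < C%:R :> R by lra.
have Bp : 0 < B%:R :> R by apply: lt_le_trans CB; rewrite mulr_gt0.
have B0 : 0 < (B ^ 2)%:R :> R by rewrite natrX exprn_gt0.
have B1 : 1 <= (B ^ 2)%:R :> R by move: B0; rewrite ltr0n ler1n.
(* The gap asks for [a] above [108 B^2 (1 + e) / g]; with [e <= 2] this is at most
   [2 * 162 B^2 / g]. *)
pose y : R := 2 * A * (B ^ 2)%:R / g.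
have A0 : 0 <= A by lra.
have y0 : 0 <= y by rewrite /y divr_ge0 ?mulr_ge0 ?(ltW g0).
pose a := (Num.truncn y).+1.
have /andP[ya1 ya2] := truncn_itv y0.
have a_le : a%:R <= (C * B ^ 2)%:R :> R.
  rewrite [(C * _)%:R]natrM; apply: (@le_trans _ _ (3 * A / g * (B ^ 2)%:R)); last first.
    by rewrite ler_wpM2r // ltW.
  rewrite /a -natr1.
  have -> : 3 * A / g * (B ^ 2)%:R = y + A / g * (B ^ 2)%:R by rewrite /y; field; rewrite gt_eqF.
  by apply: lerD ya1 _; rewrite mulr_ege1 // ler_pdivlMr // mul1r; apply: le_trans g1 _.
apply: (inst a n0 C0 (ltn0Sn _) _ CB S0 BW sep _ small solv).
  by rewrite -(ler_nat R).
rewrite -/g mulrC -ltr_pdivrMl // in ya2 *.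
apply: le_lt_trans ya2; rewrite /y [leRHS]mulrC ler_wpM2l ?invr_ge0 ?(ltW g0) //.
have : (B ^ 2)%:R * e <= (B ^ 2)%:R * 2 by rewrite ler_wpM2l // ltW.
have : (B ^ 2)%:R * 162 <= (B ^ 2)%:R * A by rewrite ler_wpM2l // ltW.
lra.
Qed.

Lemma many_pairs_bound (d B W S C : nat) (e : R) :
  K = 24 * 1000 -> eps = 1 / 1000 -> A = 217 ->
  (0 < d)%N -> (d <= n)%N -> (0 < S)%N ->
  (B ^ 14 <= W)%N -> 3 * A / g <= C%:R -> K * (C%:R * d%:R ^+ 7) <= B%:R :> R ->
  0 <= e -> e <= 2 * d%:R -> 2 * (1 + e) <= g * d%:R ->
  separates correct eps1 e d -> turnstile_solvable R correct W S ->
  eps ^+ 2 * g ^+ 4 / (64 * 14 * A ^+ 4) * (d%:R ^+ 2 / (1 + e) ^+ 4) * ln (B%:R : R) <= S%:R.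
Proof.
move=> KE epsE AE d0 dn S0 BW Cg CB e0 e2 gd sep solv; rewrite leNgt; apply/negP => small.
have K2 : 2 <= K by rewrite KE; lra.
have A216 w : 0 <= w -> 2 * (54 * (2 * w)) <= (A - 1) * w by rewrite AE; lra.
have A1 : 1 < A by rewrite AE; lra.
have inst a := @pair_instance R n d B (C * d) a W S K eps eps1 e O correct KE epsE.
move: {KE epsE AE} A1 => A1; have K0 : 0 < K by lra.
have A0 : 0 < A by lra.
have C1 : 1 <= C%:R :> R.
  apply: le_trans Cg; rewrite ler_pdivlMr // mul1r; apply: le_trans g1 _; lra.
have d1 : 1 <= d%:R :> R by rewrite ler1n.
have C0 : (0 < C * d)%N by rewrite muln_gt0 d0 andbT -(ltr0n R); lra.
have Bp : 0 < B%:R :> R.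
  have Cp : 0 < C%:R :> R by lra.
  have dp : 0 < d%:R :> R by lra.
  by apply: lt_le_trans CB; rewrite !mulr_gt0 ?exprn_gt0.
have B0 : 0 < (B ^ 2)%:R :> R by rewrite natrX exprn_gt0.
have B1 : 1 <= (B ^ 2)%:R :> R by move: B0; rewrite ltr0n ler1n.
pose z : R := (B ^ 2)%:R * (1 + e) / g.
have z1 : 1 <= z by rewrite /z ler_pdivlMr // mul1r (le_trans g1) // mulr_ege1 // lerDl.
(* The condition [2 (1 + e) <= g d] absorbs the contribution of [a] to [kappa] into half of [g a d];
   the other half needs [a] above [216 z]. The last unit of [A = 217] pays for rounding up, as
   [z >= 1]. *)
pose y : R := (A - 1) * z.
have y0 : 0 <= y by rewrite /y mulr_ge0; lra.
pose a := (Num.truncn y).+1.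
have /andP[ya1 ya2] := truncn_itv y0.
have aA : a%:R <= A * z by rewrite /a -natr1; move: ya1; rewrite /y; lra.
have a_le : a%:R <= (C * d * B ^ 2)%:R :> R.
  apply: le_trans aA _; rewrite [(C * d * _)%:R]natrM [(C * d)%:R]natrM.
  apply: (@le_trans _ _ (3 * A / g * d%:R * (B ^ 2)%:R)); last first.
    by rewrite ler_wpM2r ?(ltW B0) // ler_wpM2r.
  have -> : A * z = A / g * (1 + e) * (B ^ 2)%:R by rewrite /z; field; rewrite gt_eqF.
  have -> : 3 * A / g * d%:R * (B ^ 2)%:R = A / g * (3 * d%:R) * (B ^ 2)%:R by field; rewrite gt_eqF.
  rewrite ler_wpM2r ?(ltW B0) // ler_wpM2l ?divr_ge0 ?(ltW g0) ?(ltW A0) //; lra.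
have CB' : K * ((C * d)%:R * d%:R ^+ 6) <= B%:R :> R.
  by rewrite [(C * d)%:R]natrM -[_ * d%:R * _]mulrA -exprS.
apply: (inst a dn d0 C0 (ltn0Sn _) _ CB' S0 BW sep _ _ solv).
- by rewrite -(ler_nat R).
- rewrite -/g [(B ^ 2 * d)%:R]natrM.
  have dp : 0 < d%:R :> R by lra.
  have ap : 0 < a%:R :> R by rewrite ltr0n.
  have h1 : a%:R * (2 * (1 + e)) <= a%:R * (g * d%:R) by rewrite ler_wpM2l // ltW.
  have h2 : y * (g * d%:R) < a%:R * (g * d%:R) by rewrite ltr_pM2r // mulr_gt0.
  have e3 : y * (g * d%:R) = (A - 1) * ((B ^ 2)%:R * (1 + e) * d%:R).
    by rewrite /y /z; field; rewrite gt_eqF.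
  have w0 : 0 <= (B ^ 2)%:R * (1 + e) * d%:R by rewrite !mulr_ge0 // ?(ltW B0) //; lra.
  rewrite e3 in h2; have {}h2 := le_lt_trans (A216 _ w0) h2.
  by move: h1 h2; set b2 := (B ^ 2)%:R; lra.
move=> r rS.
have e41 : 0 < (1 + e) ^+ 4 by rewrite exprn_gt0 //; lra.
have dp : 0 < d%:R :> R by lra.
have lnB : 0 < ln (B%:R : R).
  apply: ln_gt0; apply: lt_le_trans CB.
  have cd : 1 <= C%:R * d%:R ^+ 7 :> R by rewrite mulr_ege1 // exprn_ege1.
  by have := ler_wpM2l (ltW K0) cd; lra.
pose t : R := A ^+ 2 * (1 + e) ^+ 2 / (g ^+ 2 * d%:R).
have th : a%:R ^+ 2 / ((B ^ 2)%:R ^+ 2 * d%:R) <= t.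
  rewrite ler_pdivrMr ?mulr_gt0 ?exprn_gt0 //.
  have -> : t * ((B ^ 2)%:R ^+ 2 * d%:R) = (A * z) ^+ 2.
    by rewrite /t /z; field; rewrite !gt_eqF.
  by rewrite lerXn2r ?nnegrE // mulr_ge0 ?(ltW A0) //; lra.
have th2 : (a%:R ^+ 2 / ((B ^ 2)%:R ^+ 2 * d%:R)) ^+ 2 <= t ^+ 2.
  have s0 : 0 <= a%:R ^+ 2 / ((B ^ 2)%:R ^+ 2 * d%:R) :> R by rewrite divr_ge0 ?mulr_ge0 ?exprn_ge0.
  by rewrite lerXn2r ?nnegrE // (le_trans s0).
apply: (@le_trans _ _ (64 * t ^+ 2 * r%:R)).
  by rewrite ler_wpM2r // ler_wpM2l.
have rle : r%:R * ln (B%:R : R) <= (14 * (eps ^+ 2 * g ^+ 4 / (64 * 14 * A ^+ 4) *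
    (d%:R ^+ 2 / (1 + e) ^+ 4))) * ln (B%:R : R).
  apply: le_trans rS _; rewrite -mulrA ler_wpM2l //; exact: ltW.
rewrite ler_pM2r // in rle.
apply: le_trans (ler_wpM2l (_ : 0 <= 64 * t ^+ 2) rle) _.
  by rewrite mulr_ge0 ?sqr_ge0.
rewrite le_eqVlt; apply/orP; left; apply/eqP; rewrite /t; field.
by rewrite !gt_eqF //; lra.
Qed.
End Bounds.

Lemma floor_root (k W : nat) : (0 < k)%N -> (0 < W)%N ->
  exists B : nat, [/\ (0 < B)%N, (B ^ k <= W)%N & (W < B.+1 ^ k)%N].
Proof.
move=> k0 W0; pose P (i : nat) := (i ^ k <= W)%N.
have P1 : exists i, P i by exists 1%N; rewrite /P exp1n.
have PW i : P i -> (i <= W)%N.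
  move=> Pi; apply: leq_trans Pi; case: i => // i.
  by rewrite -{1}[i.+1]expn1 leq_pexp2l.
case: (ex_maxnP P1 PW) => B PB Bmax; exists B; split => //.
  by apply: Bmax; rewrite /P exp1n.
by rewrite ltnNge; apply/negP => /Bmax; rewrite ltnn.
Qed.

(** [B] is the integral 14th root of [W], because the streams have length up to [B^14]; the exponent
    560 = 40 * 14 then gives [n^40 <= B]. The second separation, in dimension 1, supports the
    one-entry instance and the positivity of [S]. *)
Lemma separation_bound (R : realType) (eps1 : R) : 0 <= eps1 < 1 ->
  exists2 c : R, 0 < c &
    forall (n W S d : nat) (e : R) (O : Type) (correct : ('I_n * 'I_n -> int) -> O -> Prop),
      (0 < n)%N -> (n ^ 560 <= W)%N -> (0 < d)%N -> (d <= n)%N ->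
      0 <= e -> e <= 2 * Num.sqrt d%:R -> separates correct eps1 e d ->
      (exists2 e1 : R, 0 <= e1 <= 2 & separates correct eps1 e1 1) ->
      turnstile_solvable R correct W S ->
      c * (d%:R ^+ 2 / (1 + e) ^+ 4) * ln W%:R <= S%:R.
Proof.
move=> eps1_itv; pose g := 1 - eps1.
have g0 : 0 < g by rewrite /g subr_gt0; case/andP: eps1_itv.
have [K KE] : exists K : R, K = 24 * 1000 by exists (24 * 1000).
have [eps epsE] : exists eps : R, eps = 1 / 1000 by exists (1 / 1000).
have [A AE] : exists A : R, A = 217 by exists 217.
have A0 : 0 < A by rewrite AE; lra.
have K2 : 2 <= K by rewrite KE; lra.
have eps0 : 0 < eps by rewrite epsE; lra.
have many n d B W S C e O correct := @many_pairs_bound R n eps1 K eps A O correct eps1_itv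
  d B W S C e KE epsE AE.
have single n B W S C e O correct := @single_entry_bound R n eps1 K eps A O correct eps1_itv
  B W S C e KE epsE AE.
move: {KE epsE AE} A0 => A0; have K0 : 0 < K by lra.
pose C := (Num.truncn (3 * A / g)).+1.
have Cg : 3 * A / g <= C%:R.
  have h0 : 0 <= 3 * A / g by rewrite divr_ge0 ?mulr_ge0 ?(ltW A0) ?(ltW g0).
  by have /andP[_ /ltW] := truncn_itv h0.
have C1 : 1 <= C%:R :> R by rewrite ler1n.
pose Q := (Num.truncn (K * C%:R)).+1.
have QK : K * C%:R <= Q%:R.
  have h0 : 0 <= K * C%:R by rewrite mulr_ge0 // ltW.
  by have /andP[_ /ltW] := truncn_itv h0.
have Q2 : 2 <= Q%:R :> R.
  by apply: le_trans QK; have := ler_wpM2l (ltW K0) C1; lra.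
have Q1 : 1 <= Q%:R :> R by lra.
have QQ : 1 <= Q%:R ^+ 2 :> R by rewrite exprn_ege1.
pose c2 := eps ^+ 2 * g ^+ 4 / (64 * 14 * A ^+ 4).
have c20 : 0 < c2 by rewrite /c2 divr_gt0 ?mulr_gt0 ?exprn_gt0.
(* One constant for each regime: many pairs, one entry, bounded [B]. *)
pose c := Num.min (c2 / 28) (Num.min (g ^+ 2 / 112 / 14) (14 * Q%:R ^+ 6)^-1).
have c0 : 0 < c.
  have Q0 : 0 < Q%:R :> R by lra.
  by rewrite !lt_min !divr_gt0 ?invr_gt0 ?mulr_gt0 ?exprn_gt0.
have [cc2 ccg ccQ] : [/\ c <= c2 / 28, c <= g ^+ 2 / 112 / 14 & c <= (14 * Q%:R ^+ 6)^-1].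
  have : c <= c by [].
  by rewrite {2}/c !le_min => /and3P[].
exists c => // n W S d e O correct n0 nW d0 dn e0 e2 sep [e1 e1_itv sep1] solv.
have W0 : (0 < W)%N by apply: leq_trans nW; rewrite expn_gt0 n0.
have [B [B0 BW WB]] := floor_root (isT : (0 < 14)%N) W0.
have S0 := space_gt0 eps1_itv n0 W0 sep1 solv.
have S1 : 1 <= S%:R :> R by rewrite ler1n.
have nB : (n ^ 40 <= B)%N.
  rewrite leqNgt; apply/negP => Bn; move: WB; rewrite ltnNge => /negP; apply.
  apply: leq_trans nW; rewrite (expnM n 40 14) leq_exp2r //.
have d1 : 1 <= d%:R :> R by rewrite ler1n.
have dp : 0 < d%:R :> R by lra.
have B1 : 1 <= B%:R :> R by rewrite ler1n.
have dB k : (k <= 40)%N -> d%:R ^+ k <= B%:R :> R.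
  move=> k40; rewrite -natrX ler_nat; apply: leq_trans nB.
  by apply: leq_trans (leq_pexp2l d0 k40) _; rewrite leq_exp2r.
have e4 : 1 <= (1 + e) ^+ 4 by rewrite exprn_ege1 // lerDl.
pose X : R := d%:R ^+ 2 / (1 + e) ^+ 4.
have X0 : 0 <= X by rewrite divr_ge0 ?exprn_ge0 //; lra.
have lnW : ln (W%:R : R) <= 14 * ln (B.+1%:R : R).
  rewrite mulr_natl -lnXn ?ltr0n // ler_ln ?posrE ?exprn_gt0 ?ltr0n //.
  by rewrite -natrX ler_nat ltnW.
have lnW0 : 0 <= ln (W%:R : R) by rewrite ln_ge0 // ler1n.
(* If [B] is bounded, so are [d] and [ln W], and [c] makes the claimed bound at most 1, while
   [S >= 1]. *)
have [Bsmall|Bbig] := ltP (B%:R : R) (Q%:R ^+ 2).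
  have XQ : X <= Q%:R ^+ 2.
    apply: le_trans (le_trans (dB 2%N isT) (ltW Bsmall)).
    by rewrite /X ler_pdivrMr ?ler_peMr ?exprn_ge0 //; lra.
  have lnQ : ln (W%:R : R) <= 14 * Q%:R ^+ 2.
    apply: le_trans lnW _; rewrite ler_wpM2l //; apply: le_trans _ (ltW Bsmall).
    rewrite -[leRHS]expRK ler_ln ?posrE ?expR_gt0 ?ltr0n // -natr1 addrC; exact: expR_ge1Dx.
  apply: le_trans S1.
  apply: (@le_trans _ _ ((14 * Q%:R ^+ 6)^-1 * Q%:R ^+ 2 * (14 * Q%:R ^+ 2))).
    apply: ler_pM => //; first by rewrite mulr_ge0 // ltW.
    by apply: ler_pM => //; exact: ltW.
  have -> : (14 * Q%:R ^+ 6)^-1 * Q%:R ^+ 2 * (14 * Q%:R ^+ 2) = (Q%:R ^+ 2)^-1 :> R.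
    by field; rewrite gt_eqF //; lra.
  by rewrite invf_le1 //; apply: lt_le_trans QQ.
have lnB0 : 0 <= ln (B%:R : R) by rewrite ln_ge0.
have lnWB : ln (W%:R : R) <= 28 * ln (B%:R : R).
  apply: le_trans lnW _.
  have -> : 28 * ln (B%:R : R) = 14 * ln (B%:R ^+ 2).
    by rewrite lnXn ?ltr0n // -[ln _ *+ 2]mulr_natl; lra.
  rewrite ler_wpM2l // ler_ln ?posrE ?exprn_gt0 ?ltr0n // -natr1 expr2.
  have : 2 <= B%:R :> R by apply: le_trans Bbig; rewrite expr2; nra.
  nra.
have KCB : K * C%:R <= B%:R.
  by apply: le_trans Bbig; apply: le_trans QK _; rewrite expr2 ler_peMr.
have [gd|gd] := leP (2 * (1 + e)) (g * d%:R).
  have KCd : K * (C%:R * d%:R ^+ 7) <= B%:R.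
    (* Compare squares: [(K C)^2 <= Q^2 <= B] and [d^14 <= B]. *)
    rewrite mulrA -ler_sqr ?nnegrE ?mulr_ge0 ?exprn_ge0 ?(ltW K0) //.
    rewrite exprMn -exprM expr2 [leRHS]expr2; apply: ler_pM => //.
    - by rewrite -expr2 sqr_ge0.
    - by apply: le_trans Bbig; rewrite expr2; apply: ler_pM; rewrite ?mulr_ge0 // ltW.
    exact: dB.
  have sd : Num.sqrt d%:R <= d%:R :> R.
    by rewrite -{2}[d%:R]sqr_sqrtr // expr2 ler_peMr ?sqrtr_ge0 // -[leLHS]sqrtr1 ler_wsqrtr.
  have e2d : e <= 2 * d%:R by apply: le_trans e2 _; rewrite ler_wpM2l.
  have := many _ _ _ _ _ _ _ _ _ d0 dn S0 BW Cg KCd e0 e2d gd sep solv.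
  rewrite -/g -/c2 -/X; apply: le_trans.
  apply: (@le_trans _ _ (c2 / 28 * X * (28 * ln B%:R))); last by rewrite le_eqVlt; apply/orP; left; apply/eqP; field.
  apply: ler_pM => //; first by rewrite mulr_ge0 // ltW.
  by rewrite ler_wpM2r.
(* Here [d] is at most [2 (1 + e) / g], so [X] is bounded and the one-entry bound, of order [ln B],
   suffices. *)
have lnBS := single _ _ _ _ _ _ _ _ n0 S0 BW Cg KCB e1_itv sep1 solv.
have Xg : X <= 4 / g ^+ 2.
  rewrite /X ler_pdivrMr; last by lra.
  rewrite mulrAC ler_pdivlMr ?exprn_gt0 //.
  apply: (@le_trans _ _ ((2 * (1 + e)) ^+ 2)).
    rewrite -exprMn [d%:R * g]mulrC lerXn2r ?nnegrE ?mulr_ge0 ?(ltW g0) //; [lra|exact: ltW].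
  have -> : 4 * (1 + e) ^+ 4 = (2 * (1 + e)) ^+ 2 * (1 + e) ^+ 2 by ring.
  by rewrite ler_peMr ?sqr_ge0 // exprn_ege1 // lerDl.
apply: (@le_trans _ _ (g ^+ 2 / 112 / 14 * (4 / g ^+ 2) * (28 * ln B%:R))).
  apply: ler_pM => //; first by rewrite mulr_ge0 // ltW.
  by apply: ler_pM => //; exact: ltW.
have -> : g ^+ 2 / 112 / 14 * (4 / g ^+ 2) * (28 * ln B%:R) = ln (B%:R : R) / 14.
  by field; rewrite gt_eqF.
by rewrite ler_pdivrMr // mulrC.
Qed.

Lemma truncated_dimension (R : realType) (n : nat) (y : R) : (0 < n)%N -> 1 <= y ->
  exists d : nat, [/\ (0 < d)%N, (d <= n)%N, d%:R <= y & Num.min n%:R (y / 2) <= d%:R].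
Proof.
move=> n0 y1; have y0 : 0 <= y by lra.
have /andP[t1 t2] := truncn_itv y0.
have t0 : (0 < Num.truncn y)%N by rewrite truncn_gt0.
exists (minn n (Num.truncn y)); rewrite leq_min n0 t0 geq_minl; split => //.
  by apply: le_trans t1; rewrite ler_nat geq_minr.
have t3 : 1 <= (Num.truncn y)%:R :> R by rewrite ler1n.
rewrite -natr1 in t2; rewrite ge_min.
have [h|h] := leqP n (Num.truncn y).
  by rewrite lexx.
by apply/orP; right; lra.
Qed.

Lemma dimension_ratio_ge (R : realType) (d : nat) (e b z : R) : 0 <= e -> e <= b ->
  z * (1 + b) ^+ 4 <= d%:R ^+ 2 -> z <= d%:R ^+ 2 / (1 + e) ^+ 4.
Proof.
move=> e0 eb h; have e1 : 0 < (1 + e) ^+ 4 by rewrite exprn_gt0 //; lra.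
have [z0|z0] := leP 0 z; last by rewrite (le_trans (ltW z0)) // divr_ge0 ?exprn_ge0 //; lra.
rewrite ler_pdivlMr //; apply: le_trans h; rewrite ler_wpM2l // lerXn2r ?nnegrE //; lra.
Qed.

Theorem theorem7p1p10 (R : realType) :
  exists C0 : nat,
    (forall kappa eps1 : R, 0 < kappa -> eps1 < 1 ->
       exists2 c : R, 0 < c &
         forall (n W S : nat) (eps : R),
           (0 < n)%N -> (n ^ C0 <= W)%N -> 0 < eps <= eps1 ->
           kappa * eps ^- 2 <= n%:R ->
           turnstile_solvable R (@eigenvalue_approximation R n eps) W S ->
           c * eps ^- 4 * ln W%:R <= S%:R)
    /\
    (forall p eps1 : R, 1 <= p <= 2 -> eps1 < 1 ->
       exists2 c : R, 0 < c &
         forall (n W S : nat) (eps : R),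
           (0 < n)%N -> (n ^ C0 <= W)%N -> 0 < eps <= eps1 ->
           turnstile_solvable R (@psd_test R n eps p%:E) W S ->
           c * Num.min (eps `^ (- (2 * p))) (n%:R ^+ 2) * ln W%:R <= S%:R)
    /\
    (forall p eps1 : R, 2 < p -> eps1 < 1 ->
       exists2 c : R, 0 < c &
         forall (n W S : nat) (eps : R),
           (0 < n)%N -> (n ^ C0 <= W)%N -> 0 < eps <= eps1 ->
           turnstile_solvable R (@psd_test R n eps p%:E) W S ->
           c * Num.min (eps ^- 4 * n%:R `^ (2 - 4 / p)) (n%:R ^+ 2) * ln W%:R
             <= S%:R)
    /\
    (forall eps1 : R, eps1 < 1 ->
       exists2 c : R, 0 < c &
         forall (n W S : nat) (eps : R),
           (0 < n)%N -> (n ^ C0 <= W)%N -> 0 < eps <= eps1 ->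
           turnstile_solvable R (@psd_test R n eps +oo%E) W S ->
           c * n%:R ^+ 2 * ln W%:R <= S%:R).
Proof.
exists 560%N.
(* [eps1] may be negative, in which case no [eps] qualifies; clipping it at 0 puts it in the range
   of [separation_bound]. *)
have clip (eps1 : R) : eps1 < 1 -> 0 <= Num.max eps1 0 < 1.
  by move=> h; rewrite le_max lexx orbT /= gt_max h ltr01.
have clip_le (eps eps1 : R) : eps <= eps1 -> eps <= Num.max eps1 0 by rewrite le_max => ->.
have scale (c c' z X l : R) (S : nat) : 0 < c -> 0 <= l -> c' * z <= c * X ->
    c * X * l <= S%:R -> c' * z * l <= S%:R.
  by move=> c0 l0 zX; apply: le_trans; rewrite ler_wpM2r.
have lnW_ge0 (n W : nat) : (0 < n)%N -> (n ^ 560 <= W)%N -> 0 <= ln (W%:R : R).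
  move=> n0 nW; apply: ln_ge0; rewrite ler1n; apply: leq_trans nW.
  by rewrite expn_gt0 n0.
have pow1 (r : R) : 1 `^ r = 1 by rewrite powR1.
have eps_lt1 (eps eps1 : R) : eps1 < 1 -> eps <= eps1 -> eps <= 1 by lra.
split; [|split; [|split]].
- move=> kappa eps1 k0 e1; have [c c0 cP] := separation_bound (clip _ e1).
  (* [d] of order [eps^-2] keeps [e = 2 eps sqrt d] at most 2, whence 81 = (1 + 2)^4. Both
     [kappa eps^-2 <= n] and the loss of 1/2 in truncating [eps^-2] are covered by [rho]. *)
  pose rho := Num.min kappa (1 / 2).
  have rho0 : 0 < rho by rewrite lt_min k0; lra.
  exists (c * (rho ^+ 2 / 81)); first by rewrite mulr_gt0 // divr_gt0 ?exprn_gt0.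
  move=> n W S eps n0 nW /andP[ep0 ep1] kn solv.
  have epl := eps_lt1 _ _ e1 ep1.
  have y1 : 1 <= eps ^- 2 by rewrite invf_ge1 ?exprn_gt0 // exprn_ile1 // ltW.
  have [d [d0 dn dy dmin]] := truncated_dimension n0 y1.
  have d1 : 1 <= d%:R :> R by rewrite ler1n.
  pose e := 2 * eps * Num.sqrt (d%:R : R).
  have e0 : 0 <= e by rewrite /e !mulr_ge0 ?sqrtr_ge0 ?ltW.
  have e2 : e <= 2.
    rewrite /e -mulrA ger_pMr // -(@ler_pXn2r _ 2) ?nnegrE ?mulr_ge0 ?sqrtr_ge0 ?(ltW ep0) //.
    rewrite expr1n exprMn sqr_sqrtr // mulrC -ler_pdivlMr ?exprn_gt0 //.
    by rewrite div1r.
  have bound := cP n W S d e _ _ n0 nW d0 dn e0 _ (eigenvalue_separates ep0 (clip_le _ _ ep1) d0 dn) _ solv.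
  apply: (scale c _ _ _ _ _ c0 (lnW_ge0 _ _ n0 nW) _ (bound _ _)).
  + rewrite -mulrA ler_pM2l //; apply: (dimension_ratio_ge e0 e2).
    have -> : (1 + 2) ^+ 4 = 81 :> R by ring.
    rewrite mulrAC divfK //.
    have -> : rho ^+ 2 * eps ^- 4 = (rho * eps ^- 2) ^+ 2.
      by rewrite exprMn exprVn -exprM.
    rewrite lerXn2r ?nnegrE ?mulr_ge0 ?(ltW rho0) ?invr_ge0 ?exprn_ge0 ?(ltW ep0) //.
    apply: le_trans dmin; rewrite le_min; apply/andP; split.
      apply: le_trans kn; rewrite ler_wpM2r ?invr_ge0 ?exprn_ge0 ?(ltW ep0) //.
      by rewrite ge_min lexx.
    rewrite mulrC ler_wpM2l ?invr_ge0 ?exprn_ge0 ?(ltW ep0) //.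
    by rewrite ge_min mul1r lexx orbT.
  + by rewrite /e -mulrA ler_wpM2l // ger_pMl ?sqrtr_gt0; lra.
  + exists (2 * eps * Num.sqrt 1%:R); last exact: eigenvalue_separates ep0 (clip_le _ _ ep1) _ n0.
    by rewrite sqrtr1 mulr1; lra.
- move=> p eps1 /andP[p1 p2] e1; have [c c0 cP] := separation_bound (clip _ e1).
  (* [d] of order [eps^-p] keeps [e = eps d^(1/p)] at most 1. The factor 64 is 16 = (1 + 1)^4 times
     4, the square of the loss in truncating. *)
  exists (c * 64^-1); first by rewrite mulr_gt0.
  move=> n W S eps n0 nW /andP[ep0 ep1] solv.
  have epl := eps_lt1 _ _ e1 ep1.
  have p0 : 0 < p by lra.
  have pn : p != 0 by rewrite gt_eqF.
  pose x := eps `^ p.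
  have x0 : 0 < x by rewrite powR_gt0.
  have x1 : x <= 1 by rewrite /x -(pow1 p) ge0_ler_powR ?nnegrE ?(ltW p0) ?(ltW ep0).
  have y1 : 1 <= x^-1 by rewrite invf_ge1.
  have [d [d0 dn dy dmin]] := truncated_dimension n0 y1.
  have d1 : 1 <= d%:R :> R by rewrite ler1n.
  pose e := eps * (d%:R : R) `^ p^-1.
  have e0 : 0 <= e by rewrite /e mulr_ge0 ?powR_ge0 ?ltW.
  have e2 : e <= 1.
    have -> : e = (x * d%:R) `^ p^-1.
      by rewrite powRM ?(ltW x0) // /x -powRrM mulfV // powRr1 // ltW.
    rewrite -[leRHS](pow1 p^-1) ge0_ler_powR ?nnegrE ?invr_ge0 ?mulr_ge0 ?(ltW p0) ?(ltW x0) //.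
    by rewrite mulrC -ler_pdivlMr // div1r.
  have bound := cP n W S d e _ _ n0 nW d0 dn e0 _ (psd_separates n ep0 (clip_le _ _ ep1) d0 p1) _ solv.
  apply: (scale c _ _ _ _ _ c0 (lnW_ge0 _ _ n0 nW) _ (bound _ _)).
  + rewrite -mulrA ler_pM2l //; apply: (dimension_ratio_ge e0 e2).
    have -> : eps `^ (- (2 * p)) = x^-1 ^+ 2.
      by rewrite powRN mulrC powRrM powR_mulrn ?powR_ge0 // exprVn.
    set m := Num.min _ _.
    have -> : 64^-1 * m * (1 + 1) ^+ 4 = m / 4 by field.
    rewrite ler_pdivrMr //.
    have [h|h] := leP (n%:R : R) (x^-1 / 2).
      rewrite (min_idPl h) in dmin.
      have : m <= n%:R ^+ 2 by rewrite ge_min lexx orbT.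
      have : n%:R ^+ 2 <= d%:R ^+ 2 :> R by rewrite lerXn2r ?nnegrE.
      have := sqr_ge0 (d%:R : R); lra.
    rewrite (min_idPr (ltW h)) in dmin.
    have : m <= x^-1 ^+ 2 by rewrite ge_min lexx.
    have : (x^-1 / 2) ^+ 2 <= d%:R ^+ 2 by rewrite lerXn2r ?nnegrE ?divr_ge0 ?invr_ge0 ?(ltW x0).
    rewrite exprMn; lra.
  + apply: le_trans e2 _.
    have : Num.sqrt 1 <= Num.sqrt d%:R :> R by rewrite ler_wsqrtr.
    by rewrite sqrtr1; lra.
  + exists (eps * 1%:R `^ p^-1); last exact: (psd_separates n ep0 (clip_le _ _ ep1) (ltn0Sn 0) p1).
    by rewrite pow1 mulr1; lra.
- move=> p eps1 p2 e1; have [c c0 cP] := separation_bound (clip _ e1).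
  exists (c * 16^-1); first by rewrite mulr_gt0.
  move=> n W S eps n0 nW /andP[ep0 ep1] solv.
  have epl := eps_lt1 _ _ e1 ep1.
  have p0 : 0 < p by lra.
  have p1 : 1 <= p by lra.
  have pn : p != 0 by rewrite gt_eqF.
  have n1 : 1 <= n%:R :> R by rewrite ler1n.
  pose t := (n%:R : R) `^ p^-1.
  have t0 : 0 < t by rewrite powR_gt0 //; lra.
  pose e := eps * t.
  have e0 : 0 < e by rewrite /e mulr_gt0.
  have bound := cP n W S n e _ _ n0 nW n0 (leqnn n) (ltW e0) _ (psd_separates n ep0 (clip_le _ _ ep1) n0 p1) _ solv.
  apply: (scale c _ _ _ _ _ c0 (lnW_ge0 _ _ n0 nW) _ (bound _ _)).
  + rewrite -mulrA ler_pM2l //.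
    have nt : n%:R `^ (2 - 4 / p) = n%:R ^+ 2 / t ^+ 4 :> R.
      apply/(canRL (mulfK _)); first by rewrite gt_eqF // exprn_gt0.
      rewrite -!powR_mulrn ?powR_ge0 // /t -powRrM -powRD; last by rewrite pnatr_eq0 -lt0n n0 implybT.
      by congr (_ `^ _); field.
    rewrite nt; set m := Num.min _ _.
    (* For [p > 2] the whole dimension [d = n] is used even if [e = eps n^(1/p)] is large. For
       [e <= 1] the ratio is of order [n^2]; otherwise it is at least [n^2 / (2 e)^4], of order
       [eps^-4 n^(2 - 4/p)]. *)
    have [h|h] := leP e 1.
      apply: (dimension_ratio_ge (ltW e0) h).
      have -> : 16^-1 * m * (1 + 1) ^+ 4 = m by field.
      by rewrite ge_min lexx orbT.
    apply: (dimension_ratio_ge (ltW e0) (lexx e)).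
    apply: (@le_trans _ _ (16^-1 * m * (2 * e) ^+ 4)).
      rewrite ler_wpM2l ?lerXn2r ?nnegrE //; try lra.
      rewrite mulr_ge0 ?invr_ge0 // le_min sqr_ge0 andbT.
      by rewrite mulr_ge0 ?invr_ge0 ?divr_ge0 ?exprn_ge0 ?(ltW ep0) ?(ltW t0).
    apply: (@le_trans _ _ (16^-1 * (eps ^- 4 * (n%:R ^+ 2 / t ^+ 4)) * (2 * e) ^+ 4)).
      apply: ler_wpM2r; first by apply: exprn_ge0; apply: mulr_ge0 => //; exact: ltW.
      by apply: ler_wpM2l; rewrite ?invr_ge0 // ge_min lexx.
    by rewrite le_eqVlt; apply/orP; left; apply/eqP; rewrite /e; field; rewrite !gt_eqF.
  + have ts : t <= Num.sqrt n%:R.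
      rewrite -powR12_sqrt // /t ler_powR // lef_pV2 ?posrE //; lra.
    have : eps * t <= 1 * t by rewrite ler_wpM2r // ltW.
    have := sqrtr_ge0 (n%:R : R); rewrite /e; lra.
  + exists (eps * 1%:R `^ p^-1); last exact: (psd_separates n ep0 (clip_le _ _ ep1) (ltn0Sn 0) p1).
    by rewrite pow1 mulr1; lra.
- move=> eps1 e1; have [c c0 cP] := separation_bound (clip _ e1).
  exists (c * 16^-1); first by rewrite mulr_gt0.
  move=> n W S eps n0 nW /andP[ep0 ep1] solv.
  have epl := eps_lt1 _ _ e1 ep1.
  have n1 : 1 <= n%:R :> R by rewrite ler1n.
  have bound := cP n W S n eps _ _ n0 nW n0 (leqnn n) (ltW ep0) _ (psd_separates_infty n ep0 (clip_le _ _ ep1) n0) _ solv.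
  apply: (scale c _ _ _ _ _ c0 (lnW_ge0 _ _ n0 nW) _ (bound _ _)).
  + rewrite -mulrA ler_pM2l //; apply: (dimension_ratio_ge (ltW ep0) epl).
    have -> : 16^-1 * n%:R ^+ 2 * (1 + 1) ^+ 4 = n%:R ^+ 2 :> R by field.
    by [].
  + have : Num.sqrt 1 <= Num.sqrt n%:R :> R by rewrite ler_wsqrtr.
    by rewrite sqrtr1; lra.
  + exists eps; last exact: (psd_separates_infty n ep0 (clip_le _ _ ep1) (ltn0Sn 0)).
    by lra.
Qed.
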